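(* Let $m\ge2$, $N\ge1$. Let $\alpha$ be a standard parity type and let $\gamma\in\mathbb{N}_0^N$. Then $$\left(x^\alpha\zeta_\gamma(y),x^\alpha\zeta_\gamma(y)\right)_k=m^{|\alpha|+m|\gamma|}\prod_{i=1}^{m-1}\left((N-1)\kappa_0+\frac im+\kappa_i\right)_{(\gamma+\chi_i(\alpha))^+}\cdot(N\kappa_0+1)_{\gamma^+}\,\frac{h(\gamma^+,\kappa_0+1)}{h(\gamma^+,1)}\,\mathcal{E}_+(\gamma)\,\mathcal{E}_-(\gamma).$$
   Context: Dunkl operators of $G(m,1,N)$. Fix $m\ge2$, $\eta=e^{2\pi\mathrm{i}/m}$, $x=(x_1,\dots,x_N)$, $x^\alpha=\prod x_i^{\alpha_i}$, $|\alpha|=\sum\alpha_i$ for $\alpha\in\mathbb{N}_0^N$. $w\in S_N$ acts on polynomials by $w(x^\alpha)=x^{w\alpha}$, $(w\alpha)_i=\alpha_{w^{-1}(i)}$; $(i,j)$ is the transposition. $\tau_i$ acts by $\tau_ix^\alpha=\eta^{\alpha_i}x^\alpha$. With parameters $\kappa=(\kappa_0,\dots,\kappa_{m-1})$ (real), for $1\le i\le N$, $$T_i=\frac{\partial}{\partial x_i}+\kappa_0\sum_{j\ne i}\sum_{s=0}^{m-1}\frac{1-\tau_i^{-s}(i,j)\tau_i^s}{x_i-\eta^sx_j}+\sum_{t=1}^{m-1}\kappa_t\sum_{s=0}^{m-1}\frac{\eta^{-st}\tau_i^s}{x_i}$$ (divisions after applying numerators). The $T_i$ commute. The pairing is $(p,q)_k=p^*(T)q(x)|_{x=0}$,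 where $p^*$ is $p$ with conjugated coefficients and $p^*(T)$ is obtained by substituting $T_i$ for $x_i$. Put $y=(y_1,\dots,y_N)=(x_1^m,\dots,x_N^m)$. A parity type is $\alpha\in\mathbb{N}_0^N$ with $0\le\alpha_i<m$ for all $i$; it is standard if $\alpha_1\ge\alpha_2\ge\dots\ge\alpha_N$. Nonsymmetric Jack polynomials: on polynomials in $y$ (with $(i,j)$ permuting the $y$'s) let $$\mathcal{D}_ig=\frac{\partial g}{\partial y_i}+\kappa_0\sum_{j\ne i}\frac{g-(i,j)g}{y_i-y_j},\qquad \mathcal{U}_i^A=\mathcal{D}_iy_i+\kappa_0-\kappa_0\sum_{j<i}(i,j),$$ where $\mathcal{D}_iy_i$ means multiply by $y_i$ and then apply $\mathcal{D}_i$. For $\mu\in\mathbb{N}_0^N$, $\mu^+$ is the partition (nonincreasing rearrangement) of $\mu$. $\mu\succ\nu$ means $\mu\neq\nu$ and $\sum_{i\le j}\mu_i\ge\sum_{i\le j}\nu_i$ for every $j$; $\mu\vartriangleright\nu$ means $|\mu|=|\nu|$ and either $\mu^+\succ\nu^+$, or $\mu^+=\nu^+$ and $\mu\succ\nu$. Polynomials $p_\mu$ are defined by $$\sum_{\mu}p_\mu(y)z^\mu=\prod_{i=1}^N\Big\{(1-y_iz_i)^{-1}\prod_{j=1}^N(1-y_jz_i)^{-\kappa_0}\Big\}.$$ $\zeta_\mu$ is the unique simultaneous eigenfunction of $\mathcal{U}_1^A,\dots,\mathcal{U}_N^A$ of the form $\zeta_\mu=p_\mu+\sum_{\nu\vartriangleright\mu}B(\nu,\mu)p_\nu$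 with $B(\nu,\mu)\in\mathbb{Q}(\kappa_0)$; it satisfies $\mathcal{U}_i^A\zeta_\mu=\xi_i(\mu)\zeta_\mu$ with $$\xi_i(\mu)=\kappa_0\big(N-\#\{j:\mu_j>\mu_i\}-\#\{j:j<i,\ \mu_j=\mu_i\}\big)+\mu_i+1.$$ Further notation: for $\varepsilon=\pm$, $\mathcal{E}_\varepsilon(\gamma)=\prod\left\{1+\frac{\varepsilon\kappa_0}{\xi_j(\gamma)-\xi_i(\gamma)}:i<j,\ \gamma_i<\gamma_j\right\}$. For a partition $\lambda$ (with $N$ parts, zeros allowed), $(t)_\lambda=\prod_{i=1}^N(t-(i-1)\kappa_0)_{\lambda_i}$, where $(a)_0=1$, $(a)_{n+1}=(a)_n(a+n)$; and $$h(\lambda,t)=\prod_{i:\lambda_i>0}\ \prod_{j=1}^{\lambda_i}\big(\lambda_i-j+t+\kappa_0\,\#\{s:s>i,\ j\le\lambda_s\}\big).$$ For $1\le i\le m-1$ and $0\le l\le m-1$, $\chi_i(l)=1$ if $l\ge i$ and $\chi_i(l)=0$ if $l<i$; $\chi_i(\alpha)\in\mathbb{N}_0^N$ is defined coordinatewise. The identity is understood as an identity of rational functions in $\kappa_0,\dots,\kappa_{m-1}$ (valid at real parameter values where the quantities involved are defined). *)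

(* Defs.v *)
From HB Require Import structures.
From mathcomp Require Import all_boot all_order all_algebra.
From mathcomp Require Import fraction perm complex.
From mathcomp Require Import classical_sets reals.
From mathcomp Require trigo.
From mathcomp Require Import mpoly.

Set Implicit Arguments.
Unset Strict Implicit.
Unset Printing Implicit Defensive.

Import Order.TTheory GRing.Theory Num.Theory.
Local Open Scope ring_scope.

(* Indices start at 0: the variable x_i (1 <= i <= N) is 'X_(i - 1), and a
   composition in N_0^N is an element of 'X_{1..N}. *)

Definition standard_parity_type (m N : nat) (alpha : 'X_{1..N}) : Prop :=
  (forall i, alpha i < m)%N /\
  (forall i j : 'I_N, (i <= j)%N -> (alpha j <= alpha i)%N).

Definition mnm_plus (N : nat) (mu : 'X_{1..N}) : 'X_{1..N} :=
  [multinom of sort geq mu].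

Definition dominates (N : nat) (mu nu : 'X_{1..N}) : bool :=
  (mu != nu) &&
  [forall j : 'I_N, \sum_(i < N | i <= j) nu i <= \sum_(i < N | i <= j) mu i]%N.

Definition triangle_gt (N : nat) (mu nu : 'X_{1..N}) : bool :=
  (mdeg mu == mdeg nu) &&
  (dominates (mnm_plus mu) (mnm_plus nu)
   || (mnm_plus mu == mnm_plus nu) && dominates mu nu).

Definition chi (N : nat) (i : nat) (alpha : 'X_{1..N}) : 'X_{1..N} :=
  [multinom nat_of_bool (i <= alpha j)%N | j < N].

Section Scalars.
Variables (F : fieldType) (N : nat).
Implicit Types (k t : F) (mu : 'X_{1..N}).

Definition pochhammer (a : F) (n : nat) : F := \prod_(j < n) (a + j%:R).

Definition pochhammer_part k t mu : F :=
  \prod_(i < N) pochhammer (t - i%:R * k) (mu i).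

Definition hook k mu t : F :=
  \prod_(i < N | (0 < mu i)%N) \prod_(1 <= j < (mu i).+1)
    ((mu i - j)%N%:R + t + k * #|[set s : 'I_N | (i < s)%N && (j <= mu s)%N]|%:R).

Definition xi k mu (i : 'I_N) : F :=
  k * (N%:R - #|[set j : 'I_N | (mu i < mu j)%N]|%:R
            - #|[set j : 'I_N | (j < i)%N && (mu j == mu i)]|%:R)
  + (mu i)%:R + 1.

(* [eps] is the sign, taken to be 1 or -1. *)
Definition Efactor (eps k : F) mu : F :=
  \prod_(i < N) \prod_(j < N | (i < j)%N && (mu i < mu j)%N)
    (1 + eps * k / (xi k mu j - xi k mu i)).

End Scalars.

Section Quotient.
Variables (F : fieldType) (N : nat).

(* The exact quotient p / q: the unique r with r * q = p when q != 0 divides p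
   (the only case that occurs below), and 0 when q does not divide p. *)
Definition exact_quo (p q : {mpoly F[N]}) : {mpoly F[N]} :=
  xget 0 (fun r => r * q = p).

End Quotient.

Section Jack.
Variables (F : fieldType) (N : nat).
Implicit Types (k c : F) (i j : 'I_N) (g : {mpoly F[N]}).

Definition swap i j g : {mpoly F[N]} := msym (tperm i j) g.

Definition opD k i g : {mpoly F[N]} :=
  g^`M(i) + k *: \sum_(j < N | j != i) exact_quo (g - swap i j g) ('X_i - 'X_j).

Definition opU k i g : {mpoly F[N]} :=
  opD k i ('X_i * g) + k *: g - k *: \sum_(j < N | (j < i)%N) swap i j g.

(* Formal power series in z_1, ..., z_N with coefficients in F[y_1, ..., y_N],
   as functions from exponents of z to coefficients. *)
Definition zseries := 'X_{1..N} -> {mpoly F[N]}.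

Definition zseries1 : zseries := fun mu => if mu == 0%MM then 1 else 0.

Definition zseriesM (f g : zseries) : zseries := fun mu =>
  \sum_(a : 'X_{1..N < (mdeg mu).+1} | (a <= mu)%MM) f a * g (mu - a)%MM.

(* (1 - y_j z_i)^(-c) = \sum_n (c)_n / n! y_j^n z_i^n *)
Definition zseries_binom c j i : zseries := fun mu =>
  if mu == (U_(i) *+ mu i)%MM
  then (pochhammer c (mu i) / (mu i)`!%:R) *: 'X_j ^+ (mu i) else 0.

Definition pJack k : zseries :=
  \big[zseriesM/zseries1]_(i < N)
    zseriesM (zseries_binom 1 i i)
             (\big[zseriesM/zseries1]_(j < N) zseries_binom k j i).

End Jack.

(* Q(kappa_0), with kappa_0 an indeterminate *)
Definition ratfun := {fraction {poly rat}}.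
Definition kgen : ratfun := tofrac 'X.

Definition is_nonsym_jack (N : nat) (mu : 'X_{1..N}) (Z : {mpoly ratfun[N]}) :
    Prop :=
  [/\ Z != 0,
      forall i : 'I_N, exists c : ratfun, opU kgen i Z = c *: Z
    & exists B : 'X_{1..N} -> ratfun,
        Z = pJack kgen mu
            + \sum_(nu : 'X_{1..N < (mdeg mu).+1} | triangle_gt nu mu)
                B nu *: pJack kgen nu].

(* The rational function f is defined at c and takes the value v there. *)
Definition ratfun_value (C : numFieldType) (f : ratfun) (c v : C) : Prop :=
  exists a b : {poly rat},
    [/\ f = tofrac a / tofrac b,
        (map_poly ratr b).[c] != 0
      & v = (map_poly ratr a).[c] / (map_poly ratr b).[c]].

(* Z has no pole at kappa_0 = c, and z is its specialization there. *)
Definition specializes (C : numFieldType) (N : nat) (Z : {mpoly ratfun[N]})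
    (c : C) (z : {mpoly C[N]}) : Prop :=
  forall a : 'X_{1..N}, ratfun_value Z@_a c z@_a.

Section Dunkl.
Variables (R : realType) (m N : nat) (kappa : m.-tuple R).
Local Notation C := (R[i]).
Implicit Types (i j : 'I_N) (p q : {mpoly C[N]}).

(* exp(2 pi i / m) *)
Definition eta : C :=
  (trigo.cos (2 * trigo.pi / m%:R) +i* trigo.sin (2 * trigo.pi / m%:R))%C.

(* tau i s is the power tau_i^s *)
Definition tau i (s : int) p : {mpoly C[N]} :=
  \sum_(a <- msupp p) (eta ^ (s * (a i)%:Z) * p@_a) *: 'X_[a].

Definition dunkl i p : {mpoly C[N]} :=
  p^`M(i)
  + (kappa`_0)%:C%C *:
      (\sum_(j < N | j != i) \sum_(s < m)
         exact_quo (p - tau i (- s%:Z) (swap i j (tau i s%:Z p)))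
                   ('X_i - eta ^+ s *: 'X_j))
  + \sum_(1 <= t < m) (kappa`_t)%:C%C *:
      exact_quo (\sum_(s < m) eta ^- (s * t) *: tau i s%:Z p) 'X_i.

(* T^a = T_1^(a_1) ... T_N^(a_N); the T_i commute, so the order of
   composition does not matter. *)
Definition dunkl_mnm (a : 'X_{1..N}) q : {mpoly C[N]} :=
  foldr (fun i f => iter (a i) (dunkl i) f) q (enum 'I_N).

Definition pairing p q : C :=
  (\sum_(a <- msupp p) (p@_a)^* *: dunkl_mnm a q).@[fun=> 0].

End Dunkl.

(* z(y) with y_i = x_i^m *)
Definition subst_pow (C : comNzRingType) (m N : nat) (z : {mpoly C[N]}) :
    {mpoly C[N]} :=
  z \mPo [tuple 'X_i ^+ m | i < N].

(* Main.v *)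
From HB Require Import structures.
Require Import Defs.
From mathcomp Require Import all_boot all_order all_algebra.
From mathcomp Require Import fraction perm ring zify.
From mathcomp Require Import ssrcomplements complex reals mpoly.
From mathcomp Require trigo.

(* On the states x^b h(y), 0 <= b_i < m, a Dunkl operator multiplies x^b by one
   power of x_i (cyclically, modulo m) and acts on h by a type A operator: by m
   times D_i when b_i = 0, and by m (b_i/m + kappa_{b_i} + y_i D_i + exchange
   terms) otherwise.  On an eigenfunction z of the U_i^A the exchange terms that
   occur while x^alpha is lowered to 1 are those of U_i^A - 1 - kappa_0, so that
   <x^alpha z, x^alpha z> is an explicit scalar times <z, z>.

   For generic kappa_0, <z, z> is computed by induction for the U_i^A attached to
   an arbitrary order of the indices.  Exchanging two adjacent indices replaces z
   by z - r (i,j) z and multiplies the norm by 1 - r^2; when the exponents are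
   nondecreasing along the order, D_i for the last index i maps z to a multiple
   of an eigenfunction of smaller degree, for the order in which i has become the
   first index.  That each z has the expected leading coefficient and spectrum
   comes from the symmetry of the coefficients of p_mu, which makes the
   coefficients of z in the basis p_mu a left eigenvector of a triangular matrix.

   For the given kappa_0 the identity is first read over C(t), after clearing the
   denominators of zeta, and then evaluated at t = kappa_0. *)

Set Implicit Arguments.
Unset Strict Implicit.
Unset Printing Implicit Defensive.
Import Order.TTheory GRing.Theory Num.Theory.
Local Open Scope ring_scope.

(** * Divided differences and Dunkl operators of type A *)

(** Neither symmetry of the form nor self-adjointness of the U_i^A is established beforehand. The
    norm computation only needs that the eigenfunction z at hand satisfies <z, U_i h> = e_i <z, h>
    for all h. This is proved together with the norm in one induction, from the invariance of the
    form under permutations and the adjointness of y_i and T_i^m.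

    Generic means that 1 and kappa_0 are linearly independent over the integers; then the scalars by
    which the induction divides are nonzero. A real kappa_0 may fail this, an indeterminate does
    not. The parameters kappa_1, ... stay constants, hence C(t) and not Q(t).

    The hook quotient and the factors E_+, E_- have one origin: a hook product for compositions that
    depends on the order of the indices. A swap of adjacent indices alters a single box, whose
    factor is an eigenvalue difference up to a multiple of kappa_0; lowering removes a single box.
    Sorting the composition into its partition then leaves one factor of E_+ and one of E_- per
    inversion. *)

Lemma mnm_ind (n : nat) (P : 'X_{1..n} -> Prop) : P 0%MM ->
  (forall i a, P a -> P (U_(i) + a)%MM) -> forall a, P a.
Proof.
move=> P0 PS a; elim: {a}(mdeg a) {-2}a (erefl (mdeg a)) => [|d IH] a da.
  by move/eqP: da; rewrite mdeg_eq0 => /eqP ->.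
have [i ai] : exists i, a i != 0%N.
  apply/existsP; apply: contra_eqT da; rewrite negb_exists => /forallP a0.
  by rewrite mdegE big1 // => i _; apply/eqP; rewrite -[_ == _]negbK a0.
have ea : a = (U_(i) + (a - U_(i)))%MM by rewrite addmC submK // lep1mP.
rewrite ea; apply: PS; apply: IH.
by move: da; rewrite {1}ea mdegD mdeg1 => -[].
Qed.

Section LinearExtension.
Variables (R : idomainType) (n : nat) (V : lmodType R).
Implicit Types (p q : {mpoly R[n]}) (f : 'X_{1..n} -> V).

Definition mlin f p : V := \sum_(a <- msupp p) p@_a *: f a.

Lemma mlinwE f k p : (msize p <= k)%N ->
  mlin f p = \sum_(a : 'X_{1..n < k}) p@_a *: f a.
Proof.
move=> le_pk; set I : subFinType _ := 'X_{1..n < k}.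
rewrite /mlin (big_mksub I) ?msupp_uniq //=; last first.
  by move=> x /msize_mdeg_lt /leq_trans; apply.
by rewrite big_rmcond //= => j /memN_msupp_eq0 ->; rewrite scale0r.
Qed.

Lemma mlin_is_linear f : linear (mlin f).
Proof.
move=> c p q /=.
pose k := maxn (msize (c *: p + q)) (maxn (msize p) (msize q)).
rewrite !(@mlinwE f k) ?leq_max ?leqnn ?orbT // scaler_sumr -big_split /=.
by apply: eq_bigr => a _; rewrite mcoeffD mcoeffZ scalerDl scalerA.
Qed.

HB.instance Definition _ f :=
  GRing.isLinear.Build R {mpoly R[n]} V _ (mlin f) (mlin_is_linear f).

Lemma mlinX f a : mlin f 'X_[a] = f a.
Proof. by rewrite /mlin msuppX big_seq1 mcoeffX eqxx scale1r. Qed.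

Lemma mlinD f p q : mlin f (p + q) = mlin f p + mlin f q.
Proof. exact: linearD. Qed.

Lemma mlinZ f x p : mlin f (x *: p) = x *: mlin f p.
Proof. exact: linearZ. Qed.

Lemma mlin0 f : mlin f 0 = 0.
Proof. exact: linear0. Qed.

End LinearExtension.

Section DividedDifference.
Variables (R : idomainType) (n : nat).
Implicit Types (p q : {mpoly R[n]}) (i j : 'I_n) (a : 'X_{1..n}).

Definition mrest i j a : 'X_{1..n} :=
  [multinom if (k == i) || (k == j) then 0%N else a k | k < n].

Lemma mrestE i j a : i != j ->
  a = (mrest i j a + (U_(i) *+ a i + U_(j) *+ a j))%MM.
Proof.
move=> ij; apply/mnmP => k; rewrite !(mnmDE, mulmnE, mnm1E, mnmE).
rewrite (eq_sym i k) (eq_sym j k).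
have [->|ki] := eqVneq k i; first by rewrite (negbTE ij) /=; lia.
by have [->|kj] := eqVneq k j; rewrite /=; lia.
Qed.

Lemma mpolyX_rest i j a : i != j ->
  'X_[a] = 'X_[mrest i j a] * ('X_i ^+ a i * 'X_j ^+ a j) :> {mpoly R[n]}.
Proof. by move=> ij; rewrite {1}(mrestE a ij) !mpolyXD -!mpolyXn. Qed.

Definition ddm i j a : {mpoly R[n]} :=
  'X_[mrest i j a] *
    (\sum_(k < a i - a j) 'X_i ^+ (a i - k.+1) * 'X_j ^+ (a j + k)
     - \sum_(k < a j - a i) 'X_i ^+ (a i + k) * 'X_j ^+ (a j - k.+1)).

End DividedDifference.

(* Locked: otherwise [linearD] and failing conversion tests unfold the operators
   to sums over the support. *)
HB.lock Definition sw (R : idomainType) (n : nat) (i j : 'I_n)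
  (p : {mpoly R[n]}) : {mpoly R[n]} := msym (tperm i j) p.
HB.lock Definition dd (R : idomainType) (n : nat) (i j : 'I_n)
  (p : {mpoly R[n]}) : {mpoly R[n]} := mlin (ddm R i j) p.

Section DividedDifferenceTheory.
Variables (R : idomainType) (n : nat).
Implicit Types (p q : {mpoly R[n]}) (i j : 'I_n) (a : 'X_{1..n}).

Lemma swE i j p : sw i j p = msym (tperm i j) p.
Proof. by rewrite unlock. Qed.

Lemma dd_is_linear i j : linear (@dd R n i j).
Proof. by move=> c p q; rewrite dd.unlock linearP. Qed.
HB.instance Definition _ i j :=
  GRing.isLinear.Build R {mpoly R[n]} {mpoly R[n]} _ (@dd R n i j) (dd_is_linear i j).

Lemma ddX i j a : dd i j 'X_[a] = ddm R i j a.
Proof. by rewrite dd.unlock; apply: mlinX. Qed.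

Lemma sw_is_linear i j : linear (@sw R n i j).
Proof. by move=> c p q; rewrite !swE linearP. Qed.
HB.instance Definition _ i j :=
  GRing.isLinear.Build R {mpoly R[n]} {mpoly R[n]} _ (@sw R n i j) (sw_is_linear i j).

Lemma swX i j a : i != j -> sw i j 'X_[a]
  = 'X_[mrest i j a] * ('X_i ^+ a j * 'X_j ^+ a i) :> {mpoly R[n]}.
Proof.
move=> ij; rewrite swE msymX tpermV !mpolyXn -!mpolyXD; congr 'X_[_].
apply/mnmP => k; rewrite !(mnmDE, mulmnE, mnm1E, mnmE).
rewrite (eq_sym i k) (eq_sym j k).
have [->|ki] := eqVneq k i; first by rewrite tpermL (negbTE ij) /=; lia.
have [->|kj] := eqVneq k j; first by rewrite tpermR /=; lia.
by rewrite tpermD 1?eq_sym //=; lia.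
Qed.

Lemma ddP i j p : i != j ->
  ('X_i - 'X_j) * dd i j p = p - sw i j p.
Proof.
move=> ij; elim/mpolyind: p => [|c a p _ _ IH].
  by rewrite !linear0 mulr0 addr0.
rewrite !(linearP (dd i j)) (linearP (sw i j)) /= mulrDr -scalerAr IH opprD addrACA -scalerBr.
congr (_ *: _ + _).
rewrite ddX swX // (mpolyX_rest R a ij).
rewrite -mulrBr /ddm mulrCA; congr (_ * _).
set x : {mpoly R[n]} := 'X_i; set y : {mpoly R[n]} := 'X_j.
have key (u v : {mpoly R[n]}) s t : (t <= s)%N ->
  (u - v) * \sum_(k < s - t) u ^+ (s - k.+1) * v ^+ (t + k)
  = u ^+ s * v ^+ t - u ^+ t * v ^+ s.
  move=> ts.
  have -> : \sum_(k < s - t) u ^+ (s - k.+1) * v ^+ (t + k)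
    = (u ^+ t * v ^+ t) * \sum_(k < s - t) u ^+ ((s - t).-1 - k) * v ^+ k.
    rewrite mulr_sumr; apply: eq_bigr => k _.
    rewrite mulrACA -!exprD; congr (u ^+ _ * _); have := ltn_ord k; lia.
  rewrite mulrCA -subrXX mulrBr mulrAC -exprD subnKC //.
  by rewrite -mulrA -exprD subnKC.
have [le|/ltnW le] := leqP (a j) (a i); rewrite (eqP le) big_ord0.
  by rewrite subr0 key.
rewrite sub0r mulrN -mulNr opprB.
under eq_bigr do rewrite mulrC.
by rewrite key // [_ ^+ a j * _]mulrC [_ ^+ a i * _]mulrC.
Qed.

End DividedDifferenceTheory.

Section SwapCalculus.
Variables (R : idomainType) (n : nat).
Implicit Types (p q r : {mpoly R[n]}) (i j l : 'I_n) (k : R).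

Lemma subX_neq0 i j : i != j -> 'X_i - 'X_j != 0 :> {mpoly R[n]}.
Proof.
move=> ij; apply/eqP => /(congr1 (mcoeff U_(i))).
rewrite mcoeffB !mcoeffXU eqxx eq_sym (negbTE ij) subr0 mcoeff0.
by move/eqP; rewrite oner_eq0.
Qed.

(** Over an integral domain this equation determines the quotient, so identities for [dd] are
    checked after multiplication by ['X_i - 'X_j]. *)
Lemma ddE i j p r : i != j ->
  ('X_i - 'X_j) * r = p - sw i j p -> dd i j p = r.
Proof. by move=> ij; rewrite -(ddP _ ij) => /(mulfI (subX_neq0 ij)). Qed.

Lemma swXU a b i : sw a b 'X_i = 'X_(tperm a b i) :> {mpoly R[n]}.
Proof.
rewrite swE msymX; congr 'X_[_]; apply/mnmP => l; rewrite !(mnmE, mnm1E).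
by rewrite -(inj_eq (@perm_inj _ (tperm a b))) permKV.
Qed.

Lemma sw_conj a b i j p :
  sw a b (sw i j p) = sw (tperm a b i) (tperm a b j) (sw a b p).
Proof. by rewrite !swE -!msymMm -tpermJ conjgE !mulgA mulgV mul1g. Qed.

Lemma swK i j : involutive (@sw R n i j).
Proof. by move=> p; rewrite !swE -msymMm tperm2 msym1m. Qed.

Lemma swC i j p : sw i j p = sw j i p.
Proof. by rewrite !swE tpermC. Qed.

Lemma swD i j p q : sw i j (p + q) = sw i j p + sw i j q.
Proof. exact: linearD. Qed.

Lemma swB i j p q : sw i j (p - q) = sw i j p - sw i j q.
Proof. exact: linearB. Qed.

Lemma swZ i j c p : sw i j (c *: p) = c *: sw i j p.
Proof. exact: linearZ. Qed.

Lemma swM i j p q : sw i j (p * q) = sw i j p * sw i j q.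
Proof. by rewrite !swE msymM. Qed.

Lemma sw1 i j : sw i j 1 = 1 :> {mpoly R[n]}.
Proof. by rewrite swE msym1. Qed.

Lemma sw_const i j k : sw i j k%:MP = k%:MP :> {mpoly R[n]}.
Proof. by rewrite -alg_mpolyC swZ sw1. Qed.

Lemma sw_mulC i j k p : sw i j (k%:MP * p) = k%:MP * sw i j p.
Proof. by rewrite swM sw_const. Qed.

Lemma sw_sum i j (I : Type) (s : seq I) P (F : I -> {mpoly R[n]}) :
  sw i j (\sum_(x <- s | P x) F x) = \sum_(x <- s | P x) sw i j (F x).
Proof. exact: linear_sum. Qed.

Lemma dd_mulXl i j p : i != j ->
  dd i j ('X_i * p) = 'X_i * dd i j p + sw i j p.
Proof.
move=> ij; apply: ddE => //; rewrite swM swXU tpermL.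
by rewrite mulrDr mulrCA (ddP _ ij); ring.
Qed.

Lemma dd_mulXr i j p : i != j ->
  dd i j ('X_j * p) = 'X_j * dd i j p - sw i j p.
Proof.
move=> ij; apply: ddE => //; rewrite swM swXU tpermR.
by rewrite mulrBr mulrCA (ddP _ ij); ring.
Qed.

Lemma dd_mul_sym i j p q : i != j -> sw i j p = p ->
  dd i j (p * q) = p * dd i j q.
Proof.
move=> ij sp; apply: ddE => //; rewrite swM sp.
by rewrite mulrCA (ddP _ ij); ring.
Qed.

Lemma dd_mulX i j l p : i != j -> l != i -> l != j ->
  dd i j ('X_l * p) = 'X_l * dd i j p.
Proof.
move=> ij li lj; rewrite dd_mul_sym // swXU tpermD // eq_sym //.
Qed.

Lemma dd_mulM i j p q : i != j ->
  dd i j (p * q) = dd i j p * q + sw i j p * dd i j q.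
Proof.
move=> ij; apply: ddE => //; rewrite swM.
rewrite mulrDr [X in X + _]mulrA [X in _ + X]mulrCA (ddP p ij) (ddP q ij); ring.
Qed.

Lemma sw_dd a b i j p : i != j ->
  sw a b (dd i j p) = dd (tperm a b i) (tperm a b j) (sw a b p).
Proof.
move=> ij; apply/esym/ddE; first by rewrite (inj_eq perm_inj).
by rewrite -!swXU -swB -swM (ddP _ ij) swB sw_conj.
Qed.

Lemma sw_mderiv a b i p : sw a b p^`M(i) = (sw a b p)^`M(tperm a b i).
Proof.
rewrite !swE; apply/mpolyP => m; rewrite mcoeff_sym !mcoeff_deriv mcoeff_sym mnmE.
congr (p@_ _ *+ _); apply/mnmP => l; rewrite !(mnmE, mnmDE, mnm1E).
by rewrite (inj_eq perm_inj).
Qed.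

End SwapCalculus.

(** Scalars act through [k%:MP] and not through [*:], so that [ring] can close the commutation
    identities. *)
HB.lock Definition opDl (R : idomainType) (n : nat) (k : R) (i : 'I_n)
    (p : {mpoly R[n]}) : {mpoly R[n]} :=
  p^`M(i) + k%:MP * \sum_(j | j != i) dd i j p.

Section DunklA.
Variables (R : idomainType) (n : nat).
Implicit Types (p q r : {mpoly R[n]}) (i j l : 'I_n) (k : R).

Lemma opDlE k i p :
  opDl k i p = p^`M(i) + k%:MP * \sum_(j | j != i) dd i j p.
Proof. by rewrite unlock. Qed.

Lemma opDl_is_linear k i : linear (@opDl R n k i).
Proof.
move=> c p q; rewrite !opDlE linearP /=.
under eq_bigr do rewrite linearP.
rewrite big_split /= -scaler_sumr mulrDr scalerDr -scalerAr.
by rewrite addrACA.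
Qed.
HB.instance Definition _ k i :=
  GRing.isLinear.Build R {mpoly R[n]} {mpoly R[n]} _ (opDl k i) (opDl_is_linear k i).

Lemma opDlD k i p q : opDl k i (p + q) = opDl k i p + opDl k i q.
Proof. exact: linearD. Qed.

Lemma opDlB k i p q : opDl k i (p - q) = opDl k i p - opDl k i q.
Proof. exact: linearB. Qed.

Lemma opDlZ k i c p : opDl k i (c *: p) = c *: opDl k i p.
Proof. exact: linearZ. Qed.

Lemma opDl_sum k i (I : Type) (s : seq I) P (F : I -> {mpoly R[n]}) :
  opDl k i (\sum_(x <- s | P x) F x) = \sum_(x <- s | P x) opDl k i (F x).
Proof. exact: linear_sum. Qed.

Lemma opDl_mulX k i p : opDl k i ('X_i * p) =
  'X_i * opDl k i p + p + k%:MP * \sum_(j | j != i) sw i j p.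
Proof.
rewrite !opDlE mderivM mderivX mnm1E eqxx scale1r.
have -> : (U_(i) - U_(i) = 0 :> 'X_{1..n})%MM.
  by apply/mnmP => l; rewrite mnmBE mnm0E subnn.
rewrite mpolyX0 mul1r.
under eq_bigr => j ji do rewrite dd_mulXl 1?eq_sym //.
by rewrite big_split /= -mulr_sumr; ring.
Qed.

Lemma opDl_mulXn k i j p : i != j -> opDl k j ('X_i * p) =
  'X_i * opDl k j p - k%:MP * sw i j p.
Proof.
move=> ij; rewrite !opDlE mderivM mderivX mnm1E (negbTE ij) scale0r mul0r add0r.
rewrite (bigD1 i) //= dd_mulXr 1?eq_sym // swC.
rewrite (eq_bigr (fun l => 'X_i * dd j l p)).
  by rewrite -mulr_sumr [in RHS](bigD1 i) //=; ring.
by move=> l /andP[lj li]; rewrite dd_mulX // eq_sym.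
Qed.

Lemma sw_opDl k a b i p :
  sw a b (opDl k i p) = opDl k (tperm a b i) (sw a b p).
Proof.
rewrite !opDlE swD sw_mulC sw_mderiv sw_sum.
congr (_ + _ * _).
rewrite [in RHS](reindex_inj (@perm_inj _ (tperm a b))) /=.
apply: eq_big => [j|j ji]; first by rewrite (inj_eq perm_inj).
by rewrite sw_dd // eq_sym.
Qed.

Lemma opDl_swapl k i j p :
  opDl k i (sw i j p) = sw i j (opDl k j p).
Proof. by rewrite sw_opDl tpermR. Qed.

Lemma opDl_swapr k i j p :
  opDl k j (sw i j p) = sw i j (opDl k i p).
Proof. by rewrite sw_opDl tpermL. Qed.

Lemma opDl_swap k i j l p : l != i -> l != j ->
  opDl k l (sw i j p) = sw i j (opDl k l p).
Proof. by move=> li lj; rewrite sw_opDl tpermD // eq_sym. Qed.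

Lemma opDl_mulC k i c p : opDl k i (c%:MP * p) = c%:MP * opDl k i p.
Proof. by rewrite !mul_mpolyC linearZ. Qed.

Lemma opDl_comm_mulX k i j q : i != j ->
  opDl k i (opDl k j q) = opDl k j (opDl k i q) ->
  opDl k i (opDl k j ('X_i * q)) = opDl k j (opDl k i ('X_i * q)).
Proof.
move=> ij IH; rewrite opDl_mulXn // opDlB opDl_mulC opDl_mulX.
rewrite opDl_swapl opDl_mulX !opDlD opDl_mulC opDl_mulXn //.
have ji : j != i by rewrite eq_sym.
rewrite (bigD1 j ji) /= [in RHS](bigD1 j ji) /=. rewrite opDlD opDl_swapr opDl_sum IH.
rewrite [in RHS](eq_bigr (fun l => sw i l (opDl k j q))); first by ring.
by move=> l /andP[li lj]; apply: opDl_swap; rewrite 1?eq_sym.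
Qed.

Lemma opDl1 k i : opDl k i 1 = 0.
Proof.
rewrite !opDlE mderivC add0r big1 ?mulr0 // => j ji.
by apply: ddE; rewrite ?[i == j]eq_sym // mulr0 sw1 subrr.
Qed.

(** Induction on monomials: both composites kill 1, and if they agree on q they agree on ['X_l * q],
    by the relations of [opDl] with multiplication by a variable. No iterated divided difference has
    to be expanded. *)
Lemma opDl_comm k i j p : opDl k i (opDl k j p) = opDl k j (opDl k i p).
Proof.
have [->//|ij] := eqVneq i j.
suff key a : opDl k i (opDl k j 'X_[a]) = opDl k j (opDl k i 'X_[a]).
  elim/mpolyind: p => [|c a p _ _ IH]; first by rewrite !(linear0 (opDl _ _)).
  by rewrite !opDlD !opDlZ key IH.
have step q l : opDl k i (opDl k j q) = opDl k j (opDl k i q) ->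
  opDl k i (opDl k j ('X_l * q)) = opDl k j (opDl k i ('X_l * q)).
  move=> IH; have [->|li] := eqVneq l i; first exact: opDl_comm_mulX.
  have [->|lj] := eqVneq l j.
    by apply/esym/opDl_comm_mulX; rewrite 1?eq_sym.
  have il : i != l by rewrite eq_sym.
  have jl : j != l by rewrite eq_sym.
  have ji : j != i by rewrite eq_sym.
  rewrite !(opDl_mulXn _ _ lj, opDl_mulXn _ _ li) !opDlB !opDl_mulC.
  rewrite !(opDl_mulXn _ _ lj, opDl_mulXn _ _ li).
  rewrite (opDl_swap _ _ il ij) (opDl_swap _ _ jl ji) IH; ring.
elim/mnm_ind: a => [|l a IH]; last by rewrite mpolyXD; apply: step.
by rewrite mpolyX0 !opDl1 !(linear0 (opDl _ _)).
Qed.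

End DunklA.

(** The part y_i D_i plus exchange terms of T_i on x^b h(y) when b_i > 0; [S] stands for the set of
    j with b_j < b_i. *)
HB.lock Definition opK (R : idomainType) (n : nat) (k : R) (S : pred 'I_n)
    (i : 'I_n) (h : {mpoly R[n]}) : {mpoly R[n]} :=
  'X_i * opDl k i h + k%:MP * \sum_(j | S j) sw i j h.

Section StateOperators.
Variables (R : idomainType) (n : nat).
Implicit Types (p h : {mpoly R[n]}) (i j l : 'I_n) (k c q : R) (S : pred 'I_n).

Lemma opKE k S i h : opK k S i h =
  'X_i * opDl k i h + k%:MP * \sum_(j | S j) sw i j h.
Proof. by rewrite unlock. Qed.

Lemma eq_opK k S1 S2 i h : S1 =1 S2 -> opK k S1 i h = opK k S2 i h.
Proof. by move=> eS; rewrite !opKE (eq_bigl _ _ eS). Qed.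

Lemma opK_is_linear k S i : linear (@opK R n k S i).
Proof.
move=> c p h; rewrite !opKE opDlD opDlZ.
under eq_bigr do rewrite swD swZ.
rewrite big_split /= -scaler_sumr !mulrDr -!scalerAr scalerDr.
by rewrite addrACA.
Qed.
HB.instance Definition _ k S i :=
  GRing.isLinear.Build R {mpoly R[n]} {mpoly R[n]} _ (opK k S i)
    (opK_is_linear k S i).

Lemma opKD k S i p h : opK k S i (p + h) = opK k S i p + opK k S i h.
Proof. exact: linearD. Qed.

Lemma opK_mulC k S i c h : opK k S i (c%:MP * h) = c%:MP * opK k S i h.
Proof. by rewrite !mul_mpolyC linearZ. Qed.

Lemma sw_opK k a b S i h :
  sw a b (opK k S i h) = opK k (fun j => S (tperm a b j)) (tperm a b i) (sw a b h).
Proof.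
rewrite !opKE swD swM sw_mulC swXU sw_opDl; congr (_ + _ * _).
rewrite sw_sum /= [in RHS](reindex_inj (@perm_inj _ (tperm a b))) /=.
by apply: eq_big => [j|j _]; rewrite ?tpermK // sw_conj.
Qed.

Lemma opK_split k S i j h : S j ->
  opK k S i h = opK k [pred l | S l && (l != j)] i h + k%:MP * sw i j h.
Proof. by move=> Sj; rewrite !opKE (bigD1 j) //=; ring. Qed.

(** The case b_j = 0 < b_i: T_j turns the exponent of x_j into m - 1, so j leaves the set of
    exponents smaller than b_i. *)
Lemma opDl_opK k S i j h : i != j -> S j -> ~~ S i ->
  opDl k j (opK k S i h) = opK k [pred l | S l && (l != j)] i (opDl k j h).
Proof.
move=> ij Sj Si; rewrite !opKE opDlD opDl_mulXn // opDl_mulC (bigD1 j) //=.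
rewrite opDlD opDl_swapr opDl_sum opDl_comm.
rewrite [in LHS](eq_bigr (fun l => sw i l (opDl k j h))); first by ring.
move=> l /andP[_ lj]; apply: opDl_swap; rewrite 1?eq_sym //.
Qed.

Local Notation k0 k i h := ('X_i * opDl k i h).

Lemma mulX_opDl_comm k i j h : i != j ->
  k0 k i (k0 k j h) = k0 k j (k0 k i h)
    + k%:MP * sw i j (k0 k i h - k0 k j h).
Proof.
move=> ij; have ji : j != i by rewrite eq_sym.
rewrite (opDl_mulXn _ _ ij) (opDl_mulXn _ _ ji) opDl_comm swB !swM.
rewrite !swXU tpermL tpermR (swC j i); ring.
Qed.

(** For fixed b, conjugation matches the term a = j on one side with the term a = b on the other,
    and conversely; the remaining transpositions are disjoint. *)
Lemma swap_sum_comm S S' i j h : i != j -> S' j -> ~~ S' i -> ~~ S j ->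
  {subset S <= S'} ->
  \sum_(a | S' a) sw i a (\sum_(b | S b) sw j b h)
  = \sum_(b | S b) sw j b (\sum_(a | S' a) sw i a h).
Proof.
move=> ij S'j S'i Sj SS'.
under eq_bigr do rewrite sw_sum.
under [in RHS]eq_bigr do rewrite sw_sum.
rewrite exchange_big /=; apply: eq_bigr => b Sb.
have bj : b != j by apply: contraNneq Sj => <-.
have bi : b != i by apply: contraNneq S'i => <-; apply: SS'.
have S'b : S' b && (b != j) by rewrite bj andbT; apply: SS'.
rewrite (bigD1 j S'j) /= (bigD1 b S'b) /= [in RHS](bigD1 j S'j) /=.
rewrite [in RHS](bigD1 b S'b) /=.
rewrite !addrA; congr (_ + _).
  rewrite [in RHS]addrC [sw j b (sw i b h)]sw_conj.
  rewrite [sw j b (sw i j h)]sw_conj.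
  by rewrite tpermL tpermR tpermD // eq_sym.
apply: eq_bigr => a /andP[/andP[S'a aj] ab].
by rewrite [RHS]sw_conj !tpermD // eq_sym.
Qed.

(** The case 0 < b_j < b_i. The commutator of y_i D_i and y_j D_j is cancelled by the term (i,j) of
    the exchange sum over [S'], which contains j. *)
Lemma opK_comm k S S' i j h : i != j -> S' j -> ~~ S' i -> ~~ S j ->
  {subset S <= S'} ->
  opK k S' i (opK k S j h) = opK k S j (opK k S' i h).
Proof.
move=> ij S'j S'i Sj SS'.
have Si : ~~ S i by apply: contra S'i; apply: SS'.
have ji : j != i by rewrite eq_sym.
pose A x := \sum_(b | S b) sw j b x : {mpoly R[n]}.
pose B x := \sum_(b | S' b) sw i b x : {mpoly R[n]}.
have AD c x y : A (x + c%:MP * y) = A x + c%:MP * A y.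
  rewrite /A mulr_sumr -big_split; apply: eq_bigr => b _ /=.
  by rewrite swD sw_mulC.
have BD c x y : B (x + c%:MP * y) = B x + c%:MP * B y.
  rewrite /B mulr_sumr -big_split; apply: eq_bigr => b _ /=.
  by rewrite swD sw_mulC.
have FA x : k0 k i (A x) = A (k0 k i x).
  rewrite /A opDl_sum mulr_sumr; apply: eq_bigr => b Sb.
  have bi : i != b by apply: contraNneq Si => ->.
  by rewrite swM swXU tpermD 1?eq_sym // opDl_swap // eq_sym.
have FB x : B (k0 k j x) =
    k0 k j (B x) + sw i j (k0 k j x) - sw i j (k0 k i x).
  rewrite /B opDl_sum mulr_sumr (bigD1 j S'j) /= [in RHS](bigD1 j S'j) /=.
  rewrite opDl_swapr [sw _ _ ('X_i * _)]swM swXU tpermL.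
  rewrite [in LHS](eq_bigr (fun b => 'X_j * opDl k j (sw i b x))).
    by ring.
  move=> b /andP[_ bj]; rewrite swM swXU tpermD // opDl_swap //.
  by rewrite eq_sym.
have eA x : opK k S j x = k0 k j x + k%:MP * A x by rewrite opKE.
have eB x : opK k S' i x = k0 k i x + k%:MP * B x by rewrite opKE.
rewrite !eA !eB BD AD !opDlD !opDl_mulC !mulrDr [B (A h)]swap_sum_comm // -/(A _).
rewrite mulX_opDl_comm // swB FB -FA; ring.
Qed.

(** The case b_i = b_j > 0: the index that is lowered first then has a smaller exponent than the
    other one, which is why the outer operator carries an enlarged set. *)
Lemma opK_comm_eq k c S i j h : i != j -> ~~ S i -> ~~ S j ->
  c%:MP * (c%:MP * h + opK k S j h) +
    opK k [pred l | (l == j) || S l] i (c%:MP * h + opK k S j h) =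
  c%:MP * (c%:MP * h + opK k S i h) +
    opK k [pred l | (l == i) || S l] j (c%:MP * h + opK k S i h).
Proof.
move=> ij Si Sj; have ji : j != i by rewrite eq_sym.
have H x y g : x != y -> ~~ S y -> opK k [pred l | (l == y) || S l] x g =
    opK k S x g + k%:MP * sw x y g.
  move=> xy Sy; rewrite (@opK_split k _ x y) /= ?eqxx //; congr (_ + _).
  apply: eq_opK => l /=; have [->|] := eqVneq l y; last by rewrite andbT.
  by rewrite (negbTE Sy).
rewrite !opKD !opK_mulC (@opK_comm k S) //=; first last.
- by move=> l Sl; apply/orP; right.
- by rewrite negb_or ij.
- by rewrite eqxx.
rewrite !H // opKD opK_mulC !(swC j i).
have -> : opK k S j (sw i j h) = sw i j (opK k S i h).
  rewrite sw_opK tpermL; apply: eq_opK => l.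
  by case: tpermP => [->|->|//]; rewrite (negbTE Si) (negbTE Sj).
ring.
Qed.

End StateOperators.

(** * The bilinear form *)

Section CommutingPowers.
Variables (n : nat) (T : Type) (f : 'I_n -> T -> T) (V : T -> Prop).
Hypothesis fV : forall i x, V x -> V (f i x).
Hypothesis fC : forall i j x, V x -> f i (f j x) = f j (f i x).
Implicit Types (a b : 'X_{1..n}) (i : 'I_n) (x : T) (s : seq 'I_n).

Definition fpow (g : 'I_n -> T -> T) a x :=
  foldr (fun i y => iter (a i) (g i) y) x (enum 'I_n).

Let fold a s x := foldr (fun i y => iter (a i) (f i) y) x s.

Lemma fold_valid a s x : V x -> V (fold a s x).
Proof.
by move=> Vx; elim: s => //= i s IH; elim: (a i) => //= d; apply: fV.
Qed.

Lemma iter_valid i d x : V x -> V (iter d (f i) x).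
Proof. by move=> Vx; elim: d => //= d; apply: fV. Qed.

Lemma iter_fold_comm i d a s x : V x ->
  iter d (f i) (fold a s x) = fold a s (iter d (f i) x).
Proof.
have C1 j e y : V y -> f i (iter e (f j) y) = iter e (f j) (f i y).
  by move=> Vy; elim: e => //= e <-; rewrite fC //; apply: iter_valid.
have C2 y : V y -> f i (fold a s y) = fold a s (f i y).
  by move=> Vy; elim: s => //= j s IH; rewrite C1 ?IH //; apply: fold_valid.
by move=> Vx; elim: d => //= d ->; rewrite C2 //; apply: iter_valid.
Qed.

(** Commutation is available only on the invariant set [V], which will be the set of states with all
    exponents below m. *)
Lemma fpowD a b x : V x -> fpow f (a + b)%MM x = fpow f a (fpow f b x).
Proof.
rewrite /fpow -!/(fold _ _ _) => Vx; elim: (enum _) => //= i s IH.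
rewrite mnmDE iterD -/(fold _ _ _) IH; congr iter.
by rewrite -/(fold _ _ _) iter_fold_comm //; apply: fold_valid.
Qed.

Lemma fpow0 x : fpow f 0%MM x = x.
Proof. by rewrite /fpow; elim: (enum _) => //= i s ->; rewrite mnm0E. Qed.

Lemma fpowMn i d x : fpow f (U_(i) *+ d)%MM x = iter d (f i) x.
Proof.
have H s : uniq s -> fold (U_(i) *+ d)%MM s x =
    if i \in s then iter d (f i) x else x.
  elim: s => //= j s IH /andP[js us]; rewrite IH // inE mulmnE mnm1E.
  have [->|] := eqVneq i j; first by rewrite (negbTE js) mul1n.
  by rewrite mul0n.
by rewrite /fpow -/(fold _ _ _) H ?enum_uniq // mem_enum.
Qed.

Lemma fpow1 i x : fpow f U_(i)%MM x = f i x.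
Proof. by rewrite -[U_(i)%MM]mulm1n fpowMn. Qed.

End CommutingPowers.

Section Form.
Variables (R : idomainType) (n m : nat) (k q : R) (c : nat -> R).
Hypothesis m_gt0 : (0 < m)%N.
Implicit Types (p h : {mpoly R[n]}) (i j l : 'I_n) (a b : 'X_{1..n}).

(* The state [(b, h)] stands for x^b h(y), y_i = x_i^m, with all [b i < m].  For
   the Dunkl operators of the theorem [q] is m and [c l] is l/m + kappa_l. *)
Definition low i b : 'X_{1..n} :=
  [multinom if j == i then (if b i == 0%N then m.-1 else (b i).-1) else b j | j < n].

Definition levelop i b h : {mpoly R[n]} :=
  if b i == 0%N then opDl k i h
  else (c (b i))%:MP * h + opK k (fun j => (b j < b i)%N) i h.

Definition dstep i (st : 'X_{1..n} * {mpoly R[n]}) :=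
  (low i st.1, q%:MP * levelop i st.1 st.2).

Definition reduced (st : 'X_{1..n} * {mpoly R[n]}) := forall i, (st.1 i < m)%N.

Lemma low_neq i j b : j != i -> low i b j = b j.
Proof. by move=> ji; rewrite mnmE (negbTE ji). Qed.

Lemma low_eq i b : low i b i = if b i == 0%N then m.-1 else (b i).-1.
Proof. by rewrite mnmE eqxx. Qed.

Lemma dstep_reduced i st : reduced st -> reduced (dstep i st).
Proof.
move=> rst j /=; have [->|ji] := eqVneq j i; last by rewrite low_neq.
by rewrite low_eq; have := rst i; case: eqP => _; lia.
Qed.

Lemma levelop_mulC i b x h : levelop i b (x%:MP * h) = x%:MP * levelop i b h.
Proof.
rewrite /levelop; case: ifP => _; first by rewrite opDl_mulC.
by rewrite opK_mulC; ring.
Qed.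

Lemma levelopD i b p h : levelop i b (p + h) = levelop i b p + levelop i b h.
Proof.
rewrite /levelop; case: ifP => _; first by rewrite opDlD.
by rewrite opKD; ring.
Qed.

Lemma levelop_comm i j b h : i != j -> (forall l, b l < m)%N ->
  levelop i (low j b) (levelop j b h) = levelop j (low i b) (levelop i b h).
Proof.
move=> ij bm; have ji : j != i by rewrite eq_sym.
have half (x y : 'I_n) : x != y -> (0 < b x)%N -> b y = 0%N ->
    levelop x (low y b) (levelop y b h) = levelop y (low x b) (levelop x b h).
  move=> xy bx by0; have yx : y != x by rewrite eq_sym.
  rewrite /levelop (low_neq b xy) (low_neq b yx) by0 eqxx.
  rewrite (negbTE (lt0n_neq0 bx)) opDlD opDl_mulC; congr (_ + _).
  rewrite opDl_opK ?ltnn // ?by0 //; apply: eq_opK => l /=.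
  have [->|ly] := eqVneq l y; last by rewrite (low_neq b ly) andbT.
  by rewrite low_eq by0 eqxx andbF; have := bm x; lia.
have lt (x y : 'I_n) : x != y -> (0 < b y)%N -> (b y < b x)%N ->
    levelop x (low y b) (levelop y b h) = levelop y (low x b) (levelop x b h).
  move=> xy by0 byx; have yx : y != x by rewrite eq_sym.
  have bx0 := ltn_trans by0 byx.
  rewrite /levelop (low_neq b xy) (low_neq b yx) !gtn_eqF //.
  pose Sx := fun l => (b l < b x)%N; pose Sy := fun l => (b l < b y)%N.
  rewrite (@eq_opK _ _ _ (fun l => (low y b l < b x)%N) Sx); last first.
    move=> l; rewrite /Sx; have [->|ly] := eqVneq l y; last by rewrite low_neq.
    by rewrite low_eq gtn_eqF //; lia.
  rewrite (@eq_opK _ _ _ (fun l => (low x b l < b y)%N) Sy); last first.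
    move=> l; rewrite /Sy; have [->|ly] := eqVneq l x; last by rewrite low_neq.
    by rewrite low_eq gtn_eqF //; lia.
  rewrite !opKD !opK_mulC (@opK_comm _ _ _ Sy Sx) /Sx /Sy ?ltnn //; first by ring.
  by move=> l; rewrite !unfold_in => /ltn_trans; apply.
have [bi0|bi0] := posnP (b i); have [bj0|bj0] := posnP (b j).
- rewrite /levelop (low_neq b ij) (low_neq b ji) bi0 bj0 !eqxx.
  exact: opDl_comm.
- exact/esym/half.
- exact: half.
have [bij|bij|bij] := ltngtP (b i) (b j); [exact/esym/lt|exact: lt|].
rewrite /levelop (low_neq b ij) (low_neq b ji) !gtn_eqF // bij.
pose S := fun l => (b l < b j)%N.
have Si : ~~ S i by rewrite /S bij ltnn.
have Sj : ~~ S j by rewrite /S ltnn.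
rewrite (@eq_opK _ _ _ (fun l => (low j b l < b j)%N) [pred l | (l == j) || S l]).
  rewrite (@eq_opK _ _ _ (fun l => (low i b l < b j)%N) [pred l | (l == i) || S l]).
    exact: opK_comm_eq.
  move=> l /=; have [->|li] := eqVneq l i; last by rewrite low_neq.
  by rewrite low_eq gtn_eqF //; lia.
move=> l /=; have [->|li] := eqVneq l j; last by rewrite low_neq.
by rewrite low_eq gtn_eqF //; lia.
Qed.

Lemma low_comm i j b : i != j -> low i (low j b) = low j (low i b).
Proof.
move=> ij; have ji : j != i by rewrite eq_sym.
apply/mnmP => l; have [->|li] := eqVneq l i.
  by rewrite low_eq !(low_neq _ ij) low_eq.
have [->|lj] := eqVneq l j; last by rewrite !low_neq.
by rewrite !(low_neq _ ji) !low_eq low_neq.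
Qed.

Lemma dstep_comm i j st : reduced st ->
  dstep i (dstep j st) = dstep j (dstep i st).
Proof.
have [->//|ij] := eqVneq i j.
case: st => b h rst; congr (_, _) => /=; first exact: low_comm.
by rewrite !levelop_mulC levelop_comm.
Qed.

Notation dpow := (fpow dstep).

Lemma reduced0 h : reduced (0%MM, h).
Proof. by move=> i; rewrite mnm0E. Qed.

Lemma dpowD a b st : reduced st -> dpow (a + b)%MM st = dpow a (dpow b st).
Proof. by apply: fpowD; [apply: dstep_reduced | apply: dstep_comm]. Qed.

Let lin_rel x (sp sh sc : 'X_{1..n} * {mpoly R[n]}) :=
  sp.1 = sh.1 /\ sc = (sh.1, x%:MP * sp.2 + sh.2).

Lemma dstep_linear i x sp sh sc :
  lin_rel x sp sh sc -> lin_rel x (dstep i sp) (dstep i sh) (dstep i sc).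
Proof.
move=> [E1 ->]; rewrite /lin_rel /dstep /= E1 levelopD levelop_mulC.
by split=> //; congr (_, _); ring.
Qed.

Lemma dpow_linear a b x p h :
  let sp := dpow a (b, p) in let sh := dpow a (b, h) in
  sp.1 = sh.1 /\ dpow a (b, x%:MP * p + h) = (sh.1, x%:MP * sp.2 + sh.2).
Proof.
rewrite /= -/(lin_rel x _ _ _) /fpow; elim: (enum _) => //= i s IH.
by elim: (a i) => //= d; apply: dstep_linear.
Qed.

Lemma dpow_scale a b x h : dpow a (b, x%:MP * h) =
  ((dpow a (b, h)).1, x%:MP * (dpow a (b, h)).2).
Proof.
(* The instance x = -1, p = h = 0 shows that the zero polynomial is sent to zero. *)
have [_ /(congr1 snd)] := dpow_linear a b (-1) 0 0.
rewrite mulr0 addr0 mpolyCN mpolyC1 mulN1r addNr /= => z0.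
by have [E] := dpow_linear a b x h 0; rewrite z0 !addr0 E.
Qed.

Lemma dpow0 st : dpow 0%MM st = st.
Proof. exact: fpow0. Qed.

Lemma dpow1 i st : dpow U_(i)%MM st = dstep i st.
Proof. exact: fpow1. Qed.

Lemma dpowMn i d st : dpow (U_(i) *+ d)%MM st = iter d (dstep i) st.
Proof. exact: fpowMn. Qed.

(* The pairing of p(y) and h(y), without the complex conjugation. *)
Definition form p h : R :=
  mlin (fun a => (dpow (a *+ m)%MM (0%MM, h)).2@_0%MM : R^o) p.

(** The level operator on x_i^d h(y), all other exponents being 0: the exchange sum then runs over
    all j != i, and y_i D_i plus kappa_0 times that sum is D_i y_i - 1. *)
Definition opA (d : nat) i h := (c d)%:MP * h + opDl k i ('X_i * h) - h.

Lemma opA_mulC d i x h : opA d i (x%:MP * h) = x%:MP * opA d i h.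
Proof. by rewrite /opA [X in opDl _ _ X]mulrCA opDl_mulC; ring. Qed.

Lemma foldr_opA_mulC i x h s :
  foldr (fun d x => opA d i x) (x%:MP * h) s
  = x%:MP * foldr (fun d x => opA d i x) h s.
Proof. by elim: s => //= e s ->; rewrite opA_mulC. Qed.

Definition opA_prod i h := foldr (fun d x => opA d i x) h (iota 1 m.-1).

(** The action of T_i^m on polynomials in y. The form makes it adjoint to multiplication by y_i. *)
Definition opM i h := (q ^+ m)%:MP * opA_prod i (opDl k i h).

Lemma iter_dstep_level i d h :
  iter d (dstep i) ((U_(i) *+ d)%MM, h) =
  (0%MM, (q ^+ d)%:MP * foldr (fun d x => opA d i x) h (iota 1 d)).
Proof.
elim: d h => [|d IH] h; first by rewrite mulm0n expr0 mpolyC1 mul1r.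
have -> : iota 1 d.+1 = iota 1 d ++ [:: d.+1] by rewrite -[X in iota 1 X]addn1 iotaD add1n.
rewrite iterSr foldr_cat /dstep /= /levelop mulmnE mnm1E eqxx mul1n /=.
have -> : low i (U_(i) *+ d.+1)%MM = (U_(i) *+ d)%MM.
  apply/mnmP => j; rewrite mnmE !mulmnE !mnm1E eqxx eq_sym.
  by case: (eqVneq i j) => _; rewrite ?mul0n // !mul1n.
have -> : (c d.+1)%:MP * h + opK k (fun j => ((U_(i) *+ d.+1)%MM j < d.+1)%N) i h
    = opA d.+1 i h.
  rewrite /opA opDl_mulX opKE.
  rewrite (eq_bigl (fun j => j != i)) => [|j]; first by ring.
  by rewrite mulmnE mnm1E eq_sym; case: eqP => _; rewrite ?mul1n ?ltnn.
rewrite -/(dstep _) IH.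
congr (_, _); rewrite exprSr mpolyCM -mulrA; congr (_ * _).
exact: foldr_opA_mulC.
Qed.

Lemma iter_dstep0 i h : iter m (dstep i) (0%MM, h) = (0%MM, opM i h).
Proof.
rewrite /opM /opA_prod -[X in iter X](prednK m_gt0) iterSr.
have -> : dstep i (0%MM, h) = ((U_(i) *+ m.-1)%MM, q%:MP * opDl k i h).
  rewrite /dstep /levelop /= mnm0E eqxx; congr (_, _); apply/mnmP => j.
  rewrite mnmE mulmnE mnm1E !mnm0E eqxx eq_sym.
  by case: eqP => _; rewrite ?mul1n ?mul0n.
rewrite iter_dstep_level foldr_opA_mulC; congr (_, _).
by rewrite mulrA -mpolyCM -exprSr prednK.
Qed.

Lemma formX a h : form 'X_[a] h = (dpow (a *+ m)%MM (0%MM, h)).2@_0%MM.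
Proof. by rewrite /form mlinX. Qed.

Lemma formDl p1 p2 h : form (p1 + p2) h = form p1 h + form p2 h.
Proof. by rewrite /form linearD. Qed.

Lemma form_mulCl x p h : form (x%:MP * p) h = x * form p h.
Proof. by rewrite /form mul_mpolyC linearZ. Qed.

Lemma form0l h : form 0 h = 0.
Proof. by rewrite /form linear0. Qed.

Lemma form_linr p x h1 h2 : form p (x%:MP * h1 + h2) = x * form p h1 + form p h2.
Proof.
rewrite /form /mlin mulr_sumr -big_split; apply: eq_bigr => a _ /=.
have /= [_ ->] := dpow_linear (a *+ m)%MM 0%MM x h1 h2.
by rewrite mcoeffD mul_mpolyC mcoeffZ /= !/(_ *: _) /= mulrDr mulrCA.
Qed.

Lemma form0r p : form p 0 = 0.
Proof.
by have := form_linr p (-1) 0 0; rewrite mulr0 addr0 mulN1r addNr.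
Qed.

Lemma formDr p h1 h2 : form p (h1 + h2) = form p h1 + form p h2.
Proof. by have := form_linr p 1 h1 h2; rewrite mpolyC1 !mul1r. Qed.

Lemma form_mulCr p x h : form p (x%:MP * h) = x * form p h.
Proof. by have := form_linr p x h 0; rewrite form0r !addr0. Qed.

Lemma form_mulX i p h : form ('X_i * p) h = form p (opM i h).
Proof.
elim/mpolyind: p => [|x a p _ _ IH]; first by rewrite mulr0 !form0l.
rewrite mulrDr !formDl IH -mul_mpolyC mulrCA !form_mulCl -mpolyXD !formX.
congr (_ * _ + _).
have -> : ((U_(i) + a) *+ m = a *+ m + U_(i) *+ m)%MM.
  by apply/mnmP => j; rewrite !(mulmnE, mnmDE) mulnDl addnC.
rewrite dpowD ?dpowMn ?iter_dstep0 //; exact: reduced0.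
Qed.

Definition swm x y a : 'X_{1..n} := [multinom a (tperm x y i) | i < n].

Lemma sw_mnm x y a : sw x y 'X_[a] = 'X_[swm x y a] :> {mpoly R[n]}.
Proof. by rewrite swE msymX tpermV. Qed.

Lemma dstep_sw x y i b h :
  dstep (tperm x y i) (swm x y b, sw x y h) =
  (swm x y (dstep i (b, h)).1, sw x y (dstep i (b, h)).2).
Proof.
rewrite /dstep /=; congr (_, _).
  apply/mnmP => j; rewrite !mnmE tpermK.
  by rewrite -(inj_eq (@perm_inj _ (tperm x y)) j) tpermK.
rewrite sw_mulC; congr (_ * _); rewrite /levelop mnmE tpermK.
case: ifP => _; first by rewrite sw_opDl.
rewrite swD sw_mulC sw_opK; congr (_ + _); apply: eq_opK => j.
by rewrite !mnmE.
Qed.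

Lemma dpow_sw x y a b h : (forall i, b i < m)%N ->
  dpow (swm x y a) (swm x y b, sw x y h) =
  (swm x y (dpow a (b, h)).1, sw x y (dpow a (b, h)).2).
Proof.
move=> bm; elim/mnm_ind: a => [|i a IH].
  have -> : swm x y 0 = 0%MM by apply/mnmP => i; rewrite !mnmE.
  by rewrite !dpow0.
have -> : (swm x y (U_(i) + a) = U_(tperm x y i) + swm x y a)%MM.
  apply/mnmP => j; rewrite !(mnmE, mnmDE).
  by rewrite -(inj_eq (@perm_inj _ (tperm x y)) i) tpermK.
rewrite !dpowD //; last by move=> j; rewrite mnmE.
rewrite IH !dpow1; case: (dpow a (b, h)) => b' h' /=.
exact: dstep_sw.
Qed.

Lemma form_sw x y p h : form (sw x y p) (sw x y h) = form p h.
Proof.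
elim/mpolyind: p => [|z a p _ _ IH]; first by rewrite linear0 !form0l.
rewrite swD -mul_mpolyC sw_mulC !formDl IH !form_mulCl sw_mnm !formX.
congr (_ * _ + _).
have -> : (swm x y a *+ m)%MM = swm x y (a *+ m)%MM.
  by apply/mnmP => j; rewrite !(mnmE, mulmnE).
have e0 : swm x y 0%MM = 0%MM by apply/mnmP => i; rewrite !mnmE.
rewrite -[X in (X, sw _ _ _)]e0 dpow_sw => [|i]; last by rewrite mnm0E.
rewrite /= swE mcoeff_sym; congr mcoeff.
by apply/mnmP => i; rewrite !mnmE.
Qed.

Lemma form1l h : form 1 h = h@_0%MM.
Proof.
rewrite -mpolyX0 formX.
have -> : (0 *+ m = 0 :> 'X_{1..n})%MM by apply/mnmP => i; rewrite mulmnE mnm0E.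
by rewrite dpow0.
Qed.

End Form.

(** * Arbitrary orders of the indices *)

(* The operators U_i^A for an arbitrary order of the indices, given by an
   injective [o]. *)
HB.lock Definition opUo (R : idomainType) (n : nat) (k : R) (o : 'I_n -> nat)
    (i : 'I_n) (h : {mpoly R[n]}) : {mpoly R[n]} :=
  opDl k i ('X_i * h) + k%:MP * h
    - k%:MP * \sum_(j | (o j < o i)%N) sw i j h.

Section OrderedCherednik.
Variables (R : idomainType) (n : nat) (k : R).
Implicit Types (p h : {mpoly R[n]}) (i j l : 'I_n) (o : 'I_n -> nat).

Lemma opUoE o i h : opUo k o i h = opDl k i ('X_i * h) + k%:MP * h
    - k%:MP * \sum_(j | (o j < o i)%N) sw i j h.
Proof. by rewrite unlock. Qed.

Lemma opUo_is_linear o i : linear (@opUo R n k o i).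
Proof.
move=> c p h; rewrite !opUoE mulrDr -scalerAr opDlD opDlZ.
under eq_bigr do rewrite swD swZ.
rewrite big_split /= -scaler_sumr !mulrDr -!scalerAr !scalerDr scalerN; ring.
Qed.
HB.instance Definition _ o i :=
  GRing.isLinear.Build R {mpoly R[n]} {mpoly R[n]} _ (@opUo R n k o i)
    (opUo_is_linear o i).

Lemma opUoB o i p h : opUo k o i (p - h) = opUo k o i p - opUo k o i h.
Proof. exact: linearB. Qed.

Lemma opUoZ o i c h : opUo k o i (c *: h) = c *: opUo k o i h.
Proof. exact: linearZ. Qed.

Lemma opUo_mulC o i c h : opUo k o i (c%:MP * h) = c%:MP * opUo k o i h.
Proof. by rewrite !mul_mpolyC opUoZ. Qed.

Lemma sw_opUo a b o i h : sw a b (opUo k o i h) =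
  opUo k (o \o tperm a b) (tperm a b i) (sw a b h).
Proof.
rewrite !opUoE swB swD !sw_mulC sw_opDl swM swXU sw_sum; congr (_ - _ * _).
rewrite [in RHS](reindex_inj (@perm_inj _ (tperm a b))) /=.
by apply: eq_big => [j|j _]; rewrite /= ?tpermK // sw_conj.
Qed.

Section AdjacentSwap.
Variables (o : 'I_n -> nat) (i j : 'I_n).
Hypothesis o_inj : injective o.
Hypothesis oij : (o i < o j)%N.
Hypothesis adj : forall l, ~~ ((o i < o l)%N && (o l < o j)%N).
Let o2 := o \o tperm i j.

Let ij : i != j. Proof. by apply: contraTneq oij => ->; rewrite ltnn. Qed.

Lemma adj_lt l : l != i -> l != j -> (o i < o l)%N = (o j < o l)%N.
Proof.
move=> li lj; apply/idP/idP => [il|jl]; last exact: ltn_trans jl.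
rewrite ltn_neqAle (inj_eq o_inj) eq_sym lj leqNgt.
by have := adj l; rewrite il.
Qed.

Lemma adj_gt l : l != i -> l != j -> (o l < o i)%N = (o l < o j)%N.
Proof.
move=> li lj; apply/idP/idP => [il|jl]; first exact: ltn_trans oij.
rewrite ltn_neqAle (inj_eq o_inj) li leqNgt.
by have := adj l; rewrite jl andbT.
Qed.

Lemma swap_order_lt a b : a != b -> (a, b) != (i, j) -> (a, b) != (j, i) ->
  (o2 a < o2 b)%N = (o a < o b)%N.
Proof.
rewrite /o2 /=.
case: (tpermP i j a) => [->|->|/eqP ai /eqP aj];
  case: (tpermP i j b) => [->|->|/eqP bi /eqP bj]; rewrite ?eqxx // => _ _ _.
- by rewrite adj_lt.
- by rewrite adj_lt.
- by rewrite adj_gt.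
by rewrite adj_gt.
Qed.

Lemma opUo_swap_order l h : l != i -> l != j ->
  opUo k o2 l h = opUo k o l h.
Proof.
move=> li lj; rewrite !opUoE; congr (_ - _ * _); apply: eq_bigl => x.
have [->|xl] := eqVneq x l; first by rewrite !ltnn.
by apply: swap_order_lt; rewrite // xpair_eqE (negbTE li, negbTE lj) ?andbF.
Qed.

Lemma opUo_swap_orderl h : opUo k o i h = opUo k o2 i h + k%:MP * sw i j h.
Proof.
rewrite !opUoE [in RHS](bigD1 j) /=; last by rewrite /o2 /= tpermL tpermR.
rewrite [in RHS](eq_bigl (fun l => o l < o i)%N) => [|l]; first by ring.
have [->|lj] := eqVneq l j; first by rewrite /= andbF ltnNge (ltnW oij).
rewrite /= andbT; have [->|li] := eqVneq l i; first by rewrite !ltnn.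
by apply: swap_order_lt; rewrite // xpair_eqE (negbTE li, negbTE lj).
Qed.

Lemma opUo_swap_orderr h : opUo k o j h = opUo k o2 j h - k%:MP * sw i j h.
Proof.
rewrite !opUoE (bigD1 i) //= (swC j i).
rewrite (eq_bigl (fun l => o2 l < o2 j)%N) => [|l]; first by ring.
have [->|li] := eqVneq l i.
  by rewrite /o2 /= ?andbF tpermL tpermR ltnNge (ltnW oij).
rewrite /= andbT; have [->|lj] := eqVneq l j; first by rewrite !ltnn.
by apply/esym/swap_order_lt; rewrite // xpair_eqE (negbTE li, negbTE lj).
Qed.

Lemma sw_opUo_l h : sw i j (opUo k o i h) = opUo k o2 j (sw i j h).
Proof. by rewrite sw_opUo tpermL. Qed.

Lemma sw_opUo_r h : sw i j (opUo k o j h) = opUo k o2 i (sw i j h).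
Proof. by rewrite sw_opUo tpermR. Qed.

Lemma sw_opUo_neq l h : l != i -> l != j ->
  sw i j (opUo k o l h) = opUo k o2 l (sw i j h).
Proof. by move=> li lj; rewrite sw_opUo tpermD // eq_sym. Qed.

Variables (Z : {mpoly R[n]}) (e : 'I_n -> R) (r : R).
Hypothesis Ze : forall l, opUo k o l Z = (e l)%:MP * Z.
Hypothesis er : r * (e i - e j) = k.
Let Z2 := Z - r%:MP * sw i j Z.
Let kE : k%:MP = r%:MP * ((e i)%:MP - (e j)%:MP) :> {mpoly R[n]}.
Proof. by rewrite -mpolyCB -mpolyCM er. Qed.

(** The operators of the indices i and j for the orders [o] and [o2] differ by k (i,j), while
    conjugation by (i,j) carries [o] to [o2] and exchanges i and j. Because the order changes, each
    index keeps its eigenvalue. *)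
Lemma eigen_swap l : opUo k o2 l Z2 = (e l)%:MP * Z2.
Proof.
rewrite /Z2 opUoB opUo_mulC; have [->|li] := eqVneq l i.
  rewrite -sw_opUo_r Ze sw_mulC.
  have -> : opUo k o2 i Z = (e i)%:MP * Z - k%:MP * sw i j Z.
    by rewrite -Ze opUo_swap_orderl addrK.
  by rewrite kE; ring.
have [->|lj] := eqVneq l j.
  rewrite -sw_opUo_l Ze sw_mulC.
  have -> : opUo k o2 j Z = (e j)%:MP * Z + k%:MP * sw i j Z.
    by rewrite -Ze opUo_swap_orderr subrK.
  by rewrite kE; ring.
by rewrite -sw_opUo_neq // opUo_swap_order // Ze sw_mulC; ring.
Qed.

Variables (m : nat) (q : R) (c : nat -> R).
Hypothesis m_gt0 : (0 < m)%N.
Hypothesis r1 : 1 - r ^+ 2 != 0.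
Notation form := (form m k q c).
Hypothesis Z2left : forall l h, form Z2 (opUo k o2 l h) = e l * form Z2 h.

(** Z2 + r (i,j) Z2 = (1 - r^2) Z, and (i,j) passes to the other argument by invariance of the
    form. *)
Let formZ h : (1 - r ^+ 2) * form Z h = form Z2 (h + r%:MP * sw i j h).
Proof.
rewrite formDr form_mulCr // -[form Z2 (sw _ _ _)](form_sw _ _ _ m_gt0 i j).
rewrite swK -form_mulCl -formDl -form_mulCl; congr (form _ _).
rewrite /Z2 swB sw_mulC swK mpolyCB mpolyC1 expr2 mpolyCM; ring.
Qed.

Lemma left_eigen_swap l h : form Z (opUo k o l h) = e l * form Z h.
Proof.
apply: (mulfI r1); rewrite [RHS]mulrCA !formZ.
rewrite !formDr !form_mulCr; have [->|li] := eqVneq l i.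
  rewrite sw_opUo_l opUo_swap_orderl formDr form_mulCr !Z2left -er; ring.
have [->|lj] := eqVneq l j.
  rewrite sw_opUo_r opUo_swap_orderr -mulNr -mpolyCN formDr form_mulCr !Z2left.
  rewrite -er; ring.
by rewrite sw_opUo_neq // -opUo_swap_order // !Z2left; ring.
Qed.

(** For the order [o2], (i,j) Z is an eigenfunction with e i and e j exchanged, hence orthogonal to
    Z2. *)
Lemma norm_swap : e i != e j -> (1 - r ^+ 2) * form Z Z = form Z2 Z2.
Proof.
move=> eij; rewrite formZ.
suff sZ0 : form Z2 (sw i j Z) = 0.
  have Z2E : Z2 = Z + (- r)%:MP * sw i j Z by rewrite mpolyCN mulNr.
  rewrite {3}Z2E.
  by rewrite !formDr !form_mulCr sZ0 !mulr0.
have := Z2left i (sw i j Z); rewrite -sw_opUo_r Ze sw_mulC form_mulCr.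
move/eqP; rewrite -subr_eq0 -mulrBl mulf_eq0 subr_eq0 eq_sym (negbTE eij) /=.
by move/eqP.
Qed.

End AdjacentSwap.
End OrderedCherednik.

Section Lowering.
Variables (R : idomainType) (n : nat) (k : R) (o : 'I_n -> nat) (t : 'I_n).
Hypothesis o_inj : injective o.
Hypothesis o_top : forall l, (o l <= o t)%N.
Implicit Types (p h : {mpoly R[n]}) (i j l : 'I_n).

(* Changing the order in this way takes the place of the cyclic permutation of
   the variables that accompanies the usual raising operator. *)
Definition order_cycle l := if l == t then 0%N else (o l).+1.
Local Notation o3 := order_cycle.

Lemma order_cycle_inj : injective o3.
Proof.
move=> x y; rewrite /o3; case: eqVneq => [->|xt]; case: eqVneq => [->|yt] //.
by case=> /o_inj.
Qed.

Lemma o_lt_top l : (o l < o t)%N = (l != t).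
Proof. by rewrite ltn_neqAle o_top andbT (inj_eq o_inj). Qed.

(** Commuting D_t with y_l costs -k (l,t), exactly the exchange term that appears when t moves to
    the front of the order. *)
Lemma opDl_opUo l h : l != t ->
  opDl k t (opUo k o l h) = opUo k o3 l (opDl k t h).
Proof.
move=> lt; rewrite !opUoE opDlB opDlD !opDl_mulC opDl_comm (opDl_mulXn _ _ lt).
rewrite opDlB opDl_mulC (swC l t) opDl_swapr -(swC l t) opDl_sum.
rewrite [in RHS](bigD1 t) /=; last by rewrite /o3 eqxx (negbTE lt).
rewrite [in RHS](eq_bigl (fun j => o j < o l)%N) => [|j]; last first.
  rewrite /o3 (negbTE lt); have [->|jt] := eqVneq j t; rewrite ?andbT //.
  by rewrite andbF ltnNge o_top.
rewrite [in LHS](eq_bigr (fun j => sw l j (opDl k t h))); first by ring.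
move=> j jl; apply: opDl_swap; rewrite eq_sym //.
by apply: contraTneq jl => ->; rewrite -leqNgt.
Qed.

Lemma opUo_top h : opUo k o t h = 'X_t * opDl k t h + (1 + k)%:MP * h.
Proof.
rewrite opUoE opDl_mulX (eq_bigl _ _ o_lt_top) mpolyCD mpolyC1; ring.
Qed.

Lemma opUo_bottom h : opUo k o3 t h = opDl k t ('X_t * h) + k%:MP * h.
Proof.
rewrite opUoE big1 ?mulr0 ?subr0 // => j.
by rewrite /o3 eqxx ltn0.
Qed.

Lemma opDl_opUo_top h :
  opDl k t (opUo k o t h) = opUo k o3 t (opDl k t h) + opDl k t h.
Proof.
by rewrite opUo_top opDlD opDl_mulC opUo_bottom mpolyCD mpolyC1; ring.
Qed.

Variables (Z : {mpoly R[n]}) (e : 'I_n -> R).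
Hypothesis Ze : forall l, opUo k o l Z = (e l)%:MP * Z.
Local Notation e3 := (fun l => e l - (l == t)%:R).

Lemma eigen_lower l :
  opUo k o3 l (opDl k t Z) = (e3 l)%:MP * opDl k t Z.
Proof.
have [->|lt] := eqVneq l t.
  apply/(addIr (opDl k t Z)); rewrite -opDl_opUo_top Ze opDl_mulC /= ?eqxx /= mulr1n.
  rewrite mpolyCB mpolyC1; ring.
by rewrite -opDl_opUo // Ze opDl_mulC /= ?(negbTE lt) subr0.
Qed.

Lemma mulX_opDl_eigen : 'X_t * opDl k t Z = (e3 t - k)%:MP * Z.
Proof.
apply/(addIr ((1 + k)%:MP * Z)); rewrite -opUo_top Ze -mulrDl -mpolyCD.
by rewrite /= ?eqxx /=; congr (_%:MP * _); ring.
Qed.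

Variables (m : nat) (q : R) (c : nat -> R) (Z' : {mpoly R[n]}) (x : R).
Hypothesis m_gt0 : (0 < m)%N.
Hypothesis Z'E : opDl k t Z = x%:MP * Z'.
Hypothesis xE : e t - 1 = x.
Hypothesis xk : x - k != 0.
Notation form := (form m k q c).
Hypothesis Z'left : forall l h, form Z' (opUo k o3 l h) = e3 l * form Z' h.

(** On the order [o3], [opA k c d t] is [opUo k o3 t] plus c d - k - 1, and the eigenvalue of index
    t on Z' is x: one factor for each level of T_t^m. *)
Let lowfactor := q ^+ m * \prod_(1 <= d < m) (c d + x - k - 1).

Let form_opM h : form Z' (opM m k q c t h) = lowfactor * form Z' (opDl k t h).
Proof.
rewrite /opM form_mulCr // /lowfactor -mulrA; congr (_ * _).
rewrite /opA_prod /index_iota subn1; elim: (iota _ _) => [|d s IH] /=.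
  by rewrite big_nil mul1r.
rewrite big_cons -mulrA -IH.
set g := foldr _ _ _.
have -> : opA k c d t g = opUo k o3 t g + (c d - k - 1)%:MP * g.
  rewrite /opA opUo_bottom !mpolyCB mpolyC1; ring.
by rewrite formDr form_mulCr Z'left /= ?eqxx /= xE; ring.
Qed.

(** (x - k) Z = y_t D_t Z = x y_t Z', and y_t passes to the other argument as T_t^m. *)
Let formZ h : (x - k) * form Z h = x * (lowfactor * form Z' (opDl k t h)).
Proof.
rewrite -form_mulCl -xE; have := mulX_opDl_eigen; rewrite /= ?eqxx /= => <-.
by rewrite Z'E mulrCA form_mulCl form_mulX // form_opM -xE.
Qed.

Lemma left_eigen_lower l h : form Z (opUo k o l h) = e l * form Z h.
Proof.
apply: (mulfI xk); rewrite [RHS]mulrCA !formZ; have [->|lt] := eqVneq l t.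
  by rewrite opDl_opUo_top formDr Z'left /= ?eqxx /=; ring.
by rewrite opDl_opUo // Z'left /= ?(negbTE lt) subr0; ring.
Qed.

Lemma norm_lower : (x - k) * form Z Z = x ^+ 2 * lowfactor * form Z' Z'.
Proof. by rewrite formZ Z'E form_mulCr; ring. Qed.

End Lowering.

(** * Triangularity and the basis p_mu *)

Section Triangularity.
Variables (R : idomainType) (n : nat) (k : R) (o : 'I_n -> nat).
Hypothesis o_inj : injective o.
Implicit Types (p : {mpoly R[n]}) (i j l : 'I_n) (a b g : 'X_{1..n}).

Definition sqdeg a := (\sum_i a i * a i)%N.
Definition oweight a := (\sum_i o i * a i)%N.
(* A linear extension, up to ties, of the order of the Jack polynomials: [sqdeg]
   increases with the dominance order of the sorted exponents and [oweight]
   decreases with the dominance order of compositions. *)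
Definition lower b a := (mdeg b == mdeg a) &&
  ((sqdeg b < sqdeg a) || (sqdeg b == sqdeg a) && (oweight a < oweight b))%N.

Lemma lower_trans b a g : lower a b -> lower b g -> lower a g.
Proof. by rewrite /lower; lia. Qed.

Lemma lowerxx a : lower a a = false.
Proof. by rewrite /lower; lia. Qed.

(** The position of i, counted from 0, in the decreasing sort of the exponents with ties broken by
    [o]. With it [ev] extends the eigenvalues xi_i to arbitrary orders. *)
Definition rk g i : nat :=
  #|[set j | (g i < g j)%N || (g j == g i) && (o j < o i)%N]|.
Definition ev g i : R := k * (n%:R - (rk g i)%:R) + (g i)%:R + 1.

Definition below a p := forall b, p@_b != 0 -> lower b a.

Lemma below0 a : below a 0.
Proof. by move=> b; rewrite mcoeff0 eqxx. Qed.

Lemma belowD a p r : below a p -> below a r -> below a (p + r).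
Proof.
move=> Hp Hr b; rewrite mcoeffD.
case: (eqVneq p@_b 0) => [->|/Hp //]; rewrite add0r; exact: Hr.
Qed.

Lemma below_mulC a c p : below a p -> below a (c%:MP * p).
Proof.
move=> Hp b; rewrite mcoeffCM => H; apply: Hp.
by apply: contraNneq H => ->; rewrite mulr0.
Qed.

Lemma belowN a p : below a p -> below a (- p).
Proof. by move=> Hp b; rewrite mcoeffN oppr_eq0; apply: Hp. Qed.

Lemma below_sum a (I : Type) (s : seq I) (P : pred I) (G : I -> {mpoly R[n]}) :
  (forall x, P x -> below a (G x)) -> below a (\sum_(x <- s | P x) G x).
Proof.
by move=> H; apply: (big_ind (below a)) => //; [apply: below0 | apply: belowD].
Qed.

Lemma belowX a b : lower b a -> below a 'X_[b].
Proof.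
by move=> lba d; rewrite mcoeffX; case: (b =P d) => [<-//|_]; rewrite eqxx.
Qed.

Section Pair.
Variables (i j : 'I_n) (a : 'X_{1..n}).
Hypothesis ij : i != j.

Definition transfer (s t : nat) : 'X_{1..n} :=
  [multinom if l == i then s else if l == j then t else a l | l < n].

Lemma mpolyX_transfer s t :
  'X_[mrest i j a] * ('X_i ^+ s * 'X_j ^+ t) = 'X_[transfer s t] :> {mpoly R[n]}.
Proof.
rewrite !mpolyXn -!mpolyXD; congr 'X_[_]; apply/mnmP => l.
rewrite !(mnmDE, mulmnE, mnm1E, mnmE) (eq_sym i) (eq_sym j).
have [->|li] := eqVneq l i; first by rewrite (negbTE ij) /=; lia.
by have [->|lj] := eqVneq l j; rewrite /=; lia.
Qed.

Lemma sum_transfer (G : 'I_n -> nat -> nat) s t :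
  (\sum_l G l (transfer s t l) + G i (a i) + G j (a j)
   = \sum_l G l (a l) + G i s + G j t)%N.
Proof.
have H (d : 'X_{1..n}) : (\sum_l G l (d l) = G i (d i) + (G j (d j) +
    \sum_(l | (l != i) && (l != j)) G l (d l)))%N.
  by rewrite (bigD1 i) //= (bigD1 j) //= eq_sym.
rewrite (H a) (H (transfer s t)) !mnmE !eqxx [j == i]eq_sym (negbTE ij) /=.
rewrite (eq_bigr (fun l => G l (a l))); first by lia.
by move=> l /andP[/negbTE li /negbTE lj]; rewrite mnmE li lj.
Qed.

Lemma transferE : transfer (a i) (a j) = a.
Proof.
apply/mnmP => l; rewrite mnmE.
by have [->//|_] := eqVneq l i; have [->|] := eqVneq l j.
Qed.

Lemma lower_transfer s t : (s + t = a i + a j)%N ->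
  (s * s + t * t < a i * a i + a j * a j)%N
  || (s == a j) && (t == a i) && (o i * a i + o j * a j < o i * a j + o j * a i)%N ->
  lower (transfer s t) a.
Proof.
move=> st H; rewrite /lower !mdegE /sqdeg /oweight.
have := sum_transfer (fun _ x => x) s t.
have := sum_transfer (fun _ x => x * x)%N s t.
have := sum_transfer (fun l x => o l * x)%N s t.
move=> /=; case/orP: H => [H|/andP[/andP[/eqP Es /eqP Et] H]]; first by lia.
by rewrite Es Et; lia.
Qed.

(** The exchange terms of U_i regrouped by pairs {i, j}, so that triangularity becomes a statement
    about two exponents. *)
Definition pairop (p : {mpoly R[n]}) : {mpoly R[n]} :=
  'X_i * dd i j p + (if (o i < o j)%N then sw i j p else 0).

Lemma mulX_ddX : 'X_i * dd i j 'X_[a] =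
  \sum_(d < a i - a j) 'X_[transfer (a i - d) (a j + d)]
  - \sum_(d < a j - a i) 'X_[transfer (a i + d.+1) (a j - d.+1)] :> {mpoly R[n]}.
Proof.
rewrite ddX /ddm mulrCA mulrBr !mulr_sumr mulrBr !mulr_sumr; congr (_ - _).
  apply: eq_bigr => d _; rewrite [X in _ * X]mulrA -exprS mpolyX_transfer.
  by congr 'X_[transfer _ _]; have := ltn_ord d; lia.
apply: eq_bigr => d _; rewrite [X in _ * X]mulrA -exprS mpolyX_transfer.
by congr 'X_[transfer _ _]; have := ltn_ord d; lia.
Qed.

Lemma swX_transfer : sw i j 'X_[a] = 'X_[transfer (a j) (a i)] :> {mpoly R[n]}.
Proof. by rewrite swX // mpolyX_transfer. Qed.

(** Every monomial that occurs moves the pair (a i, a j) within the interval between the two values,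
    with the same sum. Interior positions lower [sqdeg]; the only other ones are a and its swap, and
    the swapped monomial either cancels or is separated by [oweight]. *)
Lemma pairop_triangular : below a (pairop 'X_[a] -
  ((a j < a i)%N || (a j == a i) && (o i < o j)%N)%:R * 'X_[a]).
Proof.
rewrite /pairop mulX_ddX swX_transfer.
have oij : o i != o j by rewrite (inj_eq o_inj).
have [lt|lt|eqa] := ltngtP (a j) (a i).
- have -> : (a j - a i = 0)%N by lia.
  have -> : (a i - a j = (a i - a j).-1.+1)%N by lia.
  rewrite big_ord0 subr0 big_ord_recl subn0 addn0 transferE /= mul1r.
  rewrite -addrA [_ + (_ - _)]addrC addrA subrK; apply: belowD.
    case: ifP => oo; last exact: below0.
    apply/belowX/lower_transfer; first by lia.
    by rewrite !eqxx /=; nia.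
  apply: below_sum => d _; apply/belowX/lower_transfer.
    by have := ltn_ord d; rewrite /bump; lia.
  by have := ltn_ord d; rewrite /bump /=; nia.
- have -> : (a i - a j = 0)%N by lia.
  have -> : (a j - a i = (a j - a i).-1.+1)%N by lia.
  rewrite big_ord0 sub0r big_ord_recr /= mul0r subr0.
  have -> : (a i + (a j - a i).-1.+1 = a j)%N by lia.
  have -> : (a j - (a j - a i).-1.+1 = a i)%N by lia.
  rewrite opprD -addrA; apply: belowD.
    apply/belowN/below_sum => d _; apply/belowX/lower_transfer.
      by have := ltn_ord d; lia.
    by have := ltn_ord d; nia.
  case: ifP => oo; first by rewrite addNr; apply: below0.
  rewrite addr0; apply/belowN/belowX/lower_transfer; first by lia.
  by rewrite !eqxx /=; nia.
have -> : transfer (a j) (a i) = a by rewrite -[RHS]transferE eqa.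
rewrite eqa subnn !big_ord0 subr0 add0r /=.
case: ifP => oo; last by rewrite mul0r subr0; apply: below0.
by rewrite mul1r subrr; apply: below0.
Qed.

End Pair.

Lemma opUo_pairop i p : opUo k o i p =
  'X_i * p^`M(i) + (1 + k)%:MP * p + k%:MP * \sum_(j | j != i) pairop i j p.
Proof.
rewrite opUoE opDl_mulX opDlE /pairop big_split /= -big_mkcondr /= -mulr_sumr.
rewrite [\sum_(j | j != i) sw i j p](bigID (fun j => o i < o j)%N) /=.
rewrite [\sum_(j | (o j < o i)%N) _](eq_bigl (fun j => (j != i) && ~~ (o i < o j)%N)).
  by rewrite mpolyCD mpolyC1; ring.
move=> j; have [->|ji] := eqVneq j i; first by rewrite ltnn.
by rewrite -leqNgt [RHS]leq_eqVlt (inj_eq o_inj) (negbTE ji).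
Qed.

Lemma ev_count g i : ev g i = (g i)%:R + (1 + k) + k *
  \sum_(j | j != i) ((g j < g i)%N || (g j == g i) && (o i < o j)%N)%:R.
Proof.
have H : (rk g i + (1 + \sum_(j | j != i) ((g j < g i)%N || (g j == g i) && (o i < o j)%N)) = n)%N.
  rewrite /rk -sum1_card (big_mkcond (fun j => j \in _)) /= (bigD1 i) //=.
  rewrite inE !ltnn andbF /= add0n addnCA -big_split /=.
  transitivity #|'I_n|; last by rewrite card_ord.
  rewrite -[RHS]sum1_card [RHS](bigD1 i) //=; congr (_ + _)%N; apply: eq_bigr => j ji.
  rewrite inE; have oji : o j != o i by rewrite (inj_eq o_inj).
  by case: ifP; lia.
rewrite /ev -[X in k * (X%:R - _)]H !natrD natr_sum; ring.
Qed.

Lemma opUoX_triangular i a : below a (opUo k o i 'X_[a] - (ev a i)%:MP * 'X_[a]).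
Proof.
have -> : opUo k o i 'X_[a] - (ev a i)%:MP * 'X_[a] = k%:MP *
    \sum_(j | j != i) (pairop i j 'X_[a] -
      ((a j < a i)%N || (a j == a i) && (o i < o j)%N)%:R * 'X_[a]).
  rewrite sumrB opUo_pairop ev_count -mulr_suml mderivX.
  have -> : 'X_i * ((a i)%:R *: 'X_[a - U_(i)]) = (a i)%:R%:MP * 'X_[a] :> {mpoly R[n]}.
    rewrite -mul_mpolyC mulrCA -mpolyXD; have [->|ai] := posnP (a i).
      by rewrite !mpolyC0 !mul0r.
    by rewrite addmC submK // lep1mP -lt0n.
  rewrite !mpolyCD mpolyCM !(raddf_sum (mpolyC n (R := R))) /=.
  rewrite [X in _ - (_ + _ * X) * _](eq_bigr (fun j =>
    ((a j < a i)%N || (a j == a i) && (o i < o j)%N)%:R)); first by ring.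
  by move=> j _; rewrite mpolyC_nat.
apply/below_mulC/below_sum => j ji; apply: pairop_triangular.
by rewrite eq_sym.
Qed.

Lemma opUoX_diag i a : (opUo k o i 'X_[a])@_a = ev a i.
Proof.
have [/eqP|/opUoX_triangular] := eqVneq ((opUo k o i 'X_[a] - (ev a i)%:MP * 'X_[a])@_a) 0.
  by rewrite mcoeffB mcoeffCM mcoeffX eqxx mulr1 subr_eq0 => /eqP.
by rewrite lowerxx.
Qed.

Lemma opUoX_off i a b : b != a -> (opUo k o i 'X_[a])@_b != 0 -> lower b a.
Proof.
move=> ba H; apply: (@opUoX_triangular i a); rewrite mcoeffB mcoeffCM mcoeffX.
by rewrite [a == b]eq_sym (negbTE ba) mulr0 subr0.
Qed.

End Triangularity.

Lemma seq_maximal (T : eqType) (r : rel T) (s : seq T) :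
  irreflexive r -> transitive r -> s != [::] ->
  exists2 x, x \in s & forall y, y \in s -> ~~ r x y.
Proof.
move=> irr tr; elim: s => // x [_ _|y s IH _].
  by exists x; rewrite ?mem_head // => y; rewrite inE => /eqP ->; rewrite irr.
have [//|z zs zm] := IH; have [zx|zx] := boolP (r z x).
  exists x; first exact: mem_head.
  move=> w; rewrite inE => /predU1P[->|/zm]; first by rewrite irr.
  by apply: contra => /(tr _ _ _ zx).
exists z; first by rewrite inE zs orbT.
by move=> w; rewrite inE => /predU1P[->//|/zm].
Qed.

(** * The inner product with orthonormal monomials *)

Section Dot.
Variables (R : idomainType) (n : nat).
Implicit Types (u v f : {mpoly R[n]}) (a b : 'X_{1..n}).

Definition dot u v : R := mlin (fun a => v@_a : R^o) u.

Lemma dotE u v : dot u v = \sum_(a <- msupp u) u@_a * v@_a.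
Proof. by []. Qed.

Lemma dotXl a v : dot 'X_[a] v = v@_a.
Proof. by rewrite /dot mlinX. Qed.

Lemma dotDl u1 u2 v : dot (u1 + u2) v = dot u1 v + dot u2 v.
Proof. by rewrite /dot linearD. Qed.

Lemma dotZl c u v : dot (c *: u) v = c * dot u v.
Proof. by rewrite /dot linearZ. Qed.

Lemma dot0l v : dot 0 v = 0.
Proof. by rewrite /dot linear0. Qed.

Lemma dot_linr u c v1 v2 : dot u (c *: v1 + v2) = c * dot u v1 + dot u v2.
Proof.
rewrite /dot /mlin mulr_sumr -big_split; apply: eq_bigr => a _ /=.
by rewrite mcoeffD mcoeffZ !/(_ *: _) /= mulrDr mulrCA.
Qed.

Lemma dot0r u : dot u 0 = 0.
Proof.
by have := dot_linr u (-1) 0 0; rewrite scaler0 addr0 mulN1r addNr.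
Qed.

Lemma dotZr u c v : dot u (c *: v) = c * dot u v.
Proof. by have := dot_linr u c v 0; rewrite dot0r !addr0. Qed.

Lemma dotDr u v1 v2 : dot u (v1 + v2) = dot u v1 + dot u v2.
Proof. by have := dot_linr u 1 v1 v2; rewrite scale1r mul1r. Qed.

Lemma dotBr u v1 v2 : dot u (v1 - v2) = dot u v1 - dot u v2.
Proof. by rewrite -scaleN1r addrC dot_linr mulN1r addrC. Qed.

Lemma dotBl u1 u2 v : dot (u1 - u2) v = dot u1 v - dot u2 v.
Proof. by rewrite dotDl -scaleN1r dotZl mulN1r. Qed.

Lemma dot_mulCl c u v : dot (c%:MP * u) v = c * dot u v.
Proof. by rewrite mul_mpolyC dotZl. Qed.

Lemma dot_mulCr u c v : dot u (c%:MP * v) = c * dot u v.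
Proof. by rewrite mul_mpolyC dotZr. Qed.

Lemma dotXr u a : dot u 'X_[a] = u@_a.
Proof.
elim/mpolyind: u => [|c b u _ _ IH]; first by rewrite dot0l mcoeff0.
by rewrite dotDl dotZl dotXl IH mcoeffD mcoeffZ !mcoeffX eq_sym.
Qed.

Lemma dot_suml (I : Type) (s : seq I) P (G : I -> {mpoly R[n]}) v :
  dot (\sum_(x <- s | P x) G x) v = \sum_(x <- s | P x) dot (G x) v.
Proof. by apply: (big_morph (dot^~ v)) => [x y|]; rewrite ?dotDl ?dot0l. Qed.

Lemma dot_sumr (I : Type) (s : seq I) P (G : I -> {mpoly R[n]}) u :
  dot u (\sum_(x <- s | P x) G x) = \sum_(x <- s | P x) dot u (G x).
Proof. by apply: (big_morph (dot u)) => [x y|]; rewrite ?dotDr ?dot0r. Qed.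

Lemma dot_eq0 u : (forall v, dot u v = 0) -> u = 0.
Proof. by move=> H; apply/mpolyP => a; rewrite -dotXr H mcoeff0. Qed.

Lemma dot_adjoint (A B : {linear {mpoly R[n]} -> {mpoly R[n]}}) :
  (forall a b, (A 'X_[a])@_b = (B 'X_[b])@_a) ->
  forall u v, dot (A u) v = dot u (B v).
Proof.
move=> AB; elim/mpolyind => [|c a u _ _ IHu] v; first by rewrite linear0 !dot0l.
rewrite linearP !(dotDl, dotZl) IHu; congr (_ * _ + _).
elim/mpolyind: v => [|d b v _ _ IHv]; first by rewrite linear0 !dot0r.
by rewrite (linearP B) !dot_linr IHv dotXr !dotXl AB.
Qed.

Lemma dot_sw i j u v : dot (sw i j u) v = dot u (sw i j v).
Proof.
apply: (dot_adjoint (A := sw i j) (B := sw i j)) => a b.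
rewrite /= !swE !mcoeff_sym !mcoeffX [b == _]eq_sym; congr (nat_of_bool _)%:R.
apply/eqP/eqP => [->|<-]; apply/mnmP => l; rewrite !mnmE;
  by rewrite -permM tperm2 perm1.
Qed.

Definition bshift i : {mpoly R[n]} -> {mpoly R[n]} :=
  mlin (fun a => if a i == 0%N then 0 else 'X_[a - U_(i)] : {mpoly R[n]}).
HB.instance Definition _ i := GRing.Linear.on (bshift i).

Lemma bshiftX i a :
  bshift i 'X_[a] = if a i == 0%N then 0 else 'X_[a - U_(i)].
Proof. exact: mlinX. Qed.

Lemma mcoeff_bshift i u a : (bshift i u)@_a = u@_(a + U_(i)).
Proof.
elim/mpolyind: u => [|c b u _ _ IH]; first by rewrite (linear0 (bshift i)) !mcoeff0.
rewrite (linearP (bshift i)) /= !mcoeffD !mcoeffZ IH bshiftX mcoeffX; congr (_ * _ + _).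
case: eqP => [b0|/eqP b0].
  rewrite mcoeff0; case: eqP => // E; move: b0; rewrite E.
  by rewrite mnmDE mnm1E eqxx addn1.
rewrite mcoeffX -(eqm_add2r U_(i)%MM) submK ?lep1mP //.
Qed.

Lemma dot_mulX i u v : dot ('X_i * u) v = dot u (bshift i v).
Proof.
elim/mpolyind: u => [|c a u _ _ IH]; first by rewrite mulr0 !dot0l.
rewrite mulrDr -scalerAr !dotDl !dotZl IH -mpolyXD !dotXl.
by rewrite mcoeff_bshift addmC.
Qed.

End Dot.

Section GenericTriangularity.
Variables (F : idomainType) (n : nat) (k : F) (o : 'I_n -> nat).
Hypothesis gen : forall x y : int, x%:~R + y%:~R * k = 0 -> x = 0 /\ y = 0.
Hypothesis o_inj : injective o.
Implicit Types (u v f : {mpoly F[n]}) (i j : 'I_n) (a b g : 'X_{1..n}).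

Lemma ev_inj a b i : ev k o a i = ev k o b i -> a i = b i.
Proof.
rewrite /ev => E.
have [|] := @gen ((a i)%:Z - (b i)%:Z) ((rk o b i)%:Z - (rk o a i)%:Z).
  rewrite !rmorphB /= -[0](subrr (k * (n%:R - (rk o b i)%:R) + (b i)%:R + 1)).
  by rewrite -{1}E; ring.
by move=> H _; lia.
Qed.

Lemma gen_neq0 (x y : int) : x != 0 -> x%:~R + y%:~R * k != 0.
Proof. by apply: contra => /eqP /gen[-> _]. Qed.

Lemma ev_neq0 a i : ev k o a i != 0.
Proof.
have := @gen_neq0 ((a i)%:Z + 1) (n%:Z - (rk o a i)%:Z).
rewrite rmorphD rmorphB /= => H; rewrite /ev -addrA addrC mulrC.
by apply: H; lia.
Qed.

Lemma mcoeff_opUo f i a :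
  (opUo k o i f)@_a = \sum_(b <- msupp f) f@_b * (opUo k o i 'X_[b])@_a.
Proof.
have -> : opUo k o i f = \sum_(b <- msupp f) f@_b *: opUo k o i 'X_[b].
  by rewrite {1}[f]mpolyE linear_sum; apply: eq_bigr => b _; rewrite linearZ.
by rewrite (raddf_sum (mcoeff a)); apply: eq_bigr => b _; rewrite /= mcoeffZ.
Qed.

(** Triangularity with nonzero diagonal: a [lower]-maximal monomial of f would survive. In the
    lowering step this identifies D_t z with a multiple of the next eigenfunction. *)
Lemma opUo_inj i f : opUo k o i f = 0 -> f = 0.
Proof.
move=> Uf; apply/eqP; apply: contraT => f0.
have [||a af amax] := @seq_maximal _ (lower o) (msupp f) (@lowerxx n o).
- by move=> x y z; apply: lower_trans.
- by rewrite msupp_eq0.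
have := mcoeff_opUo f i a; rewrite Uf mcoeff0 (bigD1_seq a) ?msupp_uniq //=.
rewrite opUoX_diag // big_seq_cond big1 ?addr0 => [/esym/eqP|b /andP[bf ba]].
  by rewrite mulf_eq0 (negbTE (ev_neq0 _ _)) orbF mcoeff_eq0 af.
apply/eqP; rewrite mulf_eq0; apply/orP; right; apply: contraNT (amax b bf).
by apply: opUoX_off; rewrite // eq_sym.
Qed.

(* Satisfied by the coefficients [u], in the basis p_mu, of an eigenfunction. *)
Definition left_eigen u (e : 'I_n -> F) :=
  forall i f, dot u (opUo k o i f) = e i * dot u f.

(** At a [lower]-minimal bad exponent b only the diagonal entry contributes to the equation for
    ['X_[b]]. Hence b and g have the same eigenvalues, and [ev_inj] gives b = g. *)
Lemma left_eigen_support u g : left_eigen u (ev k o g) ->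
  forall a, u@_a != 0 -> (a == g) || lower o g a.
Proof.
move=> ue a ua; apply: contraT => ag.
pose s := [seq b <- msupp u | ~~ ((b == g) || lower o g b)].
have as_ : a \in s by rewrite mem_filter ag mcoeff_msupp.
have [||b bs bmin] := @seq_maximal _ (fun x y => lower o y x) s (@lowerxx n o).
- by move=> x y z xy yz; apply: lower_trans yz xy.
- by apply: contraTneq as_ => ->.
move: bs; rewrite mem_filter negb_or => /andP[/andP[bg gb] bu].
suff E i : ev k o b i = ev k o g i.
  by case/eqP: bg; apply/mnmP => i; apply: ev_inj (E i).
have := ue i 'X_[b]; rewrite dotXr dotE (bigD1_seq b) ?msupp_uniq //=.
rewrite opUoX_diag // big_seq_cond big1 ?addr0 => [|d /andP[du db]].
  by rewrite [RHS]mulrC; apply: mulfI; rewrite -mcoeff_msupp.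
apply/eqP; rewrite mulf_eq0; apply/orP; right; apply: contraT => H.
have lt := opUoX_off o_inj db H; have := bmin d; rewrite lt mem_filter du andbT.
move=> /(_ _)/negP; case=> //; rewrite negb_or.
apply/andP; split; first by apply: contraNneq gb => <-.
by apply: contra gb => /lower_trans; apply.
Qed.

Lemma left_eigen_value u g (e : 'I_n -> F) : left_eigen u e -> u@_g != 0 ->
  (forall a, u@_a != 0 -> (a == g) || lower o g a) -> forall i, e i = ev k o g i.
Proof.
move=> ue ug sup i; have := ue i 'X_[g].
rewrite dotXr dotE (bigD1_seq g) ?msupp_uniq ?mcoeff_msupp //=.
rewrite opUoX_diag // big_seq_cond big1 ?addr0 => [|d /andP[du dg]].
  by rewrite [RHS]mulrC => /(mulfI ug) ->.
apply/eqP; rewrite mulf_eq0; apply/orP; right; apply: contraT => H.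
have lt := opUoX_off o_inj dg H; have := sup d; rewrite -mcoeff_msupp du (negbTE dg).
by move=> /(_ isT) /(lower_trans lt); rewrite lowerxx.
Qed.

End GenericTriangularity.

HB.lock Definition pexp (F : idomainType) (n : nat)
  (pb : 'X_{1..n} -> {mpoly F[n]}) (u : {mpoly F[n]}) : {mpoly F[n]} := mlin pb u.

(** * Transposition of the U_i in the basis p_mu *)

Section DualBasis.
Variables (F : idomainType) (n : nat) (k : F) (pb : 'X_{1..n} -> {mpoly F[n]}).
Hypothesis gen : forall x y : int, x%:~R + y%:~R * k = 0 -> x = 0 /\ y = 0.
Hypothesis pb0 : pb 0%MM = 1.
Hypothesis pb_sw : forall x y a, sw x y (pb a) = pb (swm x y a).
Hypothesis pb_eq0 : forall i (a : 'X_{1..n}), a i = 0%N -> opDl k i (pb a) = 0.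
Hypothesis pb_step : forall i a,
  opDl k i (pb (U_(i) + a)%MM) = opDl k i ('X_i * pb a) + k%:MP * pb a.
Hypothesis pb_sym : forall a b, (pb a)@_b = (pb b)@_a.
Implicit Types (u v f g : {mpoly F[n]}) (i j : 'I_n) (a b : 'X_{1..n}).

Local Notation pexp := (pexp pb).

Lemma pexp_is_linear : linear pexp.
Proof. by move=> c u v; rewrite unlock linearP. Qed.
HB.instance Definition _ :=
  GRing.isLinear.Build F {mpoly F[n]} {mpoly F[n]} _ pexp pexp_is_linear.

Lemma pexpX a : pexp 'X_[a] = pb a.
Proof. by rewrite unlock mlinX. Qed.

Lemma pexp0 : pexp 0 = 0.
Proof. exact: linear0. Qed.

Lemma pexpD u v : pexp (u + v) = pexp u + pexp v.
Proof. exact: linearD. Qed.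

Lemma pexpZ c u : pexp (c *: u) = c *: pexp u.
Proof. exact: linearZ. Qed.

Lemma pexp_sum (I : Type) (s : seq I) P (G : I -> {mpoly F[n]}) :
  pexp (\sum_(x <- s | P x) G x) = \sum_(x <- s | P x) pexp (G x).
Proof. exact: linear_sum. Qed.

Lemma pexpB u v : pexp (u - v) = pexp u - pexp v.
Proof. exact: linearB. Qed.

Lemma pexp_mulC c u : pexp (c%:MP * u) = c%:MP * pexp u.
Proof. by rewrite !mul_mpolyC pexpZ. Qed.

Lemma pexp_sw x y u : sw x y (pexp u) = pexp (sw x y u).
Proof.
elim/mpolyind: u => [|c a u _ _ IH].
  by rewrite pexp0 !(linear0 (sw x y)) pexp0.
by rewrite pexpD pexpZ !swD !swZ IH pexpD pexpZ pexpX pb_sw sw_mnm pexpX.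
Qed.

Lemma dot_pexp u v : dot (pexp u) v = dot u (pexp v).
Proof. by apply: (dot_adjoint (A := pexp) (B := pexp)) => a b /=; rewrite !pexpX. Qed.

Definition opJ i f := (1 + k)%:MP * f + k%:MP * \sum_(j | j != i) sw i j f.

Lemma opDl_pexp i u : opDl k i (pexp u) =
  opDl k i ('X_i * pexp (bshift i u)) + k%:MP * pexp (bshift i u).
Proof.
elim/mpolyind: u => [|c a u _ _ IH].
  by rewrite (linear0 (bshift i)) pexp0 !mulr0 (linear0 (opDl _ _)) addr0.
rewrite (linearP (bshift i)) /= !pexpD !pexpZ opDlD opDlZ IH pexpX !mulrDr -!scalerAr opDlD opDlZ addrACA -scalerDr.
congr (_ *: _ + _); rewrite bshiftX; have [ai|ai] := eqVneq (a i) 0%N.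
  by rewrite (pb_eq0 ai) pexp0 !mulr0 (linear0 (opDl _ _)) addr0.
by rewrite pexpX -pb_step addmC submK // lep1mP.
Qed.

Lemma opDl_mulX_opJ i f :
  opDl k i ('X_i * f) + k%:MP * f = 'X_i * opDl k i f + opJ i f.
Proof. by rewrite opDl_mulX /opJ mpolyCD mpolyC1; ring. Qed.

Lemma dot_opJ i u v : dot (opJ i u) v = dot u (opJ i v).
Proof.
rewrite /opJ dotDl dotDr !dot_mulCl !dot_mulCr dot_suml dot_sumr.
by congr (_ + _ * _); apply: eq_bigr => j _; rewrite dot_sw.
Qed.

Lemma pexp_opJ i u : opJ i (pexp u) = pexp (opJ i u).
Proof.
rewrite /opJ pexpD !pexp_mulC pexp_sum.
by congr (_ + _ * _); apply: eq_bigr => j _; rewrite pexp_sw.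
Qed.

(** Induction on the exponent a i: the recursion for p_a replaces D_i p_a by y_i D_i + J_i applied
    to the basis element with one less i, where J_i is [opJ], self-adjoint and commuting with
    [pexp]. If a i = 0, both sides vanish, the right one because it is the coefficient at a of a
    multiple of y_i. *)
Lemma mulX_opDl_pexp_adjoint i u v :
  dot ('X_i * opDl k i (pexp u)) v = dot u ('X_i * opDl k i (pexp v)).
Proof.
suff H a w : dot ('X_i * opDl k i (pexp 'X_[a])) w =
             dot 'X_[a] ('X_i * opDl k i (pexp w)).
  elim/mpolyind: u => [|c a u _ _ IH].
    by rewrite pexp0 (linear0 (opDl _ _)) mulr0 !dot0l.
  rewrite pexpD pexpZ opDlD opDlZ mulrDr -scalerAr !dotDl !dotZl IH.
  by rewrite H.
elim: {a}(a i) {-2}a (erefl (a i)) w => [|d IH] a ai w.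
  rewrite pexpX (pb_eq0 ai) mulr0 dot0l dotXl.
  have -> : 'X_i * opDl k i (pexp w) = opDl k i (pexp w) * 'X_i by rewrite mulrC.
  rewrite mcoeffMr big1 // => -[x y] /eqP /= E.
  rewrite mcoeffX; case: eqP => [Ey|_]; rewrite ?mulr0 //.
  have := congr1 (fun d : 'X_{1..n} => d i) E.
  by rewrite /= ai -Ey !(mnmDE, mnm1E) eqxx; lia.
have ai0 : a i != 0%N by rewrite ai.
have aE : a = (U_(i) + (a - U_(i)))%MM by rewrite addmC submK // lep1mP.
rewrite dot_mulX opDl_pexp opDl_mulX_opJ bshiftX (negbTE ai0) dotDl IH; last first.
  by rewrite mnmBE mnm1E eqxx ai subn1.
rewrite dot_opJ dot_pexp -pexp_opJ -dotDr -opDl_mulX_opJ -opDl_pexp.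
by rewrite !dotXl {2}aE ['X_i * _]mulrC mcoeffMX.
Qed.

(** As [pexp] is symmetric, this says U P = P U^T: in the basis p_mu, U_i has the transpose of its
    matrix on monomials. *)
Lemma opUo_pexp_adjoint o i u v :
  dot (opUo k o i (pexp u)) v = dot u (opUo k o i (pexp v)).
Proof.
have E f : opUo k o i f = 'X_i * opDl k i f + opJ i f
    - k%:MP * \sum_(j | (o j < o i)%N) sw i j f.
  by rewrite opUoE opDl_mulX_opJ.
rewrite !E dotBl dotBr dotDl dotDr mulX_opDl_pexp_adjoint.
rewrite dot_opJ dot_pexp -pexp_opJ dot_mulCl dot_mulCr.
congr (_ + _ - _ * _); rewrite dot_suml dot_sumr; apply: eq_bigr => j _.
by rewrite dot_sw dot_pexp pexp_sw.
Qed.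

Lemma msize_leP d u : reflect (forall a, u@_a != 0 -> (mdeg a < d)%N) (msize u <= d)%N.
Proof.
apply: (iffP idP) => [H a|H].
  by rewrite -mcoeff_msupp => /msize_mdeg_lt /leq_trans; apply.
rewrite msizeE; apply/bigmax_leqP_seq => a au _.
by apply: H; rewrite -mcoeff_msupp.
Qed.

Lemma opUo_bottom_pexp_inj i f : opDl k i ('X_i * f) + k%:MP * f = 0 -> f = 0.
Proof.
rewrite -(opUo_bottom k (fun j : 'I_n => j : nat)) => H.
apply: (opUo_inj gen _ H); apply: order_cycle_inj; exact: val_inj.
Qed.

(** If P u = 0, then D_i y_i + k kills P of every shift [bshift i u]. This operator is U_i for an
    order in which i is first, hence injective, so by induction all shifts vanish and u is
    constant. *)
Lemma pexp_inj u : pexp u = 0 -> u = 0.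
Proof.
elim: {u}(msize u) {-2}u (leqnn (msize u)) => [|d IH] u ud Pu.
  by apply/eqP; rewrite -(@msize_poly_eq0 n F) -leqn0.
have bu i : bshift i u = 0.
  apply: IH; last first.
    apply: (@opUo_bottom_pexp_inj i).
    by rewrite -opDl_pexp Pu (linear0 (opDl _ _)).
  apply/msize_leP => a; rewrite mcoeff_bshift => H.
  by move/msize_leP: ud => /(_ _ H); rewrite mdegD mdeg1 addn1.
have uc : u = (u@_0)%:MP.
  apply/mpolyP => a; rewrite mcoeffC; have [->|a0] := eqVneq a 0%MM.
    by rewrite mulr1.
  rewrite mulr0; move: a0; elim/mnm_ind: a => [|i a _]; first by rewrite eqxx.
  by rewrite addmC -mcoeff_bshift bu mcoeff0.
move: Pu; rewrite uc -[_%:MP]mulr1 pexp_mulC -mpolyX0 pexpX pb0 mulr1 => ->.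
by rewrite mul0r.
Qed.

(** The defect [lam] of the left eigenvector equation vanishes on the image of P, by adjointness.
    Represented by a polynomial [w], it satisfies P w = 0, and injectivity of P gives w = 0. *)
Lemma pexp_left_eigen o u (e : 'I_n -> F) : injective o ->
  (forall i, opUo k o i (pexp u) = (e i)%:MP * pexp u) -> left_eigen k o u e.
Proof.
move=> o_inj ue i f; apply/eqP; rewrite -subr_eq0; apply/eqP.
pose lam g := dot u (opUo k o i g) - e i * dot u g.
rewrite -/(lam f).
(* A finite sum suffices: U_i preserves the degree, so [lam] kills every monomial of degree at least
   [msize u]. *)
pose w := \sum_(a : 'X_{1..n < msize u}) lam 'X_[a] *: 'X_[a] : {mpoly F[n]}.
have lamX a : lam 'X_[a] = w@_a.
  have [lt|ge] := ltnP (mdeg a) (msize u).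
    rewrite /w (raddf_sum (mcoeff a)) /= (bigD1 (BMultinom lt)) //=.
    rewrite mcoeffZ mcoeffX eqxx mulr1 big1 ?addr0 // => b /negbTE ba.
    by rewrite mcoeffZ mcoeffX -[_ == a](bmeqP b (BMultinom lt)) ba mulr0.
  have ua b : mdeg b = mdeg a -> u@_b = 0.
    by move=> ba; apply/memN_msupp_eq0/msize_mdeg_ge; rewrite ba.
  rewrite /w (raddf_sum (mcoeff a)) /= big1 => [|b _]; last first.
    rewrite mcoeffZ mcoeffX; case: eqP => [E|_]; rewrite ?mulr0 //.
    by have := bmdeg b; rewrite E ltnNge ge.
  rewrite /lam dotXr ua // mulr0 subr0 dotE big1_seq // => b /andP[_ bu].
  apply/eqP; rewrite mulf_eq0; apply/norP => -[ub].
  have [ba|ba] := eqVneq b a; first by move: ub; rewrite ua ?ba ?eqxx.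
  move=> /(opUoX_off o_inj ba) /andP[/eqP E _].
  by move: ub; rewrite ua ?eqxx.
have lamE g : lam g = dot w g.
  rewrite [g]mpolyE dot_sumr /lam dot_sumr (linear_sum (opUo k o i)) dot_sumr.
  rewrite mulr_sumr -sumrB; apply: eq_bigr => a _.
  rewrite /= opUoZ !dotZr !dotXr -lamX /lam dotXr; ring.
rewrite lamE; suff -> : w = 0 by rewrite dot0l.
apply/pexp_inj/dot_eq0 => v; rewrite dot_pexp -lamE /lam.
rewrite -opUo_pexp_adjoint -dot_pexp ue.
by rewrite dot_mulCl subrr.
Qed.

End DualBasis.

(** * Recursion for products of one-index families *)

Section ProductBasis.
Variables (R : idomainType) (n : nat) (k : R) (f : 'I_n -> nat -> {mpoly R[n]}).
Implicit Types (i j : 'I_n) (d : nat) (a : 'X_{1..n}) (s : seq 'I_n).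
Hypothesis f0 : forall i, f i 0%N = 1.
Hypothesis f_sym : forall i j d,
  f i d.+1 - 'X_i * f i d = f j d.+1 - 'X_j * f j d.
Hypothesis f_deriv : forall i j d,
  (f j d.+1 - 'X_j * f j d)^`M(i) = k%:MP * f i d.
Hypothesis f_sw : forall x y i d, sw x y (f i d) = f (tperm x y i) d.

Lemma dd1 i j : i != j -> dd i j 1 = 0 :> {mpoly R[n]}.
Proof. by move=> ij; apply: ddE; rewrite ?mulr0 ?sw1 ?subrr. Qed.

(** By [f_sym] the difference [f i d.+1 - 'X_i * f i d] is the same for i and j. It is therefore
    invariant under (i,j) and killed by [dd i j]. *)
Lemma dd_f_succ i j d : i != j ->
  dd i j (f i d.+1) = 'X_i * dd i j (f i d) + f j d.
Proof.
move=> ij; have -> : f i d.+1 = f i d.+1 - 'X_i * f i d + 'X_i * f i d.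
  by rewrite subrK.
rewrite linearD /= dd_mulXl // f_sw tpermL.
suff -> : dd i j (f i d.+1 - 'X_i * f i d) = 0 by rewrite add0r.
apply: ddE; rewrite ?mulr0 // swB swM swXU !f_sw tpermL.
by rewrite (f_sym i j) subrr.
Qed.

Lemma dd_fX i j d : i != j -> ('X_i - 'X_j) * dd i j (f i d) = f i d - f j d.
Proof. by move=> ij; rewrite ddP // f_sw tpermL. Qed.

Lemma dd_fC i j d : i != j -> dd i j (f j d) = - dd i j (f i d).
Proof.
move=> ij; apply: ddE => //; rewrite mulrN dd_fX // f_sw tpermR opprB //.
Qed.

Lemma mderiv_mulX i j p : ('X_i * p)^`M(j) = (i == j)%:R * p + 'X_i * p^`M(j)
  :> {mpoly R[n]}.
Proof.
rewrite mderivM mderivX mnm1E; congr (_ + _).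
case: eqP => [->|_]; last by rewrite scale0r !mul0r.
rewrite scale1r !mul1r; have -> : (U_(j) - U_(j) = 0 :> 'X_{1..n})%MM.
  by apply/mnmP => l; rewrite mnmBE mnm0E subnn.
by rewrite mpolyX0 mul1r.
Qed.

Lemma mderiv_f_neq i j d : i != j -> (f j d)^`M(i) = k%:MP * dd i j (f i d).
Proof.
move=> ij; elim: d => [|d IH].
  by rewrite !f0 mderivC dd1 // mulr0.
have -> : f j d.+1 = (f j d.+1 - 'X_j * f j d) + 'X_j * f j d by rewrite subrK.
rewrite mderivD f_deriv mderiv_mulX eq_sym (negbTE ij) mul0r add0r IH.
rewrite dd_f_succ //.
have -> : 'X_i * dd i j (f i d) = 'X_j * dd i j (f i d) + (f i d - f j d).
  by rewrite -dd_fX //; ring.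
by ring.
Qed.

Lemma mderiv_f_eq i d :
  (f i d.+1)^`M(i) = 'X_i * (f i d)^`M(i) + (1 + k)%:MP * f i d.
Proof.
have -> : f i d.+1 = (f i d.+1 - 'X_i * f i d) + 'X_i * f i d by rewrite subrK.
by rewrite mderivD f_deriv mderiv_mulX eqxx mul1r mpolyCD mpolyC1; ring.
Qed.

(** The derivative of the factor f_j absorbs the part of [dd i j] that acts on this factor. In the
    Dunkl operator of a product each j thus leaves a single term. *)
Lemma dd_f_mul i j d e : i != j ->
  k%:MP * dd i j (f i d * f j e) + f i d * (f j e)^`M(i)
  = k%:MP * (dd i j (f i d) * f i e).
Proof.
move=> ij; rewrite mderiv_f_neq // dd_mulM // f_sw tpermL dd_fC //.
have := dd_fX d ij; have := dd_fX e ij.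
move: (dd i j (f i d)) (dd i j (f i e)) => x y Ey Ex.
have E : f i d - f j d = ('X_i - 'X_j) * x by [].
have -> : f i e = f j e + ('X_i - 'X_j) * y by rewrite Ey addrC subrK.
transitivity (k%:MP * (x * f j e + (f i d - f j d) * y)); first by ring.
by rewrite E; ring.
Qed.

Definition fprod a s := \prod_(j <- s) f j (a j).

(** The divided differences are restricted to [s] so that the factors of the product can be added
    one index at a time. *)
Definition partial_dunkl i s p :=
  p^`M(i) + k%:MP * \sum_(j <- s) dd i j p.

Lemma sw_fprod i j a s : i \notin s -> j \notin s ->
  sw i j (fprod a s) = fprod a s.
Proof.
move=> is_ js; rewrite /fprod swE rmorph_prod /=.
rewrite !big_seq; apply: eq_bigr => l ls.
rewrite -swE f_sw tpermD //; first by apply: contraNneq is_ => ->.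
by apply: contraNneq js => ->.
Qed.

Lemma dd_mul_fprod i j a s p : i != j -> i \notin s -> j \notin s ->
  dd i j (p * fprod a s) = dd i j p * fprod a s.
Proof.
move=> ij is_ js; rewrite mulrC dd_mul_sym // ?sw_fprod //.
by rewrite mulrC.
Qed.

Lemma partial_dunkl_cons i j a s d : i != j -> i \notin s -> j \notin s ->
  partial_dunkl i (j :: s) (f i d * fprod a (j :: s)) =
  f j (a j) * partial_dunkl i s (f i d * fprod a s)
  + k%:MP * (dd i j (f i d) * f i (a j) * fprod a s).
Proof.
move=> ij is_ js; rewrite /partial_dunkl big_cons.
have -> : fprod a (j :: s) = f j (a j) * fprod a s by rewrite /fprod big_cons.
have -> : \sum_(l <- s) dd i l (f i d * (f j (a j) * fprod a s)) =
    f j (a j) * \sum_(l <- s) dd i l (f i d * fprod a s).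
  rewrite mulr_sumr !big_seq; apply: eq_bigr => l ls.
  have il : i != l by apply: contraNneq is_ => ->.
  have jl : l != j by apply: contraNneq js => <-.
  by rewrite mulrCA [LHS]dd_mul_sym //; rewrite f_sw tpermD.
have -> : dd i j (f i d * (f j (a j) * fprod a s)) =
    dd i j (f i d * f j (a j)) * fprod a s.
  by rewrite mulrA dd_mul_fprod.
have E := dd_f_mul d (a j) ij.
rewrite [k%:MP * (_ * _ * _)]mulrA -E !mderivM; ring.
Qed.

Lemma partial_dunkl0 i a s : i \notin s -> uniq s ->
  partial_dunkl i s (f i 0%N * fprod a s) = 0.
Proof.
elim: s => [_ _|j s IH].
  by rewrite /partial_dunkl /fprod !big_nil mulr0 addr0 f0 mulr1 mderivC.
rewrite inE negb_or => /andP[ij is_] /= /andP[js us].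
by rewrite partial_dunkl_cons // IH // mulr0 f0 dd1 // !mul0r mulr0 addr0.
Qed.

Lemma partial_dunkl_succ i a s d : i \notin s -> uniq s ->
  partial_dunkl i s (f i d.+1 * fprod a s) =
  'X_i * partial_dunkl i s (f i d * fprod a s)
  + (1 + k)%:MP * (f i d * fprod a s)
  + k%:MP * \sum_(j <- s) sw i j (f i d * fprod a s).
Proof.
elim: s => [_ _|j s IH].
  rewrite /partial_dunkl /fprod !big_nil !mulr0 !addr0 !mulr1.
  by rewrite mderiv_f_eq.
rewrite inE negb_or => /andP[ij is_] /= /andP[js us].
rewrite !partial_dunkl_cons // IH // dd_f_succ // big_cons.
have -> : fprod a (j :: s) = f j (a j) * fprod a s by rewrite /fprod big_cons.
have -> : sw i j (f i d * (f j (a j) * fprod a s)) =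
    f j d * (f i (a j) * fprod a s).
  by rewrite !swM !f_sw tpermL tpermR sw_fprod.
have -> : \sum_(l <- s) sw i l (f i d * (f j (a j) * fprod a s)) =
    f j (a j) * \sum_(l <- s) sw i l (f i d * fprod a s).
  rewrite mulr_sumr !big_seq; apply: eq_bigr => l ls.
  have il : i != l by apply: contraNneq is_ => ->.
  have jl : l != j by apply: contraNneq js => <-.
  by rewrite mulrCA [LHS]swM f_sw tpermD.
by ring.
Qed.

Let others i := [seq j <- enum 'I_n | j != i].

Lemma opDl_others i p : opDl k i p = partial_dunkl i (others i) p.
Proof. by rewrite opDlE /partial_dunkl /others big_filter big_enum_cond. Qed.

Lemma prod_others i a : \prod_j f j (a j) = f i (a i) * fprod a (others i).
Proof. by rewrite (bigD1 i) //= /fprod /others big_filter big_enum_cond. Qed.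

Definition prodbasis a := \prod_j f j (a j).

Lemma prodbasis_eq0 i a : a i = 0%N -> opDl k i (prodbasis a) = 0.
Proof.
move=> ai; rewrite opDl_others /prodbasis (prod_others i) ai partial_dunkl0 //.
  by rewrite mem_filter eqxx.
by rewrite filter_uniq // enum_uniq.
Qed.

Lemma prodbasis_step i a : opDl k i (prodbasis (U_(i) + a)%MM) =
  opDl k i ('X_i * prodbasis a) + k%:MP * prodbasis a.
Proof.
have is_ : i \notin others i by rewrite mem_filter eqxx.
have us : uniq (others i) by rewrite filter_uniq // enum_uniq.
rewrite opDl_mulX /prodbasis !(prod_others i) !opDl_others mnmDE mnm1E eqxx add1n.
have -> : fprod (U_(i) + a)%MM (others i) = fprod a (others i).
  rewrite /fprod !big_seq; apply: eq_bigr => j.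
  by rewrite mem_filter mnmDE mnm1E eq_sym => /andP[/negbTE -> _].
rewrite partial_dunkl_succ // mpolyCD mpolyC1.
have -> : \sum_(j | j != i) sw i j (f i (a i) * fprod a (others i)) =
    \sum_(j <- others i) sw i j (f i (a i) * fprod a (others i)).
  by rewrite [in RHS]/others big_filter big_enum_cond.
by ring.
Qed.

End ProductBasis.

(** * The generating kernel and its symmetry *)

Section Exchange.
Variables (F : fieldType) (N : nat).
Local Notation T := {mpoly F[N]}.
Local Notation TT := {mpoly T[N]}.

Definition lift_const (c : F) : TT := c%:MP%:MP.
Lemma lift_const_is_zmod : zmod_morphism lift_const.
Proof. by move=> x y; rewrite /lift_const !rmorphB. Qed.
Lemma lift_const_is_monoid : monoid_morphism lift_const.
Proof. by split=> [|x y]; rewrite /lift_const ?rmorph1 ?rmorphM. Qed.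
HB.instance Definition _ :=
  GRing.isZmodMorphism.Build F TT lift_const lift_const_is_zmod.
HB.instance Definition _ :=
  GRing.isMonoidMorphism.Build F TT lift_const lift_const_is_monoid.

Definition lift_inner : T -> TT := mmap lift_const (fun j => 'X_j).
HB.instance Definition _ := GRing.RMorphism.on lift_inner.
End Exchange.

(* Exchanges the two families of variables. *)
HB.lock Definition exchange (F : fieldType) (N : nat) (p : {mpoly {mpoly F[N]}[N]})
  : {mpoly {mpoly F[N]}[N]} := mmap (@lift_inner F N) (fun i => ('X_i)%:MP) p.

Section ExchangeTheory.
Variables (F : fieldType) (N : nat).
Local Notation T := {mpoly F[N]}.
Local Notation TT := {mpoly T[N]}.

Lemma exchangeD (p q : TT) : exchange (p + q) = exchange p + exchange q.
Proof. by rewrite unlock rmorphD. Qed.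

Lemma exchangeM (p q : TT) : exchange (p * q) = exchange p * exchange q.
Proof. by rewrite unlock rmorphM. Qed.

Lemma exchange0 : exchange 0 = 0 :> TT.
Proof. by rewrite unlock rmorph0. Qed.

Lemma exchange1 : exchange 1 = 1 :> TT.
Proof. by rewrite unlock rmorph1. Qed.

Lemma exchange_monomial (c : F) (a b : 'X_{1..N}) :
  exchange ((c *: 'X_[a]) *: 'X_[b]) = (c *: 'X_[b]) *: 'X_[a] :> TT.
Proof.
rewrite unlock mmapZ mmapX /= /lift_inner mmapZ mmapX mmap1_id /=.
have -> : mmap1 (fun i => ('X_i : T)%:MP_[N]) b = 'X_[b]%:MP.
  rewrite /mmap1 [in RHS](mpolyXE_id F b) rmorph_prod /=.
  by apply: eq_bigr => i _; rewrite rmorphXn.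
by rewrite /lift_const -[RHS]mul_mpolyC -[c *: _]mul_mpolyC mpolyCM mulrAC.
Qed.

Lemma mcoeff_monomial (x : F) (l m a b : 'X_{1..N}) :
  ((x *: 'X_[m] : T) *: 'X_[l] : TT)@_a@_b = x * (m == b)%:R * (l == a)%:R.
Proof.
rewrite mcoeffZ mcoeffX; case: (l == a).
  by rewrite !mulr1 mcoeffZ mcoeffX.
by rewrite !mulr0 mcoeff0.
Qed.

Lemma mcoeff_exchange (p : TT) (a b : 'X_{1..N}) : (exchange p)@_a@_b = p@_b@_a.
Proof.
have M (c : T) m : (exchange (c *: 'X_[m]))@_a@_b = (c *: 'X_[m] : TT)@_b@_a.
  elim/mpolyind: c => [|x l c _ _ IH].
    by rewrite scale0r exchange0 !mcoeff0.
  rewrite scalerDl exchangeD exchange_monomial [((_ : TT) + _)@_a]mcoeffD.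
  rewrite [LHS]mcoeffD IH [((_ : TT) + _)@_b]mcoeffD [RHS]mcoeffD.
  by rewrite !mcoeff_monomial mulrAC.
elim/mpolyind: p => [|c m p _ _ IH]; first by rewrite exchange0 !mcoeff0.
rewrite exchangeD [(exchange _ + _)@_a]mcoeffD [LHS]mcoeffD.
by rewrite [(_ + p)@_b]mcoeffD [RHS]mcoeffD M IH.
Qed.

End ExchangeTheory.

Section Kernel.
Variables (F : fieldType) (N : nat) (k : F).
Hypothesis char0 : forall d : nat, (d.+1)%:R != 0 :> F.
Implicit Types (c : F) (i j : 'I_N) (d s : nat) (a b mu : 'X_{1..N}).
Local Notation T := {mpoly F[N]}.
Local Notation TT := {mpoly T[N]}.

(** Truncation of power series in z to polynomials: up to degree d the coefficients of a product
    depend only on those of the factors up to degree d. *)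
Definition agree d (f : zseries F N) (p : TT) :=
  forall mu, (mdeg mu <= d)%N -> f mu = p@_mu.

Lemma agree1 d : agree d (@zseries1 F N) 1.
Proof. by move=> mu _; rewrite mcoeff1 /zseries1; case: eqP. Qed.

Lemma agreeM d f g p r : agree d f p -> agree d g r ->
  agree d (zseriesM f g) (p * r).
Proof.
move=> fp gr mu mud; rewrite /zseriesM (@mcoeff_poly_mul_lin _ _ p r mu (mdeg mu).+1) //.
apply: eq_bigr => a am; rewrite fp; last first.
  by rewrite (leq_trans _ mud) // -ltnS bmdeg.
by rewrite gr // (leq_trans _ mud) // mdegB.
Qed.

Definition bcoef c s : F := pochhammer c s / s`!%:R.
Definition bpoly c j d : {poly T} := \poly_(s < d.+1) (bcoef c s *: 'X_j ^+ s).
Definition bkern c j i d : TT :=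
  \sum_(s < d.+1) (bcoef c s *: 'X_j ^+ s) *: 'X_i ^+ s.

Lemma agree_binom d c j i : agree d (zseries_binom c j i) (bkern c j i d).
Proof.
move=> mu mud; rewrite /zseries_binom /bkern raddf_sum /=.
have mui : (mu i < d.+1)%N.
  by rewrite ltnS (leq_trans _ mud) // mdegE (bigD1 i) //= leq_addr.
have E s : ((U_(i) *+ s)%MM == mu) = (mu == (U_(i) *+ mu i)%MM) && (s == mu i).
  apply/eqP/andP => [<-|[/eqP -> /eqP ->]].
    by rewrite mulmnE mnm1E eqxx mul1n.
  by rewrite mulmnE mnm1E eqxx mul1n.
rewrite (bigD1 (Ordinal mui)) //= big1 => [|s smu].
  rewrite addr0 mcoeffZ mcoeffXn E eqxx andbT.
  by case: ifP; rewrite ?mulr1 ?mulr0.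
rewrite mcoeffZ mcoeffXn E; move: smu; rewrite -(inj_eq val_inj) /= => smu.
by rewrite (negbTE smu) andbF mulr0.
Qed.

Definition kern d : TT := \prod_i (bkern 1 i i d * \prod_j bkern k j i d).

Lemma agree_prod d (I : Type) (s : seq I) (f : I -> zseries F N) (p : I -> TT) :
  (forall x, agree d (f x) (p x)) ->
  agree d (\big[@zseriesM F N/@zseries1 F N]_(x <- s) f x) (\prod_(x <- s) p x).
Proof.
move=> fp; elim: s => [|x s IH]; first by rewrite !big_nil; apply: agree1.
by rewrite !big_cons; apply: agreeM.
Qed.

Lemma pJack_kern d mu : (mdeg mu <= d)%N -> pJack k mu = (kern d)@_mu.
Proof.
move=> mud; rewrite /pJack.
have H := @agree_prod d _ (index_enum 'I_N) (fun i => zseriesM (zseries_binom 1 i i)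
  (\big[@zseriesM F N/@zseries1 F N]_(j < N) zseries_binom k j i))
  (fun i => bkern 1 i i d * \prod_j bkern k j i d).
apply: (H _ mu mud) => i.
by apply: agreeM; [apply: agree_binom | apply: agree_prod => j; apply: agree_binom].
Qed.

Lemma exchange_bkern c i j d : exchange (bkern c j i d) = bkern c i j d.
Proof.
rewrite /bkern (big_morph _ (@exchangeD F N) (exchange0 F N)); apply: eq_bigr => s _.
by rewrite !mpolyXn exchange_monomial -!mpolyXn.
Qed.

Lemma exchange_kern d : exchange (kern d) = kern d.
Proof.
have EP (f : 'I_N -> TT) : exchange (\prod_i f i) = \prod_i exchange (f i).
  exact: (big_morph _ (@exchangeM F N) (exchange1 F N)).
rewrite /kern !big_split /= exchangeM !EP; congr (_ * _).
  by apply: eq_bigr => i _; apply: exchange_bkern.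
rewrite [RHS]exchange_big /=; apply: eq_bigr => i _.
by rewrite EP; apply: eq_bigr => j _; apply: exchange_bkern.
Qed.

(** The kernel, the product of all (1 - y_i z_i)^(-1) and (1 - y_j z_i)^(-k), is invariant under the
    exchange of y and z; so is its truncation. *)
Lemma pJack_sym a b : (pJack k a)@_b = (pJack k b)@_a.
Proof.
pose d := maxn (mdeg a) (mdeg b).
rewrite (@pJack_kern d) ?leq_maxl // (@pJack_kern d) ?leq_maxr //.
by rewrite -mcoeff_exchange exchange_kern.
Qed.

Definition univ i (q : {poly T}) : TT := horner_alg 'X_i q.

Lemma univ_bpoly c j i d : univ i (bpoly c j d) = bkern c j i d.
Proof.
rewrite /univ /bpoly /bkern poly_def rmorph_sum /=; apply: eq_bigr => s _.
by rewrite linearZ rmorphXn /= horner_algX mulr_algl.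
Qed.

Lemma mcoeff_prod_univ (q : 'I_N -> {poly T}) mu :
  (\prod_i univ i (q i))@_mu = \prod_i (q i)`_(mu i).
Proof.
pose D := (\max_i (maxn (size (q i)) (mu i).+1))%N.
have qD i : (size (q i) <= D)%N.
  by apply: leq_trans (leq_bigmax i); rewrite leq_maxl.
have muD i : (mu i < D)%N by apply: leq_trans (leq_bigmax i); rewrite leq_maxr.
have E i : univ i (q i) = \sum_(s < D) (q i)`_s *: 'X_i ^+ s.
  have -> : q i = \poly_(s < D) (q i)`_s.
    apply/polyP => s; rewrite coef_poly; case: ltnP => // Ds.
    by rewrite nth_default // (leq_trans (qD i)).
  rewrite /univ poly_def rmorph_sum /=; apply: eq_bigr => s _.
  rewrite linearZ rmorphXn /= horner_algX mulr_algl -poly_def coef_poly.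
  by rewrite ltn_ord.
under eq_bigr do rewrite E.
rewrite bigA_distr_bigA /= (raddf_sum (mcoeff mu)) /=.
pose fmu : {ffun 'I_N -> 'I_D} := [ffun i => Ordinal (muD i)].
have P (f : {ffun 'I_N -> 'I_D}) : \prod_i ((q i)`_(f i) *: 'X_i ^+ f i : TT) =
    (\prod_i (q i)`_(f i)) *: 'X_[[multinom (f i : nat) | i < N]].
  rewrite scaler_prod; congr (_ *: _); rewrite mpolyXE_id.
  by apply: eq_bigr => i _; rewrite mnmE.
under eq_bigr => f _ do rewrite P mcoeffZ mcoeffX.
rewrite (bigD1 fmu) //= [X in _ + X]big1 ?addr0 => [|f ffmu].

  have -> : [multinom (fmu i : nat) | i < N] = mu.
    by apply/mnmP => i; rewrite mnmE ffunE.
  by rewrite eqxx mulr1; apply: eq_bigr => i _; rewrite ffunE.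
case: eqP => [E'|]; last by rewrite mulr0.
case/eqP: ffmu; apply/ffunP => i; apply/val_inj; rewrite ffunE /= -E'.
by rewrite mnmE.
Qed.

Definition Fpoly i d : {poly T} := bpoly 1 i d * \prod_j bpoly k j d.

Lemma pJack_prod d mu : (mdeg mu <= d)%N ->
  pJack k mu = \prod_i (Fpoly i d)`_(mu i).
Proof.
move=> mud; rewrite (pJack_kern mud) /kern -mcoeff_prod_univ; congr (_@_mu).
apply: eq_bigr => i _; rewrite /univ /Fpoly rmorphM rmorph_prod /=.
rewrite -!/(univ _ _) univ_bpoly; congr (_ * _).
by apply: eq_bigr => j _; rewrite -/(univ _ _) univ_bpoly.
Qed.

Definition jf i d : T := (Fpoly i d)`_d.

Lemma Fpoly0 i d : (Fpoly i d)`_0 = 1.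
Proof.
have H c j : (bpoly c j d)`_0 = 1.
  by rewrite coef_poly /= /bcoef /pochhammer big_ord0 fact0 divr1 scale1r expr0.
rewrite /Fpoly coef0M H mul1r.
by elim/big_ind: _ => [|x y x1 y1|j _]; rewrite ?coef1 // ?coef0M ?x1 ?y1 ?mul1r.
Qed.

(** Every truncation at degree at least s computes the same p_mu, mu being s times the i-th unit
    vector, whose definition involves no truncation. *)
Lemma jfE i s d : (s <= d)%N -> (Fpoly i d)`_s = jf i s.
Proof.
move=> sd; pose mu := (U_(i) *+ s)%MM.
have H e : (s <= e)%N -> pJack k mu = (Fpoly i e)`_s.
  move=> se; rewrite (@pJack_prod e) ?mdegMn ?mdeg1 ?mul1n //.
  rewrite (bigD1 i) //= big1 ?mulr1 => [|j ji].
    by rewrite mulmnE mnm1E eqxx mul1n.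
  by rewrite mulmnE mnm1E eq_sym (negbTE ji) mul0n Fpoly0.
by rewrite /jf -H // -H.
Qed.

Lemma pJackE mu : pJack k mu = \prod_i jf i (mu i).
Proof.
rewrite (pJack_prod (leqnn _)); apply: eq_bigr => i _; apply: jfE.
by rewrite mdegE (bigD1 i) //= leq_addr.
Qed.

Lemma jf0 i : jf i 0 = 1.
Proof. exact: Fpoly0. Qed.

Lemma jf_sw x y i d : sw x y (jf i d) = jf (tperm x y i) d.
Proof.
pose mp : {poly T} -> {poly T} := map_poly (msym (tperm x y)).
have mpE c j : mp (bpoly c j d) = bpoly c (tperm x y j) d.
  apply/polyP => s; rewrite coef_map !coef_poly; case: ltnP => _ /=.
    by rewrite -swE swZ swE rmorphXn /= -swE swXU.
  exact: msym0.
rewrite /jf swE -coef_map -/mp; congr (_`_d).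
have -> : mp (Fpoly i d) = mp (bpoly 1 i d) * \prod_j mp (bpoly k j d).
  by rewrite /mp /Fpoly rmorphM rmorph_prod.
rewrite mpE (eq_bigr _ (fun j _ => mpE k j)) /Fpoly.
by rewrite [in RHS](reindex_inj (@perm_inj _ (tperm x y))).
Qed.

Definition Gpoly d : {poly T} := \prod_j bpoly k j d.

Lemma bcoef1 s : bcoef 1 s = 1.
Proof.
rewrite /bcoef /pochhammer; have -> : \prod_(j < s) (1 + j%:R) = s`!%:R :> F.
  elim: s => [|s IH]; first by rewrite big_ord0.
  by rewrite big_ord_recr /= IH factS natrM mulrC -natr1 addrC.
rewrite divff //; elim: s => [|s IH]; first by rewrite oner_neq0.
by rewrite factS natrM mulf_neq0.
Qed.

Lemma bcoefS c s : (s.+1)%:R * bcoef c s.+1 = (c + s%:R) * bcoef c s.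
Proof.
rewrite /bcoef /pochhammer big_ord_recr /= factS natrM invfM.
have E (u x y v w : F) : u * (x * y * (v * w)) = v * u * (y * (x * w)) by ring.
by rewrite E mulVf // mul1r.
Qed.

(** The coefficients of (1 - y_i z) F_i(z) = G(z) below the truncation degree, where G(z) is the
    product of the (1 - y_j z)^(-k). *)
Lemma Fpoly_Gpoly i d s : (s < d)%N ->
  (Fpoly i d)`_s.+1 - 'X_i * (Fpoly i d)`_s = (Gpoly d)`_s.+1.
Proof.
move=> sd; rewrite /Fpoly -/(Gpoly d) !coefM big_ord_recl /= subn0 mulr_sumr.
have B t : (t <= d)%N -> (bpoly 1 i d)`_t = 'X_i ^+ t.
  by move=> td; rewrite coef_poly ltnS td bcoef1 scale1r.
rewrite B // expr0 mul1r -addrA -sumrB big1 ?addr0 // => t _.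
have ts := ltn_ord t.
by rewrite /bump /= add1n subSS !B ?exprS; [rewrite mulrA subrr|lia..].
Qed.

Lemma mderiv_Xn i t : ('X_i ^+ t.+1 : T)^`M(i) = t.+1%:R *: 'X_i ^+ t.
Proof.
rewrite !mpolyXn mderivX mulmnE mnm1E eqxx mul1n; congr (_ *: 'X_[_]).
by rewrite mulmSr addmK.
Qed.

Lemma mderiv_bpoly i d t : (t < d)%N ->
  ((bpoly k i d)`_t.+1)^`M(i) =
  'X_i * ((bpoly k i d)`_t)^`M(i) + k%:MP * (bpoly k i d)`_t.
Proof.
move=> td; rewrite !coef_poly ltnS td ltnS (ltnW td) !mderivZ mderiv_Xn scalerA.
rewrite mulrC bcoefS mul_mpolyC; case: t td => [|t] td.
  by rewrite expr0 mderivC scaler0 mulr0 add0r addr0 scalerA.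
rewrite mderiv_Xn -scalerAr -scalerAr -exprS !scalerA -scalerDl.
by congr (_ *: _); rewrite mulrDl addrC [bcoef _ _ * _]mulrC.
Qed.

Lemma mderiv_Gpoly_rest i d t :
  ((\prod_(j | j != i) bpoly k j d)`_t)^`M(i) = 0.
Proof.
elim/big_ind: _ t => [|p q Hp Hq|j ji] t.
- by rewrite coef1 -mpolyC_nat mderivC.
- rewrite coefM (raddf_sum (mderiv i)) big1 // => s _ /=.
  by rewrite mderivM Hp Hq mulr0 mul0r addr0.
rewrite coef_poly; case: ifP => _; last by rewrite mderiv0.
rewrite mderivZ mpolyXn mderivX mulmnE mnm1E (negbTE ji) mul0n scale0r.
by rewrite scaler0.
Qed.

Lemma mderiv_Gpoly i d s : (s < d)%N ->
  ((Gpoly d)`_s.+1)^`M(i) = 'X_i * ((Gpoly d)`_s)^`M(i) + k%:MP * (Gpoly d)`_s.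
Proof.
move=> sd; rewrite /Gpoly (bigD1 i) //= !coefM !(raddf_sum (mderiv i)) /=.
rewrite big_ord_recl /= mderivM mderiv_Gpoly_rest mulr0 addr0.
have -> : ((bpoly k i d)`_0)^`M(i) = 0 by rewrite coef_poly expr0 /= mderivZ mderivC scaler0.
rewrite mul0r add0r !mulr_sumr -big_split; apply: eq_bigr => t _ /=.
rewrite /bump /= add1n subSS !mderivM !mderiv_Gpoly_rest !mulr0 !addr0.
by rewrite mderiv_bpoly; [ring | have := ltn_ord t; lia].
Qed.

(** The coefficients of dG/dy_i = k z G / (1 - y_i z) = k z F_i. The induction divides by 1 - y_i z
    one coefficient at a time. *)
Lemma mderiv_Gpoly_Fpoly i d s : (s < d)%N ->
  ((Gpoly d)`_s.+1)^`M(i) = k%:MP * (Fpoly i d)`_s.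
Proof.
elim: s => [|s IH] sd; rewrite mderiv_Gpoly //.
  have G0 : (Gpoly d)`_0 = 1.
    rewrite /Gpoly; elim/big_ind: _ => [|x y x1 y1|j _].
    - by rewrite coef1.
    - by rewrite coef0M x1 y1 mulr1.
    by rewrite coef_poly /= /bcoef /pochhammer big_ord0 fact0 divr1 scale1r.
  by rewrite G0 Fpoly0 mderivC mulr0 add0r.
rewrite IH 1?ltnW // -(Fpoly_Gpoly i) 1?ltnW //; ring.
Qed.

Lemma jf_Gpoly i d : jf i d.+1 - 'X_i * jf i d = (Gpoly d.+1)`_d.+1.
Proof. by rewrite -(jfE _ (leqnSn d)) -(Fpoly_Gpoly i). Qed.

Lemma jf_sym i j d :
  jf i d.+1 - 'X_i * jf i d = jf j d.+1 - 'X_j * jf j d.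
Proof. by rewrite !jf_Gpoly. Qed.

Lemma jf_deriv i j d : (jf j d.+1 - 'X_j * jf j d)^`M(i) = k%:MP * jf i d.
Proof. by rewrite jf_Gpoly mderiv_Gpoly_Fpoly // jfE. Qed.

Lemma pJack0 : pJack k (0%MM : 'X_{1..N}) = 1.
Proof. by rewrite pJackE big1 // => i _; rewrite mnm0E jf0. Qed.

Lemma pJack_sw x y a : sw x y (pJack k a) = pJack k (swm x y a).
Proof.
rewrite !pJackE swE rmorph_prod /= [RHS](reindex_inj (@perm_inj _ (tperm x y))).
by apply: eq_bigr => i _; rewrite -swE jf_sw mnmE tpermK.
Qed.

Lemma pJack_eq0 i a : a i = 0%N -> opDl k i (pJack k a) = 0.
Proof.
move=> ai; rewrite pJackE.
exact: (prodbasis_eq0 jf0 jf_sym jf_deriv jf_sw ai).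
Qed.

Lemma pJack_step i a : opDl k i (pJack k (U_(i) + a)%MM) =
  opDl k i ('X_i * pJack k a) + k%:MP * pJack k a.
Proof.
rewrite !pJackE.
exact: (prodbasis_step jf0 jf_sym jf_deriv jf_sw i a).
Qed.

End Kernel.

(** * The norm formula for generic kappa_0 *)

Section AdjacentInversion.
Variables (n : nat) (o : 'I_n -> nat) (r : rel nat) (g : 'I_n -> nat).
Hypothesis o_inj : injective o.
Hypothesis r_split : forall x y z, r x y -> r x z || r z y.

Lemma adjacent_inversion x y : (o x < o y)%N -> r (g x) (g y) ->
  exists i j, [/\ (o i < o j)%N, r (g i) (g j) &
    forall l, ~~ ((o i < o l)%N && (o l < o j)%N)].
Proof.
elim: {x y}(o y - o x)%N {-2}x {-2}y (leqnn (o y - o x)%N) => [|d IH] x y.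
  by rewrite leqn0 subn_eq0 leqNgt => /negbTE ->.
move=> dxy oxy gxy.
have [/existsP[l /andP[xl ly]]|] := boolP [exists l, (o x < o l)%N && (o l < o y)%N].
  by case/orP: (r_split (g l) gxy) => H; [apply: (IH x l)|apply: (IH l y)] => //; lia.
by rewrite negb_exists => /forallP adj; exists x, y.
Qed.

Definition inversions := #|[set p : 'I_n * 'I_n | (o p.1 < o p.2)%N && r (g p.1) (g p.2)]|.

End AdjacentInversion.

(** * Hook products of compositions *)

Section Combinatorics.
Variables (R : idomainType) (n : nat) (k : R).
Implicit Types (o : 'I_n -> nat) (g : 'X_{1..n}) (i j l : 'I_n) (t : R).

(* The leg of the box of row [i] with arm [a] in the diagram of a composition: a
   row before [i] counts as one box longer. *)
Definition leg o g i (a : nat) := #|[set s |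
  (o i < o s)%N && (g i - a <= g s <= g i)%N
  || (o s < o i)%N && (g i - a <= (g s).+1 <= g i)%N]|.

Definition hooks o g t : R :=
  \prod_i \prod_(a < g i) (a%:R + t + k * (leg o g i a)%:R).

Definition rpoch (a : R) (d : nat) : R := \prod_(j < d) (a + j%:R).

Definition opoch o g t : R := \prod_i rpoch (t - (rk o g i)%:R * k) (g i).

Section Swap.
Variables (o : 'I_n -> nat) (i j : 'I_n) (g : 'X_{1..n}).
Hypothesis o_inj : injective o.
Hypothesis oij : (o i < o j)%N.
Hypothesis adj : forall l, ~~ ((o i < o l)%N && (o l < o j)%N).
Let o2 := o \o tperm i j.

Let ij : i != j. Proof. by apply: contraTneq oij => ->; rewrite ltnn. Qed.
Let olt a b : a != b -> (a, b) != (i, j) -> (a, b) != (j, i) ->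
  (o2 a < o2 b)%N = (o a < o b)%N.
Proof. exact: swap_order_lt. Qed.
Let o2i : o2 i = o j. Proof. by rewrite /o2 /= tpermL. Qed.
Let o2j : o2 j = o i. Proof. by rewrite /o2 /= tpermR. Qed.

Lemma inversions_swap (r : rel nat) : r (g i) (g j) -> ~~ r (g j) (g i) ->
  (inversions o2 r g < inversions o r g)%N.
Proof.
move=> rij rji; apply/proper_card/properP; split; last first.
  exists (i, j); rewrite inE /= ?oij ?rij //.
  by rewrite o2i o2j ltnNge (ltnW oij).
apply/subsetP => -[a b]; rewrite !inE /= => /andP[ab gab].
have [ab'|] := eqVneq a b; first by move: ab; rewrite ab' ltnn.
have [[-> ->]|ne1] := eqVneq (a, b) (i, j); first by rewrite oij rij.
have [[E1 E2]|ne2] := eqVneq (a, b) (j, i); first by move: gab; rewrite E1 E2 (negbTE rji).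
by move=> neq; rewrite -olt // ab.
Qed.

Hypothesis gij : g i != g j.

Lemma rk_swap l : rk o2 g l = rk o g l.
Proof.
rewrite /rk; congr #|pred_of_set _|; apply/setP => s; rewrite !inE.
congr (_ || _); case: eqP => //= gsl.
have [->|sl] := eqVneq s l; first by rewrite !ltnn.
by apply: olt => //; apply/eqP => -[E1 E2]; case/eqP: gij; rewrite -E1 -E2 gsl.
Qed.

Lemma ev_swap l : ev k o2 g l = ev k o g l.
Proof. by rewrite /ev rk_swap. Qed.

Lemma opoch_swap t : opoch o2 g t = opoch o g t.
Proof. by apply: eq_bigr => l _; rewrite rk_swap. Qed.

Hypothesis gji : (g j < g i)%N.
Let a0 := (g i - g j).-1.

Let olt2 s l : s != l -> ~~ ((s == i) && (l == j)) -> ~~ ((s == j) && (l == i)) ->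
  ((o2 l < o2 s)%N = (o l < o s)%N) * ((o2 s < o2 l)%N = (o s < o l)%N).
Proof.
move=> sl H1 H2; have ls : l != s by rewrite eq_sym.
by split; apply: olt; rewrite ?xpair_eqE // andbC.
Qed.

Lemma leg_swap_neq l a : l != i -> (a < g l)%N -> leg o2 g l a = leg o g l a.
Proof.
move=> li al; rewrite /leg; congr #|pred_of_set _|; apply/setP => s; rewrite !inE.
have [->|sl] := eqVneq s l; first by rewrite !ltnn.
have [/andP[/eqP -> /eqP ->]|H1] := boolP ((s == i) && (l == j)).
  by rewrite o2i o2j; lia.
have [/andP[_ /eqP E]|H2] := boolP ((s == j) && (l == i)); first by rewrite E eqxx in li.
by have [-> ->] := olt2 sl H1 H2.
Qed.

(** When row j moves before row i it counts as one box longer. It then reaches column g j + 1, where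
    the arm of row i is g i - g j - 1; this is the only leg that changes. *)
Lemma leg_swap a : (a < g i)%N -> leg o2 g i a = (leg o g i a + (a == a0))%N.
Proof.
move=> ai; pose L (p : 'I_n -> nat) := [set s |
  (p i < p s)%N && (g i - a <= g s <= g i)%N
  || (p s < p i)%N && (g i - a <= (g s).+1 <= g i)%N].
rewrite /leg -/(L o2) -/(L o) (cardsD1 j (L o2)) (cardsD1 j (L o)).
have -> : L o2 :\ j = L o :\ j.
  apply/setP => s; rewrite !inE; have [//|sj /=] := eqVneq s j.
  have [->|si] := eqVneq s i; first by rewrite !ltnn.
  have [||-> ->//] := @olt2 s i si; first by rewrite (negbTE si).
  by rewrite (negbTE sj).
by rewrite !inE o2i o2j oij /a0; lia.
Qed.

(** The rows counted by this leg are those ranked strictly between i and j. *)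
Lemma leg_rk_swap : (rk o g i + (leg o g i a0).+1 = rk o g j)%N.
Proof.
pose A := [set x | (g i < g x)%N || (g x == g i) && (o x < o i)%N].
pose B := [set s | (o i < o s)%N && (g i - a0 <= g s <= g i)%N
      || (o s < o i)%N && (g i - a0 <= (g s).+1 <= g i)%N].
have AB : [disjoint A & i |: B].
  apply/pred0P => x /=; rewrite !inE; have [->|xi] := eqVneq x i; first by rewrite !ltnn andbF.
  have : o x != o i by rewrite (inj_eq o_inj).
  by rewrite /a0; lia.
have iB : i \notin B by rewrite inE !ltnn.
have -> : (leg o g i a0).+1 = #|i |: B| by rewrite cardsU1 iB.
rewrite {1}/rk -/A -cardsUI (disjoint_setI0 AB) cards0 addn0 /rk.
congr #|pred_of_set _|; apply/setP => x; rewrite !inE.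
have [->|xi] := eqVneq x i; first by rewrite gji orbT.
have [->|xj] := eqVneq x j; first by rewrite /a0; move: oij gji; lia.
have := adj_lt o_inj oij adj xi xj; have := adj_gt o_inj oij adj xi xj.
have : o x != o i by rewrite (inj_eq o_inj).
by rewrite /a0; move: gji; lia.
Qed.

Lemma hooks_swap t : hooks o2 g t * (a0%:R + t + k * (leg o g i a0)%:R) =
  hooks o g t * (a0%:R + t + k * ((leg o g i a0).+1)%:R).
Proof.
have a0i : (a0 < g i)%N by rewrite /a0; move: gji; lia.
rewrite /hooks (bigD1 i) //= [in RHS](bigD1 i) //=.
rewrite (bigD1 (Ordinal a0i)) //= [in RHS](bigD1 (Ordinal a0i)) //=.
rewrite leg_swap // eqxx addn1.
have -> : \prod_(l | l != i) \prod_(a < g l) (a%:R + t + k * (leg o2 g l a)%:R) =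
  \prod_(l | l != i) \prod_(a < g l) (a%:R + t + k * (leg o g l a)%:R).
  by apply: eq_bigr => l li; apply: eq_bigr => a _; rewrite leg_swap_neq.
have -> : \prod_(a < g i | a != Ordinal a0i) (a%:R + t + k * (leg o2 g i a)%:R) =
  \prod_(a < g i | a != Ordinal a0i) (a%:R + t + k * (leg o g i a)%:R).
  apply: eq_bigr => a aa; rewrite leg_swap //.
  by move: aa; rewrite -(inj_eq val_inj) /= => /negbTE ->; rewrite addn0.
by ring.
Qed.

Let X := ev k o g i - ev k o g j.

Lemma ev_diff_leg : X = a0%:R + 1 + k * ((leg o g i a0).+1)%:R.
Proof.
have E : (g i = a0 + 1 + g j)%N by rewrite /a0; move: gji; lia.
have E' : (g i)%:R = a0%:R + 1 + (g j)%:R :> R by rewrite {1}E !natrD.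
by rewrite /X /ev -leg_rk_swap E' natrD; ring.
Qed.

(** At the box that changes, the hook factor is X - k before and X after the swap; for the parameter
    k + 1 it is X before and X + k after. *)
Lemma hooks_swap1 : hooks o2 g 1 * (X - k) = hooks o g 1 * X.
Proof.
have := hooks_swap 1; rewrite ev_diff_leg => <-; congr (_ * _).
by rewrite -[(leg _ _ _ _).+1]addn1 natrD; ring.
Qed.

Lemma hooks_swapk : hooks o2 g (k + 1) * X = hooks o g (k + 1) * (X + k).
Proof.
have := hooks_swap (k + 1); rewrite ev_diff_leg -[(leg _ _ _ _).+1]addn1 natrD => H.
transitivity (hooks o2 g (k + 1) * (a0%:R + (k + 1) + k * (leg o g i a0)%:R)).
  by congr (_ * _); ring.
by rewrite H; congr (_ * _); ring.
Qed.

End Swap.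

Section Lower.
Variables (o : 'I_n -> nat) (t : 'I_n) (g : 'X_{1..n}).
Hypothesis o_inj : injective o.
Hypothesis o_top : forall l, (o l <= o t)%N.
Hypothesis gt0 : (0 < g t)%N.
Local Notation o3 := (order_cycle o t).
Let g' := (g - U_(t))%MM.

Let gE l : g l = (g' l + (l == t))%N.
Proof.
rewrite /g' mnmBE mnm1E eq_sym; case: eqP => [->|_] /=; last by lia.
by rewrite subnK.
Qed.

Let ot l : l != t -> (o l < o t)%N.
Proof. by move=> lt; rewrite ltn_neqAle o_top (inj_eq o_inj) lt. Qed.

(** Being last with g t boxes and being first with g t - 1 boxes give the same comparisons with
    every other row. *)
Lemma rk_lower l : rk o3 g' l = rk o g l.
Proof.
rewrite /rk; congr #|pred_of_set _|; apply/setP => s; rewrite !inE.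
have [->|sl] := eqVneq s l; first by rewrite !ltnn !andbF.
rewrite !(gE s) !(gE l) /order_cycle.
have [st|st] := eqVneq s t; have [lt|lt] := eqVneq l t.
- by rewrite st lt eqxx in sl.
- by have := ot lt; rewrite st; lia.
- by have := ot st; rewrite lt; lia.
by rewrite !addn0 ltnS.
Qed.

Lemma ev_lower l : ev k o3 g' l = ev k o g l - (l == t)%:R.
Proof. by rewrite /ev rk_lower [in RHS]gE natrD; ring. Qed.

Lemma opoch_lower x : opoch o g x =
  opoch o3 g' x * (x - (rk o g t)%:R * k + (g' t)%:R).
Proof.
rewrite /opoch (bigD1 t) //= [in RHS](bigD1 t) //= rk_lower gE eqxx addn1.
rewrite /rpoch big_ord_recr /= mulrAC; congr (_ * _ * _).
by apply: eq_bigr => l /negbTE lt; rewrite rk_lower gE lt addn0.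
Qed.

Lemma leg_lower l a : (a < g' l)%N -> leg o3 g' l a = leg o g l a.
Proof.
move=> al; rewrite /leg; congr #|pred_of_set _|; apply/setP => s; rewrite !inE.
have [->|sl] := eqVneq s l; first by rewrite !ltnn.
move: al; rewrite !(gE s) !(gE l) /order_cycle.
have [st|st] := eqVneq s t; have [lt|lt] := eqVneq l t => al.
- by rewrite st lt eqxx in sl.
- by have := ot lt; rewrite st; lia.
- by have := ot st; rewrite lt; lia.
by rewrite !addn0 !ltnS.
Qed.

(** The removed box is that of largest arm, in the first column; its leg consists of all rows ranked
    after t. *)
Lemma leg_new : (leg o g t (g' t) + (rk o g t).+1 = n)%N.
Proof.
pose A := [set x | (g t < g x)%N || (g x == g t) && (o x < o t)%N].
pose B := [set s | (o t < o s)%N && (g t - g' t <= g s <= g t)%N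
      || (o s < o t)%N && (g t - g' t <= (g s).+1 <= g t)%N].
have AB : [disjoint B & t |: A].
  apply/pred0P => x /=; rewrite !inE; have [->|xt] := eqVneq x t; first by rewrite !ltnn.
  by have := ot xt; lia.
have tA : t \notin A by rewrite inE !ltnn andbF.
have -> : (rk o g t).+1 = #|t |: A| by rewrite cardsU1 tA.
rewrite {1}/leg -/B -cardsUI (disjoint_setI0 AB) cards0 addn0.
rewrite -[RHS](card_ord n) -cardsT; congr #|pred_of_set _|; apply/setP => x.
rewrite !inE; have [->|xt] := eqVneq x t; first by rewrite orbT.
have := ot xt; have := gE t; rewrite eqxx; lia.
Qed.

Lemma hooks_lower x : hooks o g x =
  hooks o3 g' x * ((g' t)%:R + x + k * (leg o g t (g' t))%:R).
Proof.
rewrite /hooks (bigD1 t) //= [in RHS](bigD1 t) //=.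
have P (d e : nat) (G : nat -> R) : d = e.+1 ->
    \prod_(a < d) G a = \prod_(a < e) G a * G e.
  by move=> ->; rewrite big_ord_recr.
rewrite (P (g t) (g' t) (fun a => a%:R + x + k * (leg o g t a)%:R)); last first.
  by rewrite gE eqxx addn1.
rewrite mulrAC; congr (_ * _ * _).
  by apply: eq_bigr => a _; rewrite leg_lower.
apply: eq_bigr => l /negbTE lt.
have gl : g l = g' l by rewrite gE lt addn0.
have Q (d e : nat) (G : nat -> R) : d = e ->
    \prod_(a < d) G a = \prod_(a < e) G a by move=> ->.
rewrite (Q (g l) (g' l) (fun a => a%:R + x + k * (leg o g l a)%:R)) //.
by apply: eq_bigr => a _; rewrite leg_lower.
Qed.

Let x0 := ev k o g t - 1.

Lemma ev_leg : x0 = (g' t)%:R + (k + 1) + k * (leg o g t (g' t))%:R.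
Proof.
have E : n%:R = (leg o g t (g' t))%:R + ((rk o g t)%:R + 1) :> R.
  by rewrite natr1 -natrD leg_new.
have E' : (g t)%:R = (g' t)%:R + 1 :> R by rewrite {1}gE eqxx natrD.
by rewrite /x0 /ev E E'; ring.
Qed.

Lemma hooks_lowerk : hooks o g (k + 1) = hooks o3 g' (k + 1) * x0.
Proof. by rewrite hooks_lower ev_leg. Qed.

Lemma hooks_lower1 : hooks o g 1 = hooks o3 g' 1 * (x0 - k).
Proof. by rewrite hooks_lower ev_leg; congr (_ * _); ring. Qed.

End Lower.
End Combinatorics.

Definition normfactor (R : idomainType) (n : nat) (k : R) (m : nat) (q : R)
    (c : nat -> R) (o : 'I_n -> nat) (g : 'X_{1..n}) : R :=
  q ^+ (m * mdeg g) * \prod_(1 <= d < m) opoch k o g ((n%:R - 1) * k + c d)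
  * opoch k o g (n%:R * k + 1).

(** * Induction on degree and inversions *)

Section NormInduction.
Variables (F : fieldType) (n : nat) (k : F) (pb : 'X_{1..n} -> {mpoly F[n]}).
Hypothesis gen : forall x y : int, x%:~R + y%:~R * k = 0 -> x = 0 /\ y = 0.
Hypothesis pb0 : pb 0%MM = 1.
Hypothesis pb_sw : forall x y a, sw x y (pb a) = pb (swm x y a).
Hypothesis pb_eq0 : forall i (a : 'X_{1..n}), a i = 0%N -> opDl k i (pb a) = 0.
Hypothesis pb_step : forall i a,
  opDl k i (pb (U_(i) + a)%MM) = opDl k i ('X_i * pb a) + k%:MP * pb a.
Hypothesis pb_sym : forall a b, (pb a)@_b = (pb b)@_a.
Variables (m : nat) (q : F) (c : nat -> F).
Hypothesis m_gt0 : (0 < m)%N.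
Implicit Types (u h : {mpoly F[n]}) (g : 'X_{1..n}) (o : 'I_n -> nat).
Local Notation form := (form m k q c).
Local Notation P := (pexp pb).

Local Notation normfactor := (normfactor k m q c).

Definition homog_at u g := forall a, u@_a != 0 -> mdeg a = mdeg g.

Definition eigen_at u o g :=
  forall i, opUo k o i (P u) = (ev k o g i)%:MP * P u.

(* Here [P u] is the eigenfunction and [u@_g] its leading coefficient, which
   neither step of the induction changes. *)
Definition norm_spec u o g :=
  (forall l h, form (P u) (opUo k o l h) = ev k o g l * form (P u) h) /\
  form (P u) (P u) * hooks k o g 1 =
    u@_g ^+ 2 * normfactor o g * hooks k o g (k + 1).

Lemma norm_spec0 u o g : injective o -> mdeg g = 0%N -> homog_at u g ->
  norm_spec u o g.
Proof.
move=> o_inj /eqP; rewrite mdeg_eq0 => /eqP -> hu.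
have Pu : P u = (u@_0)%:MP.
  have -> : u = (u@_0)%:MP * 'X_[0].
    apply/mpolyP => a; rewrite mcoeffCM mcoeffX; have [<-|a0] := eqVneq 0%MM a.
      by rewrite mulr1.
    rewrite mulr0; apply/eqP; apply: contraNT a0 => /hu.
    by rewrite mdeg0 => /eqP; rewrite mdeg_eq0 eq_sym.
  by rewrite pexp_mulC pexpX pb0 mcoeffCM mcoeffX eqxx !mulr1.
have formP h : form (P u) h = u@_0 * h@_0.
  by rewrite Pu -[_%:MP]mulr1 form_mulCl form1l.
have o1 y : opoch k o 0%MM y = 1.
  by rewrite /opoch big1 // => i _; rewrite mnm0E /rpoch big_ord0.
have h1 y : hooks k o 0%MM y = 1.
  by rewrite /hooks big1 // => i _; rewrite mnm0E big_ord0.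
split=> [l h|]; last first.
  rewrite formP Pu mcoeffC eqxx /normfactor !h1 mdeg0 muln0 expr0 o1.
  rewrite big1 => [|d _]; last by rewrite o1.
  by rewrite !mulr1 expr2.
rewrite !formP mulrCA; congr (_ * _); rewrite mcoeff_opUo.
have [h0|h0] := boolP (0%MM \in msupp h).
  rewrite (bigD1_seq 0%MM) ?msupp_uniq //= opUoX_diag // mulrC big1 ?addr0 //.
  move=> b b0; apply/eqP; rewrite mulf_eq0; apply/orP; right; apply: contraT.
  rewrite eq_sym in b0 => /(opUoX_off o_inj b0)/andP[/eqP E _].
  by case/eqP: b0; apply/esym/eqP; rewrite -mdeg_eq0 -E mdeg0.
rewrite (memN_msupp_eq0 h0) mulr0 big1_seq // => b /andP[_ bh].
have b0 : 0%MM != b by apply: contraNneq h0 => ->.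
apply/eqP; rewrite mulf_eq0; apply/orP; right; apply: contraT.
move=> /(opUoX_off o_inj b0)/andP[/eqP E _].
by case/eqP: b0; apply/esym/eqP; rewrite -mdeg_eq0 -E mdeg0.
Qed.

Lemma norm_spec_lower u o g t : injective o -> (forall l, o l <= o t)%N ->
  (0 < g t)%N -> homog_at u g -> eigen_at u o g ->
  (forall v, homog_at v (g - U_(t))%MM ->
     eigen_at v (order_cycle o t) (g - U_(t))%MM ->
     norm_spec v (order_cycle o t) (g - U_(t))%MM) ->
  norm_spec u o g.
Proof.
move=> o_inj o_top gt0 hu eu IH.
pose x := ev k o g t - 1; pose u' := bshift t u; pose o3 := order_cycle o t.
pose g' := (g - U_(t))%MM.
have gg' : (g' + U_(t))%MM = g by rewrite submK // lep1mP -lt0n.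
have o3_inj : injective o3 by apply: order_cycle_inj.
have xE : x = (g t : int)%:~R + ((n : int) - (rk o g t : int))%:~R * k.
  by rewrite /x /ev rmorphB /=; ring.
have x0 : x != 0 by rewrite xE; apply: gen_neq0 => //; lia.
have xk : x - k != 0.
  have -> : x - k = (g t : int)%:~R + ((n : int) - (rk o g t : int) - 1)%:~R * k.
    by rewrite xE !rmorphB /=; ring.
  by apply: gen_neq0 => //; lia.
have W : opDl k t (P u) = opUo k o3 t (P u').
  by rewrite opUo_bottom /u' -(opDl_pexp pb_eq0 pb_step).
have el := eigen_lower o_inj o_top eu.
(* U_t for the order [o3] takes the same value on both sides: D_t P u has eigenvalue x, and U_t maps
   P u' to D_t P u. *)
have Z'E : opDl k t (P u) = x%:MP * P u'.
  apply/eqP; rewrite -subr_eq0; apply/eqP/(opUo_inj gen o3_inj (i := t)).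
  by rewrite opUoB opUo_mulC -W (el t) eqxx subrr.
have hu' : homog_at u' g'.
  move=> a; rewrite mcoeff_bshift => /hu; rewrite -gg' !mdegD.
  by move/addIn.
have eu' : eigen_at u' o3 g'.
  move=> i; have xM : x%:MP != 0 :> {mpoly F[n]} by rewrite mpolyC_eq0.
  apply: (mulfI xM); rewrite -opUo_mulC -Z'E el -(ev_lower k o_inj o_top gt0).
  by rewrite Z'E mulrCA.
have [L' N'] := IH u' hu' eu'.
have L'2 l h : form (P u') (opUo k o3 l h) = (ev k o g l - (l == t)%:R) * form (P u') h.
  by rewrite L' (ev_lower k o_inj o_top gt0).
split; first exact: (left_eigen_lower o_inj o_top eu m_gt0 Z'E (erefl x) xk L'2).
have NL := norm_lower o_inj o_top eu m_gt0 Z'E (erefl x) L'2.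
have ug : u'@_g' = u@_g by rewrite mcoeff_bshift gg'.
have NF : normfactor o g = x * (q ^+ m * \prod_(1 <= d < m) (c d + x - k - 1))
    * normfactor o3 g'.
  have gtE : (g t)%:R = (g' t)%:R + 1 :> F.
    by rewrite -[in LHS]gg' mnmDE mnm1E eqxx natrD.
  rewrite /normfactor -[in mdeg g]gg' mdegD mdeg1 mulnDr muln1 exprD.
  rewrite (opoch_lower k o_inj o_top gt0 (n%:R * k + 1)) -/o3 -/g'.
  rewrite (eq_bigr (fun d => opoch k o3 g' ((n%:R - 1) * k + c d)
     * (c d + x - k - 1))) => [|d _]; last first.
    rewrite (opoch_lower k o_inj o_top gt0); congr (_ * _).
    by rewrite /x /ev gtE; ring.
  rewrite big_split /=.
  have -> : n%:R * k + 1 - (rk o g t)%:R * k + (g' t)%:R = x.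
    by rewrite /x /ev gtE; ring.
  by ring.
rewrite (hooks_lower1 k o_inj o_top gt0) (hooks_lowerk k o_inj o_top gt0).
rewrite -/x -/o3 -/g' NF.
have -> : form (P u) (P u) * (hooks k o3 g' 1 * (x - k)) =
  ((x - k) * form (P u) (P u)) * hooks k o3 g' 1 by ring.
rewrite NL -[_ * form (P u') (P u') * _]mulrA N' ug; ring.
Qed.

Lemma norm_spec_swap u o g i j : injective o -> (o i < o j)%N ->
  (forall l, ~~ ((o i < o l)%N && (o l < o j)%N)) -> (g j < g i)%N ->
  homog_at u g -> eigen_at u o g ->
  (forall v, homog_at v g -> eigen_at v (o \o tperm i j) g ->
     norm_spec v (o \o tperm i j) g) ->
  norm_spec u o g.
Proof.
move=> o_inj oij adj gji hu eu IH.
have gij : g i != g j by rewrite gtn_eqF.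
have ij : i != j by apply: contraTneq oij => ->; rewrite ltnn.
pose X := ev k o g i - ev k o g j; pose r := k / X.
have XE : X = ((g i - g j)%N : int)%:~R + ((rk o g j : int) - (rk o g i : int))%:~R * k.
  by rewrite -[in RHS]pmulrn (natrB _ (ltnW gji)) rmorphB /= /X /ev; ring.
have X0 : X != 0 by rewrite XE; apply: gen_neq0 => //; move: gji; lia.
have Xpk : X + k != 0.
  have -> : X + k = ((g i - g j)%N : int)%:~R
      + ((rk o g j : int) - (rk o g i : int) + 1)%:~R * k.
    by rewrite XE rmorphD /=; ring.
  by apply: gen_neq0 => //; move: gji; lia.
have Xmk : X - k != 0.
  have -> : X - k = ((g i - g j)%N : int)%:~R
      + ((rk o g j : int) - (rk o g i : int) - 1)%:~R * k.
    by rewrite XE rmorphB /=; ring.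
  by apply: gen_neq0 => //; move: gji; lia.
have er : r * X = k by rewrite /r divfK.
(* 1 - r^2 = (X + k)(X - k) / X^2, and both factors are nonzero by genericity. *)
have r1 : 1 - r ^+ 2 != 0.
  have E : (1 - r ^+ 2) * X ^+ 2 = (X + k) * (X - k) by rewrite -er; ring.
  have : (1 - r ^+ 2) * X ^+ 2 != 0 by rewrite E mulf_neq0.
  by rewrite mulf_eq0 negb_or => /andP[].
pose u2 := u - r%:MP * sw i j u; pose o2 := o \o tperm i j.
have Pu2 : P u2 = P u - r%:MP * sw i j (P u).
  by rewrite /u2 pexpB pexp_mulC (pexp_sw pb_sw).
have mdeg_swm a : mdeg (swm i j a) = mdeg a.
  rewrite !mdegE [RHS](reindex_inj (@perm_inj _ (tperm i j))).
  by apply: eq_bigr => l _; rewrite mnmE.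
have mcoeff_sw a : (sw i j u)@_a = u@_(swm i j a) by rewrite swE mcoeff_sym.
have hu2 : homog_at u2 g.
  move=> a; rewrite mcoeffB mcoeffCM mcoeff_sw.
  have [ua|/hu//] := eqVneq u@_a 0; have [ua'|/hu] := eqVneq u@_(swm i j a) 0.
    by rewrite ua ua' mulr0 subrr eqxx.
  by rewrite mdeg_swm.
have eu2 : eigen_at u2 o2 g.
  move=> l; rewrite Pu2 (ev_swap k o_inj oij adj gij).
  exact: (eigen_swap o_inj oij adj eu er).
have [L2 N2] := IH u2 hu2 eu2.
have L2' l h : form (P u - r%:MP * sw i j (P u)) (opUo k o2 l h)
    = ev k o g l * form (P u - r%:MP * sw i j (P u)) h.
  by rewrite -Pu2 L2 (ev_swap k o_inj oij adj gij).
split; first exact: (left_eigen_swap o_inj oij adj er m_gt0 r1 L2').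
have NS : (1 - r ^+ 2) * form (P u) (P u) = form (P u2) (P u2).
  rewrite Pu2; apply: (norm_swap eu m_gt0 L2'); rewrite -subr_eq0; exact: X0.
(* The swapped exponent is [lower] than g, while u is supported at g and above it. Hence the swap
   leaves the leading coefficient unchanged. *)
have usw : u@_(swm i j g) = 0.
  apply/eqP; apply: contraT => ug.
  have low_sw : lower o (swm i j g) g.
    have -> : swm i j g = transfer i j g (g j) (g i).
      apply/mnmP => l; rewrite !mnmE.
      by case: tpermP => [->|->|/eqP/negbTE -> /eqP/negbTE ->//];
        rewrite ?eqxx // eq_sym (negbTE ij).
    apply: lower_transfer => //; first by rewrite addnC.
    by rewrite !eqxx /=; apply/orP; right; nia.
  have le := pexp_left_eigen gen pb0 pb_sw pb_eq0 pb_step pb_sym o_inj eu.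
  case/orP: (left_eigen_support gen o_inj le ug) => [/eqP E|H].
    by case/eqP: gij; rewrite -{1}E mnmE tpermL.
  by have := lower_trans low_sw H; rewrite lowerxx.
have u2g : u2@_g = u@_g by rewrite mcoeffB mcoeffCM mcoeff_sw usw mulr0 subr0.
have NF : normfactor o2 g = normfactor o g.
  rewrite /normfactor (opoch_swap k o_inj oij adj gij); congr (_ * _ * _).
  by apply: eq_bigr => d _; rewrite (opoch_swap k o_inj oij adj gij).
have H1 := hooks_swap1 k o_inj oij adj gij gji; rewrite -/X -/o2 in H1.
have Hk := hooks_swapk k o_inj oij adj gij gji; rewrite -/X -/o2 in Hk.
have nz : X * (X ^+ 2 * (1 - r ^+ 2)) != 0 by rewrite !mulf_neq0 ?expf_neq0.
apply: (mulfI nz).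
transitivity (X ^+ 2 * ((1 - r ^+ 2) * form (P u) (P u)) * (hooks k o g 1 * X)).
  by ring.
rewrite NS -H1.
transitivity (X ^+ 2 * (X - k) * (form (P u2) (P u2) * hooks k o2 g 1)); first by ring.
rewrite N2 u2g NF.
transitivity (X * (X - k) * u@_g ^+ 2 * normfactor o g * (hooks k o2 g (k + 1) * X)).
  by ring.
rewrite Hk -er; ring.
Qed.

Lemma norm_spec_sorted u o g : injective o ->
  (forall x y, (o x < o y)%N -> (g x <= g y)%N) -> (0 < mdeg g)%N ->
  homog_at u g -> eigen_at u o g ->
  (forall v o' g', (mdeg g').+1 = mdeg g -> injective o' -> homog_at v g' ->
     eigen_at v o' g' -> norm_spec v o' g') ->
  norm_spec u o g.
Proof.
move=> o_inj srt g_gt0 hu eu IH.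
have [i0 gi0] : exists i, g i != 0%N.
  apply/existsP; apply: contraTT g_gt0; rewrite negb_exists => /forallP a0.
  by rewrite mdegE big1 // => l _; apply/eqP; rewrite -[_ == _]negbK a0.
pose t := [arg max_(l > i0) o l].
have o_top l : (o l <= o t)%N by rewrite /t; case: arg_maxnP => // l' _; apply.
have gt0 : (0 < g t)%N.
  rewrite lt0n; apply: contraNneq gi0 => g0.
  have [->|it] := eqVneq i0 t; first exact/eqP.
  rewrite -leqn0 -g0 srt // ltn_neqAle o_top andbT.
  by apply: contra it => /eqP/o_inj->.
apply: (norm_spec_lower o_inj o_top gt0 hu eu) => v hv ev'.
apply: IH => //; last exact: order_cycle_inj.
have E : ((g - U_(t)) + U_(t))%MM = g by rewrite submK // lep1mP -lt0n.
by rewrite -[in RHS]E mdegD mdeg1 addn1.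
Qed.

(** Outer induction on the degree, inner induction on the number of pairs in which the larger
    exponent comes first. Lowering is applied once there are no such pairs, since the last index
    then has a positive exponent. *)
Theorem norm_spec_all u o g : injective o -> homog_at u g -> eigen_at u o g ->
  norm_spec u o g.
Proof.
move: {-1}(mdeg g) (leqnn (mdeg g)) => d; elim: d g u o => [|d IHd] g u o.
  by rewrite leqn0 => /eqP dg o_inj hu _; apply: norm_spec0.
rewrite leq_eqVlt => /orP[/eqP dg|]; last by rewrite ltnS; apply: IHd.
pose r x y := (y < x)%N.
have r_split x y z : r x y -> r x z || r z y by rewrite /r; lia.
move: {-1}(inversions o r g) (leqnn (inversions o r g)) => e.
elim: e u o => [|e IHe] u o oe o_inj hu eu.
  apply: norm_spec_sorted => // [x y oxy||v o' g']; last 2 first.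
  - by rewrite dg.
  - by rewrite dg => -[E]; apply: IHd; rewrite E.
  move: oe; rewrite leqn0 cards_eq0 => /eqP/setP/(_ (x, y)).
  by rewrite !inE /= oxy /r ltnNge => /negbFE.
have [no|[[x y]]] := set_0Vmem [set p : 'I_n * 'I_n | (o p.1 < o p.2)%N && r (g p.1) (g p.2)].
  apply: norm_spec_sorted => // [x y oxy||v o' g']; last 2 first.
  - by rewrite dg.
  - by rewrite dg => -[E]; apply: IHd; rewrite E.
  move/setP/(_ (x, y)): no.
  by rewrite !inE /= oxy /r ltnNge => /negbFE.
rewrite inE /= => /andP[oxy gxy].
have [i [j [oij gij adj]]] := adjacent_inversion r_split oxy gxy.
apply: (norm_spec_swap o_inj oij adj gij hu eu) => v hv ev'.
apply: IHe => //; last exact: inj_comp o_inj (@perm_inj _ _).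
rewrite -ltnS (leq_trans _ oe) // inversions_swap //.
by rewrite /r -leqNgt ltnW.
Qed.

End NormInduction.

(** * Specialization of kappa_0 *)

Section Morphism.
Variables (R S : idomainType) (f : {rmorphism R -> S}) (n : nat).
Implicit Types (p h : {mpoly R[n]}) (i j : 'I_n) (k : R) (g a b : 'X_{1..n}).
Implicit Types (o : 'I_n -> nat).
Local Notation mf := (@map_mpoly n R S f).

Lemma map_sw i j p : mf (sw i j p) = sw i j (mf p).
Proof.
apply/mpolyP => a; rewrite mcoeff_map_mpoly !swE !mcoeff_sym.
by rewrite mcoeff_map_mpoly.
Qed.

Lemma map_mpolyXU i : mf 'X_i = 'X_i.
Proof. exact: map_mpolyX. Qed.

Lemma map_mulC x p : mf (x%:MP * p) = (f x)%:MP * mf p.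
Proof. by rewrite rmorphM /= map_mpolyC. Qed.

Lemma map_dd i j p : i != j -> mf (dd i j p) = dd i j (mf p).
Proof.
move=> ij; apply/esym/ddE => //.
by rewrite -map_sw -rmorphB -ddP // rmorphM rmorphB /= !map_mpolyXU.
Qed.

Lemma map_mderiv i p : mf p^`M(i) = (mf p)^`M(i).
Proof.
apply/mpolyP => a; rewrite mcoeff_map_mpoly !mcoeff_deriv raddfMn.
by rewrite mcoeff_map_mpoly.
Qed.

Lemma map_opDl k i p : mf (opDl k i p) = opDl (f k) i (mf p).
Proof.
rewrite !opDlE rmorphD rmorphM /= map_mpolyC map_mderiv rmorph_sum /=.
by congr (_ + _ * _); apply: eq_bigr => j ji; rewrite map_dd // eq_sym.
Qed.

Lemma map_opUo k o i p : mf (opUo k o i p) = opUo (f k) o i (mf p).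
Proof.
rewrite !opUoE rmorphB rmorphD !rmorphM /= map_mpolyC map_opDl rmorphM /=.
rewrite map_mpolyXU rmorph_sum /=.
by congr (_ - _ * _); apply: eq_bigr => j _; rewrite map_sw.
Qed.

Lemma map_opK k (P : pred 'I_n) i p : mf (opK k P i p) = opK (f k) P i (mf p).
Proof.
rewrite !opKE rmorphD !rmorphM /= map_mpolyC map_opDl map_mpolyXU rmorph_sum /=.
by congr (_ + _ * _); apply: eq_bigr => j _; rewrite map_sw.
Qed.

Variables (m : nat) (k q : R) (c : nat -> R).

Lemma map_levelop i b h :
  mf (levelop k c i b h) = levelop (f k) (f \o c) i b (mf h).
Proof.
rewrite /levelop; case: ifP => _; first by rewrite map_opDl.
by rewrite rmorphD rmorphM /= map_mpolyC map_opK.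
Qed.

Definition map_state (st : 'X_{1..n} * {mpoly R[n]}) := (st.1, mf st.2).

Lemma map_dstep i st : map_state (dstep m k q c i st)
  = dstep m (f k) (f q) (f \o c) i (map_state st).
Proof.
by rewrite /dstep /map_state /= rmorphM /= map_mpolyC map_levelop.
Qed.

Lemma map_dpow a st : map_state (fpow (dstep m k q c) a st)
  = fpow (dstep m (f k) (f q) (f \o c)) a (map_state st).
Proof.
rewrite /fpow; elim: (enum _) => //= i s <-.
by elim: (a i) => //= d <-; rewrite map_dstep.
Qed.

Lemma map_form p h :
  f (form m k q c p h) = form m (f k) (f q) (f \o c) (mf p) (mf h).
Proof.
(* The morphism may kill coefficients, so both sums are taken over a common range of exponents. *)
pose d := maxn (msize p) (msize (mf p)).
rewrite /form (@mlinwE _ _ _ _ d) ?leq_maxl // [in RHS](@mlinwE _ _ _ _ d) ?leq_maxr //.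
rewrite rmorph_sum /=; apply: eq_bigr => a _.
rewrite !/(_ *: _) /= rmorphM mcoeff_map_mpoly; congr (_ * _).
have := map_dpow (a *+ m) (0%MM, h) => /(congr1 (fun st => st.2@_0%MM)) /= <-.
by rewrite mcoeff_map_mpoly.
Qed.

Lemma map_ev o g i : f (ev k o g i) = ev (f k) o g i.
Proof. by rewrite /ev !rmorphD rmorphM rmorphB /= !rmorph_nat rmorph1. Qed.

Lemma map_rpoch x d : f (rpoch x d) = rpoch (f x) d.
Proof.
by rewrite /rpoch rmorph_prod; apply: eq_bigr => j _; rewrite rmorphD rmorph_nat.
Qed.

Lemma map_opoch o g t : f (opoch k o g t) = opoch (f k) o g (f t).
Proof.
rewrite /opoch rmorph_prod; apply: eq_bigr => i _.
by rewrite map_rpoch rmorphB rmorphM /= rmorph_nat.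
Qed.

Lemma map_hooks o g t : f (hooks k o g t) = hooks (f k) o g (f t).
Proof.
rewrite /hooks rmorph_prod; apply: eq_bigr => i _; rewrite rmorph_prod.
apply: eq_bigr => j _.
by rewrite !rmorphD rmorphM /= !rmorph_nat.
Qed.

Lemma map_normfactor o g : f (normfactor k m q c o g)
  = normfactor (f k) m (f q) (f \o c) o g.
Proof.
rewrite /normfactor !rmorphM rmorphXn rmorph_prod /= !map_opoch.
rewrite rmorphD rmorphM /= rmorph1 rmorph_nat; congr (_ * _ * _).
apply: eq_bigr => d _; rewrite map_opoch rmorphD rmorphM rmorphB /=.
by rewrite rmorph1 rmorph_nat.
Qed.

End Morphism.

Section DefinitionsLink.
Variables (F : fieldType) (N : nat).
Implicit Types (k : F) (g h p q r : {mpoly F[N]}) (i j : 'I_N) (mu nu : 'X_{1..N}).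

Lemma exact_quoE p q r : q != 0 -> r * q = p -> exact_quo p q = r.
Proof.
move=> q0 rq; apply: (mulIf q0); rewrite rq /exact_quo.
by case: classical_sets.xgetP => [y _ ->//|/(_ r)]; rewrite rq.
Qed.

Lemma swapE i j p : swap i j p = sw i j p.
Proof. by rewrite swE. Qed.

Lemma opDE k i h : opD k i h = opDl k i h.
Proof.
rewrite /opD opDlE mul_mpolyC; congr (_ + _ *: _); apply: eq_bigr => j ji.
have ij : i != j by rewrite eq_sym.
by apply: exact_quoE; rewrite ?subX_neq0 // mulrC ddP // swapE.
Qed.

Lemma opUE k i h : opU k i h = opUo k (@nat_of_ord N) i h.
Proof.
rewrite /opU opUoE opDE !mul_mpolyC; congr (_ - _ *: _).
by apply: eq_bigr => j _; rewrite swapE.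
Qed.

Lemma xiE k mu i : xi k mu i = ev k (@nat_of_ord N) mu i.
Proof.
rewrite /xi /ev /rk; congr (k * _ + _ + _).
rewrite -addrA -opprD -natrD; congr (_ - _%:R); rewrite -cardsUI.
rewrite [X in (_ + #|pred_of_set X|)%N](_ : _ = set0) ?cards0 ?addn0.
  by apply: eq_card => j; rewrite !inE andbC.
apply/setP => j; rewrite !inE; apply/negP => /andP[H /andP[_ /eqP E]].
by rewrite E ltnn in H.
Qed.

End DefinitionsLink.

(** * Dominance implies the order [lower] *)

Section Dominance.
Variable N : nat.
Implicit Types (mu nu : 'X_{1..N}) (i j : 'I_N) (a b c : 'I_N -> nat).

(** Abel summation by layers: for nonincreasing c each set {i : t < c i} is an initial segment, so
    the inner sums are the partial sums compared by dominance. *)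
Lemma layer_cake a c M : (forall i, c i <= M)%N ->
  (\sum_i a i * c i = \sum_(t < M) \sum_(i | t < c i) a i)%N.
Proof.
move=> cM; rewrite (exchange_big_dep xpredT) //=; apply: eq_bigr => i _.
rewrite sum_nat_const mulnC; congr (_ * _)%N.
have E : (c i = \sum_(t < c i) 1)%N by rewrite sum1_card card_ord.
by rewrite {1}E (big_ord_widen _ (fun _ => 1%N) (cM i)) sum1_card.
Qed.

Lemma sum_down_closed a b (P : pred 'I_N) :
  (forall i j, (i <= j)%N -> P j -> P i) ->
  (forall j, \sum_(i < N | (i <= j)%N) b i <= \sum_(i < N | (i <= j)%N) a i)%N ->
  (\sum_(i | P i) b i <= \sum_(i | P i) a i)%N.
Proof.
move=> Pd dom; have [j0 Pj0|P0] := pickP P; last by rewrite !big_pred0.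
pose j := [arg max_(l > j0 | P l) (l : nat)].
have PE i : P i = (i <= j)%N.
  rewrite /j; case: arg_maxnP => // l Pl lmax; apply/idP/idP => [/lmax//|il].
  exact: Pd il Pl.
by rewrite !(eq_bigl _ _ PE).
Qed.

Lemma dominance_sum a b c : (forall i j, (i <= j)%N -> (c j <= c i)%N) ->
  (forall j, \sum_(i < N | (i <= j)%N) b i <= \sum_(i < N | (i <= j)%N) a i)%N ->
  (\sum_i b i * c i <= \sum_i a i * c i)%N.
Proof.
move=> c_dec dom; pose M := \max_i c i.
have cM i : (c i <= M)%N by apply: leq_bigmax.
rewrite !(layer_cake _ cM); apply: leq_sum => t _.
by apply: sum_down_closed dom => i j ij H; apply: leq_trans H (c_dec _ _ ij).
Qed.

Lemma big_mnm_plus (T : Type) (idx : T) (op : Monoid.com_law idx) (f : nat -> T) mu :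
  \big[op/idx]_i f (mnm_plus mu i) = \big[op/idx]_i f (mu i).
Proof.
have -> : \big[op/idx]_i f (mu i) = \big[op/idx]_(x <- (mu : N.-tuple nat)) f x.
  by rewrite (big_tuple _ _ (mu : N.-tuple nat) xpredT f).
have pe : perm_eq (sort geq (mu : N.-tuple nat)) (mu : N.-tuple nat) by rewrite perm_sort.
rewrite -(perm_big _ pe) /=.
by rewrite (big_tuple _ _ [tuple of sort geq (mu : N.-tuple nat)] xpredT f).
Qed.

Lemma mnm_plus_dec mu i j : (i <= j)%N -> (mnm_plus mu j <= mnm_plus mu i)%N.
Proof.
move=> ij; have sz : size (sort geq mu) = N by rewrite size_sort size_tuple.
rewrite /mnm_plus !multinomE !(tnth_nth 0%N) /=.
have geq_trans : transitive geq by move=> y x z; rewrite /geq /=; lia.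
apply: (sorted_leq_nth geq_trans _ 0%N) => //; rewrite ?inE ?sz //.
- by move=> x; rewrite /geq /=.
- by apply: sort_sorted => x y; rewrite /geq /=; lia.
Qed.

Lemma sqdeg_plus mu : sqdeg (mnm_plus mu) = sqdeg mu.
Proof. exact: (big_mnm_plus addn (fun x => x * x)%N mu). Qed.

(** For sorted a dominating b, the sum of b_i^2 is at most that of a_i b_i; then 2 a_i b_i <= a_i^2
    + b_i^2, strictly for some i. *)
Lemma dominance_sqdeg mu nu : dominates (mnm_plus nu) (mnm_plus mu) ->
  (sqdeg mu < sqdeg nu)%N.
Proof.
rewrite -(sqdeg_plus mu) -(sqdeg_plus nu); set a := mnm_plus nu; set b := mnm_plus mu => /andP[neq /forallP dom].
have le : (\sum_i b i * b i <= \sum_i a i * b i)%N.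
  by apply: dominance_sum dom => i j; apply: mnm_plus_dec.
have [l lneq] : exists l, a l != b l.
  apply/existsP; apply: contraNT neq; rewrite negb_exists => /forallP H.
  by apply/eqP/mnmP => l; apply/eqP; rewrite -[_ == _]negbK H.
have lt : (\sum_i (2 * (a i * b i)) < \sum_i (a i * a i + b i * b i))%N.
  rewrite (bigD1 l) //= [X in (_ < X)%N](bigD1 l) //= -addSn leq_add //.
    by rewrite !mulnn (ltn_leqif (nat_Cauchy _ _)).
  by apply: leq_sum => i _; rewrite !mulnn nat_Cauchy.
move: le lt; rewrite -big_distrr big_split /= /sqdeg.
move: (\sum_i a i * a i)%N (\sum_i b i * b i)%N (\sum_i a i * b i)%N => x y z; lia.
Qed.

Lemma eq_partial_sums a b :
  (forall j, \sum_(i < N | (i <= j)%N) b i = \sum_(i < N | (i <= j)%N) a i)%N ->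
  a =1 b.
Proof.
move=> S i; elim/ltn_ind: {i}(i : nat) {-2}i (erefl (i : nat)) => d IH i id.
have := S i; rewrite (bigD1 i) //= [in RHS](bigD1 i) //=.
rewrite (eq_bigr a) => [|l /andP[li li']]; first by move/addIn.
by rewrite (IH l) // -id ltn_neqAle li andbT.
Qed.

(** Up to the constant N |x|, [oweight] is minus the sum of the x_i (N - i), which is the sum of all
    partial sums of x. *)
Lemma dominance_oweight mu nu : dominates nu mu -> mdeg nu = mdeg mu ->
  (oweight (@nat_of_ord N) nu < oweight (@nat_of_ord N) mu)%N.
Proof.
case/andP => neq /forallP dom deg.
pose c i := (N - i)%N.
have ocE x : (oweight (@nat_of_ord N) x + \sum_i x i * c i = N * mdeg x)%N.
  rewrite /oweight -big_split /= mdegE big_distrr /=; apply: eq_bigr => i _.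
  by rewrite /c; have := ltn_ord i; nia.
suff lt : (\sum_i mu i * c i < \sum_i nu i * c i)%N.
  by have := ocE mu; have := ocE nu; rewrite deg; lia.
have cN i : (c i <= N)%N by apply: leq_subr.
have [j jlt] : exists j : 'I_N,
    (\sum_(i < N | (i <= j)%N) mu i < \sum_(i < N | (i <= j)%N) nu i)%N.
  apply/existsP; apply: contraNT neq; rewrite negb_exists => /forallP H.
  apply/eqP/mnmP/eq_partial_sums => l; apply/eqP; rewrite eqn_leq dom.
  by rewrite leqNgt H.
rewrite !(layer_cake _ cN).
have jN : (N - j.+1 < N)%N by have := ltn_ord j; lia.
have PE (i : 'I_N) : (Ordinal jN < c i)%N = (i <= j)%N.
  by rewrite /c /=; have := ltn_ord i; have := ltn_ord j; lia.
rewrite (bigD1 (Ordinal jN)) //= [X in (_ < X)%N](bigD1 (Ordinal jN)) //=.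
rewrite !(eq_bigl _ _ PE) -addSn leq_add //; apply: leq_sum => t _.
by apply: sum_down_closed dom => i l il H; apply: leq_trans H (leq_sub2l _ il).
Qed.

Lemma triangle_gt_lower mu nu : triangle_gt nu mu -> lower (@nat_of_ord N) mu nu.
Proof.
case/andP => /eqP deg /orP[/dominance_sqdeg H|/andP[/eqP E H]].
  by rewrite /lower deg eqxx H.
rewrite /lower deg eqxx (dominance_oweight H) // andbT orbC.
suff -> : sqdeg mu = sqdeg nu by rewrite eqxx.
by rewrite -(sqdeg_plus mu) -(sqdeg_plus nu) E.
Qed.

End Dominance.

Section Fractions.
Variable R : idomainType.

Lemma fraction_ex (x : {fraction R}) : exists a b, b != 0 /\ x = tofrac a / tofrac b.
Proof.
elim/quotW: x => y; exists (\n_y), (\d_y); split; first exact: denom_ratioP.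
have d0 : tofrac \d_y != 0 :> {fraction R} by rewrite tofrac_eq0 denom_ratioP.
apply: (mulIf d0); rewrite divfK //; unlock tofrac.
rewrite -[LHS]FracField.pi_mul; apply/eqmodP => /=.
rewrite /FracField.equivf /FracField.mulf /= !numden_Ratio ?oner_eq0 ?mulf_neq0 ?denom_ratioP //.
all: rewrite ?oner_eq0 ?mulr1 ?denom_ratioP //.
by rewrite mulrC.
Qed.

(* [S] is a multiplicative set of admissible denominators. *)
Lemma clear_denominators (S : R -> Prop) (n : nat) (Z : {mpoly {fraction R}[n]}) :
  S 1 -> (forall a b, S a -> S b -> S (a * b)) ->
  (forall a, exists x y, [/\ S y, y != 0 & Z@_a * tofrac y = tofrac x]) ->
  exists (d : R) (W : {mpoly R[n]}),
    [/\ S d, d != 0 & map_mpoly (@tofrac _) W = (tofrac d)%:MP * Z].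
Proof.
move=> S1 SM Zfrac; rewrite [Z]mpolyE.
elim: (msupp Z) => [|a s [d [W [Sd d0 WE]]]].
  exists 1, 0; split=> //; first exact: oner_neq0.
  by rewrite big_nil rmorph0 mulr0.
have [x [y [Sy y0 xyE]]] := Zfrac a.
exists (y * d), (y%:MP * W + (x * d)%:MP * 'X_[a]); split; first exact: SM.
  by rewrite mulf_neq0.
rewrite big_cons rmorphD !rmorphM /= WE !map_mpolyC map_mpolyX -mul_mpolyC.
set T := \sum_(b <- s) _.
transitivity ((tofrac y)%:MP * ((tofrac d)%:MP * T)
  + (tofrac x)%:MP * (tofrac d)%:MP * 'X_[a]) => //.
by rewrite -xyE mpolyCM; ring.
Qed.

End Fractions.

Lemma map_mpoly_inj (R S : nzRingType) (f : {rmorphism R -> S}) (n : nat) :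
  injective f -> injective (@map_mpoly n R S f).
Proof.
move=> f_inj p q /mpolyP pq; apply/mpolyP => a; apply: f_inj.
by rewrite -!mcoeff_map_mpoly.
Qed.

Section Indeterminate.
Variable C : numFieldType.

Lemma tofrac_generic (x y : int) :
  x%:~R + y%:~R * tofrac ('X : {poly C}) = 0 -> x = 0 /\ y = 0.
Proof.
rewrite -(rmorph_int (@tofrac _) x) -(rmorph_int (@tofrac _) y) -rmorphM -rmorphD /=.
move/eqP; rewrite tofrac_eq0 => /eqP E.
have := congr1 (fun p : {poly C} => p`_0) E.
have := congr1 (fun p : {poly C} => p`_1) E.
rewrite !coefD !coefMX /= -!(rmorph_int (@polyC C)) !coefC /= add0r addr0.
by move=> /eqP; rewrite intr_eq0 => /eqP ->; move/eqP; rewrite intr_eq0 => /eqP ->.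
Qed.

Lemma tofrac_char0 d : (d.+1)%:R != 0 :> {fraction {poly C}}.
Proof.
by rewrite -(rmorph_nat (@tofrac _)) tofrac_eq0 -polyC_natr polyC_eq0 pnatr_eq0.
Qed.

End Indeterminate.

Section CommonLift.
Variables (A : idomainType) (F1 F2 : fieldType).
Variables (f1 : {rmorphism A -> F1}) (f2 : {rmorphism A -> F2}).
Variables (N : nat) (k : A).
Hypothesis factA : forall d, exists x : A, x * d`!%:R = 1.

(** The p_mu over Q(t) and over C(t) are compared through a common preimage over Q[t]. Inverse
    factorials are the only denominators that it requires. *)
Definition common_lift (p1 : {mpoly F1[N]}) (p2 : {mpoly F2[N]}) :=
  exists w : {mpoly A[N]}, map_mpoly f1 w = p1 /\ map_mpoly f2 w = p2.

Lemma common_liftD p1 p2 q1 q2 : common_lift p1 p2 -> common_lift q1 q2 ->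
  common_lift (p1 + q1) (p2 + q2).
Proof.
by move=> [v [<- <-]] [w [<- <-]]; exists (v + w); rewrite !rmorphD.
Qed.

Lemma common_liftM p1 p2 q1 q2 : common_lift p1 p2 -> common_lift q1 q2 ->
  common_lift (p1 * q1) (p2 * q2).
Proof.
by move=> [v [<- <-]] [w [<- <-]]; exists (v * w); rewrite !rmorphM.
Qed.

Lemma common_lift0 : common_lift 0 0.
Proof. by exists 0; rewrite !rmorph0. Qed.

Definition common_zlift (g1 : zseries F1 N) (g2 : zseries F2 N) :=
  forall mu, common_lift (g1 mu) (g2 mu).

Lemma common_zliftM g1 g2 h1 h2 : common_zlift g1 g2 -> common_zlift h1 h2 ->
  common_zlift (zseriesM g1 h1) (zseriesM g2 h2).
Proof.
move=> Hg Hh mu; rewrite /zseriesM.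
apply: (big_ind2 common_lift common_lift0 common_liftD) => a _.
exact: common_liftM.
Qed.

Lemma common_zlift1 : common_zlift (@zseries1 F1 N) (@zseries1 F2 N).
Proof.
move=> mu; rewrite /zseries1; case: (mu == 0%MM); last exact: common_lift0.
by exists 1; rewrite !rmorph1.
Qed.

Lemma common_zlift_binom x i j :
  common_zlift (zseries_binom (f1 x) j i) (zseries_binom (f2 x) j i).
Proof.
move=> mu; rewrite /zseries_binom; case: eqP => _; last exact: common_lift0.
have [y yE] := factA (mu i).
have map_y (F : fieldType) (f : {rmorphism A -> F}) :
    f (rpoch x (mu i) * y) = pochhammer (f x) (mu i) / (mu i)`!%:R.
  have fy : f y * (mu i)`!%:R = 1 by rewrite -(rmorph_nat f) -rmorphM yE rmorph1.
  have f0 : (mu i)`!%:R != 0 :> F.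
    by apply: contra_eq_neq fy => ->; rewrite mulr0 eq_sym oner_neq0.
  by rewrite rmorphM map_rpoch; apply: (mulIf f0); rewrite divfK // -mulrA fy mulr1.
exists ((rpoch x (mu i) * y) *: 'X_j ^+ mu i).
by rewrite !map_mpolyZ !map_y !rmorphXn /= !map_mpolyX.
Qed.

Lemma common_lift_pJack k1 k2 mu : f1 k = k1 -> f2 k = k2 ->
  common_lift (pJack k1 mu) (pJack k2 mu).
Proof.
move=> <- <-.
have H : common_zlift (pJack (f1 k)) (pJack (f2 k)); last exact: H.
apply: (big_ind2 common_zlift common_zlift1 common_zliftM) => i _.
apply: common_zliftM.
  by rewrite -(rmorph1 f1) -(rmorph1 f2); apply: common_zlift_binom.
apply: (big_ind2 common_zlift common_zlift1 common_zliftM) => j _.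
exact: common_zlift_binom.
Qed.

End CommonLift.

Definition eval_at (C : numFieldType) (c0 : C) : {rmorphism {poly rat} -> C} :=
  horner_eval c0 \o map_poly ratr.

Definition to_ratfun (C : numFieldType) : {rmorphism {poly rat} -> {fraction {poly C}}} :=
  @tofrac {poly C} \o map_poly ratr.

Lemma eval_atE (C : numFieldType) (c0 : C) p : eval_at c0 p = (map_poly ratr p).[c0].
Proof. by []. Qed.

Lemma to_ratfunE (C : numFieldType) p :
  to_ratfun C p = tofrac (map_poly ratr p : {poly C}).
Proof. by []. Qed.

Section Specialization.
Variables (C : numFieldType) (N : nat) (mu : 'X_{1..N}) (Z : {mpoly ratfun[N]}).
Hypothesis hZ : is_nonsym_jack mu Z.
Local Notation o := (@nat_of_ord N).
Local Notation i1 := (@tofrac {poly rat}).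
Local Notation i2 := (to_ratfun C).

Lemma jack_coefficients : exists u : {mpoly ratfun[N]},
  [/\ Z = pexp (pJack kgen) u, u@_mu = 1,
      forall a, u@_a != 0 -> (a == mu) || lower o mu a & homog_at u mu].
Proof.
case: hZ => _ _ [B ZE].
pose v := \sum_(nu : 'X_{1..N < (mdeg mu).+1} | triangle_gt nu mu)
  B nu *: 'X_[nu] : {mpoly ratfun[N]}.
have vsupp a : v@_a != 0 -> triangle_gt a mu.
  apply: contraNT => amu; rewrite /v (raddf_sum (mcoeff a)) /= big1 // => b bmu.
  rewrite mcoeffZ mcoeffX; have [E|_] := eqVneq (b : 'X_{1..N}) a.
    by rewrite E (negbTE amu) in bmu.
  by rewrite mulr0.
have vmu : v@_mu = 0.
  apply/eqP; apply: contraT => /vsupp /triangle_gt_lower.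
  by rewrite lowerxx.
exists ('X_[mu] + v); split.
- rewrite pexpD pexpX ZE; congr (_ + _); rewrite pexp_sum.
  by apply: eq_bigr => b _; rewrite pexpZ pexpX.
- by rewrite mcoeffD mcoeffX eqxx vmu addr0.
- move=> a; rewrite mcoeffD mcoeffX [a == mu]eq_sym; case: (eqVneq mu a) => //= _.
  by rewrite mulr0n add0r => /vsupp /triangle_gt_lower.
move=> a; rewrite mcoeffD mcoeffX; case: (eqVneq mu a) => [->//|_].
by rewrite mulr0n add0r => /vsupp /andP[/eqP].
Qed.

(** The definition of the Jack polynomial only provides some eigenvalues; the left eigenvector
    equation at the leading exponent [mu] determines them. *)
Lemma jack_eigen i : opUo kgen o i Z = (ev kgen o mu i)%:MP * Z.
Proof.
have [u [ZE u1 usupp _]] := jack_coefficients.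
have [Z0 Zeig _] := hZ.
have [e eE] : exists e : 'I_N -> ratfun, forall i, opU kgen i Z = e i *: Z.
  exact: (fin_all_exists Zeig).
have el : left_eigen kgen o u e.
  apply: (@pexp_left_eigen ratfun N kgen (pJack kgen)).
  - exact: tofrac_generic.
  - exact: pJack0.
  - by move=> x y a; apply: pJack_sw; apply: tofrac_char0.
  - by move=> l a; apply: pJack_eq0; apply: tofrac_char0.
  - by move=> l a; apply: pJack_step; apply: tofrac_char0.
  - by move=> a b; apply: pJack_sym; apply: tofrac_char0.
  - exact: val_inj.
  by move=> l; rewrite -ZE -opUE eE mul_mpolyC.
have u0 : u@_mu != 0 by rewrite u1 oner_neq0.
by rewrite -opUE eE -mul_mpolyC
  (left_eigen_value (@val_inj _ _ _) el u0 usupp).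
Qed.

Variables (c0 : C) (z : {mpoly C[N]}).
Hypothesis hz : specializes Z c0 z.
Local Notation at_c0 := (eval_at c0).

(** Each coefficient of Z has a denominator that does not vanish at c0. Their product d keeps this
    property, so z is recovered from W at c0 by cancelling d(c0). *)
Lemma specialization_lift : exists (d : {poly rat}) (W : {mpoly {poly rat}[N]}),
  [/\ at_c0 d != 0, map_mpoly i1 W = (i1 d)%:MP * Z
    & map_mpoly at_c0 W = (at_c0 d)%:MP * z].
Proof.
have [||a|d [W [Sd d0 WE]]] := @clear_denominators _ (fun d => at_c0 d != 0) N Z.
- by rewrite rmorph1 oner_neq0.
- by move=> a b a0 b0; rewrite rmorphM mulf_neq0.
- have [x [y [E y0 _]]] := hz a; exists x, y.
  have yn0 : y != 0 by apply: contraNneq y0 => ->; rewrite rmorph0 horner0.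
  by split=> //; rewrite E divfK // tofrac_eq0.
exists d, W; split=> //; apply/mpolyP => a.
rewrite mcoeffCM mcoeff_map_mpoly.
have [x [y [E y0 ->]]] := hz a.
have yn0 : y != 0 by apply: contraNneq y0 => ->; rewrite rmorph0 horner0.
have H : W@_a * y = d * x.
  apply/eqP; rewrite -tofrac_eq !tofracM -mcoeff_map_mpoly WE mcoeffCM E.
  by rewrite -mulrA divfK // tofrac_eq0.
apply: (mulIf y0); rewrite -mulrA divfK //.
by have := congr1 at_c0 H; rewrite !rmorphM.
Qed.

Lemma lift_eigen d W i : d != 0 -> map_mpoly i1 W = (i1 d)%:MP * Z ->
  opUo 'X o i W = (ev 'X o mu i)%:MP * W.
Proof.
move=> d0 WE; apply: (@map_mpoly_inj _ _ i1).
  by move=> x y /eqP; rewrite tofrac_eq => /eqP.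
rewrite map_opUo WE opUo_mulC jack_eigen rmorphM /= map_mpolyC WE mulrCA.
by congr (_%:MP * _); apply/esym/(map_ev i1).
Qed.

Lemma specialized_eigen i : opUo c0 o i z = (ev c0 o mu i)%:MP * z.
Proof.
have [d [W [d0 W1 W2]]] := specialization_lift.
have dn0 : d != 0 by apply: contraNneq d0 => ->; rewrite rmorph0.
have XE : at_c0 'X = c0 by rewrite eval_atE map_polyX hornerX.
have evE : at_c0 (ev 'X o mu i) = ev c0 o mu i.
  by rewrite -[in RHS]XE; apply: (map_ev at_c0).
have := map_opUo at_c0 'X o i W.
rewrite (lift_eigen i dn0 W1) (map_mulC at_c0) W2 evE XE.
rewrite opUo_mulC mulrCA => /esym.
by apply: mulfI; rewrite mpolyC_eq0.
Qed.

Variables (m : nat) (q : C) (c : nat -> C).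
Hypothesis m_gt0 : (0 < m)%N.

Lemma specialized_norm :
  form m c0 q c z z * hooks c0 o mu 1 =
  normfactor c0 m q c o mu * hooks c0 o mu (c0 + 1).
Proof.
have [d2 [W [d2c W1 W2]]] := specialization_lift.
have d20 : d2 != 0 by apply: contraNneq d2c => ->; rewrite rmorph0.
have [u [ZE u1 _ uhom]] := jack_coefficients.
(* The coefficients in the basis p_mu may have poles at c0 even if Z has none. So [d1] is only known
   to be nonzero and has to be cancelled before the evaluation at c0. *)
have [||a|d1 [U [_ d10 UE]]] := @clear_denominators _ (fun=> True) N u => //.
  by have [x [y [y0 xE]]] := fraction_ex u@_a; exists x, y; rewrite xE divfK ?tofrac_eq0.
have fact_inv d : exists x : {poly rat}, x * d`!%:R = 1.
  exists (d`!%:R^-1)%:P; rewrite -polyC_natr -polyCM mulVf //.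
  by rewrite pnatr_eq0 -lt0n fact_gt0.
have gE : i1 'X = kgen by [].
have kE : i2 'X = tofrac 'X by rewrite to_ratfunE map_polyX.
have lift_pb a := common_lift_pJack (N := N) fact_inv a gE kE.
have [pb pbE] : exists pb : 'X_{1..N < msize U} -> {mpoly {poly rat}[N]}, forall a,
    map_mpoly i1 (pb a) = pJack kgen a /\ map_mpoly i2 (pb a) = pJack (tofrac 'X) a.
  have H (a : 'X_{1..N < msize U}) : exists w : {mpoly {poly rat}[N]},
      map_mpoly i1 w = pJack kgen a /\ map_mpoly i2 w = pJack (tofrac 'X) a.
    have [w [w1 w2]] := lift_pb a; exists w.
    by split; [exact: w1 | exact: w2].
  exact: (fin_all_exists H).
pose Y := \sum_(a : 'X_{1..N < msize U}) (U@_a)%:MP * pb a.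
have YE (F : fieldType) (f : {rmorphism {poly rat} -> F}) k :
    (forall a, map_mpoly f (pb a) = pJack k a) ->
    map_mpoly f Y = pexp (pJack k) (map_mpoly f U).
  move=> fpb; rewrite /Y rmorph_sum [map_mpoly f U](@map_mpolyE _ _ _ _ _ (msize U)) //.
  rewrite pexp_sum; apply: eq_bigr => a _.
  by rewrite /= map_mulC fpb -mul_mpolyC pexp_mulC pexpX.
have Y1 : map_mpoly i1 Y = (i1 d1)%:MP * Z.
  by rewrite (YE _ i1 kgen) ?UE ?pexp_mulC ?ZE // => a; have [] := pbE a.
(* Over Q(t) both sides are d1 d2 Z. *)
have YW : d2%:MP * Y = d1%:MP * W.
  apply: (@map_mpoly_inj _ _ i1); first by move=> x y /eqP; rewrite tofrac_eq => /eqP.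
  by rewrite !(map_mulC i1) Y1 W1 mulrCA.
pose K : fieldType := {fraction {poly C}}; pose k : K := tofrac 'X.
pose u' : {mpoly K[N]} := map_mpoly i2 (d2%:MP * U).
pose P := pexp (@pJack K N k).
have Pu' : P u' = (i2 d1)%:MP * map_mpoly i2 W.
  rewrite /P /u' (map_mulC i2) pexp_mulC -(YE _ i2 k).
    by rewrite -!(map_mulC i2) YW.
  by move=> a; have [] := pbE a.
have eW i : opUo k o i (map_mpoly i2 W) = (ev k o mu i)%:MP * map_mpoly i2 W.
  rewrite /k -kE -(map_opUo i2) (lift_eigen i d20 W1) (map_mulC i2).
  by congr (_%:MP * _); apply: (map_ev i2).
have eu' i : opUo k o i (P u') = (ev k o mu i)%:MP * P u'.
  by rewrite Pu' opUo_mulC eW mulrCA.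
have hu' : homog_at u' mu.
  move=> a; rewrite mcoeff_map_mpoly mcoeffCM => ua; apply: uhom.
  apply: contraNneq ua => ua.
  have : tofrac U@_a == 0 :> ratfun by rewrite -mcoeff_map_mpoly UE mcoeffCM ua mulr0.
  by rewrite tofrac_eq0 => /eqP ->; rewrite mulr0; apply/eqP/(rmorph0 i2).
have Umu : U@_mu = d1.
  by apply/eqP; rewrite -tofrac_eq -mcoeff_map_mpoly UE mcoeffCM u1 mulr1.
(* Only kappa_0 becomes the indeterminate; q and the c l enter as constants, and genericity concerns
   kappa_0 alone. *)
pose qK : K := tofrac q%:P; pose cK l : K := tofrac (c l)%:P.
have gen := @tofrac_generic C.
have char0 := @tofrac_char0 C.
have H : norm_spec k (pJack k) m qK cK u' o mu.
  apply: norm_spec_all => //.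
  - exact: pJack0.
  - by move=> x y a; apply: pJack_sw.
  - by move=> l a; apply: pJack_eq0.
  - by move=> l a; apply: pJack_step.
  - by move=> a b; apply: pJack_sym.
  - exact: val_inj.
have [_ N1] := H.
pose toC : {rmorphism {poly rat} -> {poly C}} := map_poly (@ratr C).
pose V := map_mpoly toC W.
have VW : map_mpoly i2 W = map_mpoly (@tofrac {poly C}) V.
  apply/mpolyP => a; transitivity (tofrac (toC W@_a)).
    exact: (mcoeff_map_mpoly i2).
  apply/esym; rewrite (mcoeff_map_mpoly (@tofrac {poly C})); congr (tofrac _).
  exact: (mcoeff_map_mpoly toC).
have form_P : form m k qK cK (map_mpoly i2 W) (map_mpoly i2 W) =
    tofrac (form m 'X q%:P (fun l => (c l)%:P) V V).
  by rewrite VW -(map_form (@tofrac {poly C})).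
have hooks_P t : hooks k o mu (tofrac t) = tofrac (hooks 'X o mu t).
  by rewrite -(map_hooks (@tofrac {poly C})).
have nf_P : normfactor k m qK cK o mu
    = tofrac (normfactor 'X m q%:P (fun l => (c l)%:P) o mu).
  by rewrite -(map_normfactor (@tofrac {poly C})).
have u'mu : u'@_mu = i2 d2 * i2 d1.
  by rewrite mcoeff_map_mpoly mcoeffCM Umu; apply: (rmorphM i2).
have d1K : i2 d1 != 0 by rewrite to_ratfunE tofrac_eq0 map_poly_eq0.
(* The identity over C(t), with d1 cancelled, is pulled back to C[t], where evaluation at c0 is
   defined. *)
have N2 : form m 'X q%:P (fun l => (c l)%:P) V V * hooks 'X o mu 1
  = toC d2 ^+ 2 * normfactor 'X m q%:P (fun l => (c l)%:P) o mu * hooks 'X o mu ('X + 1).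
  have tofracE (x y v : {poly C}) : tofrac (x ^+ 2 * y * v)
    = tofrac x ^+ 2 * tofrac y * tofrac v by rewrite tofracM tofracM tofracXn.
  apply/eqP; rewrite -tofrac_eq; apply/eqP.
  rewrite [LHS]tofracM tofracE -(hooks_P 1) -(hooks_P ('X + 1)) tofracD tofrac1.
  rewrite -nf_P -form_P -[tofrac (toC d2)]/(i2 d2).
  have d1K2 : i2 d1 ^+ 2 != 0 by rewrite expf_neq0.
  apply: (mulfI d1K2); move: N1; rewrite -/P Pu' form_mulCl form_mulCr // u'mu => N1.
  rewrite -/k; transitivity (i2 d1 * (i2 d1 * form m k qK cK (map_mpoly i2 W) (map_mpoly i2 W))
    * hooks k o mu 1); first by ring.
  by rewrite N1; ring.
pose e0 : {rmorphism {poly C} -> C} := horner_eval c0.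
have e0V : map_mpoly e0 V = (at_c0 d2)%:MP * z.
  rewrite -W2; apply/mpolyP => a; transitivity (e0 (toC W@_a)).
    by rewrite (mcoeff_map_mpoly e0); congr (e0 _); exact: (mcoeff_map_mpoly toC).
  by apply/esym/(mcoeff_map_mpoly at_c0).
have e0X : e0 'X = c0 by apply: hornerX.
have e0C x : e0 x%:P = x by apply: hornerC.
have e0c : e0 \o (fun l => (c l)%:P) = c by apply: boolp.funext => l; apply: e0C.
have := congr1 e0 N2; rewrite [e0 (_ * _ * _)](rmorphM e0) [e0 (_ ^+ 2 * _)](rmorphM e0) (rmorphXn e0)
  [e0 (form _ _ _ _ _ _ * _)](rmorphM e0) (map_form e0) !(map_hooks e0).
rewrite (map_normfactor e0) e0V (rmorphD e0) (rmorph1 e0) e0X e0C.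
rewrite e0c form_mulCl form_mulCr // -[e0 (toC d2)]/(at_c0 d2) => E.
have d2K : at_c0 d2 ^+ 2 != 0 by rewrite expf_neq0.
apply: (mulfI d2K); move: E; set f := form _ _ _ _ _ _ => E.
transitivity (at_c0 d2 * (at_c0 d2 * f) * hooks c0 o mu 1); first by ring.
by rewrite E; ring.
Qed.

End Specialization.

(** * Sorted compositions and hook products *)

Section SortingRank.
Variable n : nat.
Implicit Types (g : 'X_{1..n}) (i j s : 'I_n) (o : 'I_n -> nat).

Lemma mnm_plus_perm g (f : 'I_n -> 'I_n) : injective f ->
  (forall i j, (f i <= f j)%N -> (g j <= g i)%N) ->
  forall i, mnm_plus g (f i) = g i.
Proof.
move=> f_inj f_mono i; pose f' := invF f_inj.
have geq_trans : transitive geq by move=> y x z; rewrite /geq /=; lia.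
pose h : n.-tuple nat := [tuple g (f' p) | p < n].
have hE : sort geq (g : n.-tuple nat) = h.
  apply: (sorted_eq geq_trans) => [x y|||].
  - by rewrite /geq /=; lia.
  - by apply: sort_sorted => x y; rewrite /geq /=; lia.
  - apply/(sortedP 0%N) => p; rewrite size_tuple => pn.
    have pn' := ltn_trans (ltnSn p) pn.
    rewrite -(tnth_nth _ h (Ordinal pn')) -(tnth_nth _ h (Ordinal pn)) !tnth_mktuple.
    by apply: f_mono; rewrite !f_invF /=.
  rewrite perm_sort; apply/tuple_permP; exists (perm (can_inj (f_invF f_inj)))^-1%g.
  apply: (@eq_from_nth _ 0%N); rewrite !size_tuple // => p pn.
  rewrite -[p]/(nat_of_ord (Ordinal pn)) -!tnth_nth !tnth_mktuple.
  by congr (g _); rewrite -[LHS](permKV (perm (can_inj (f_invF f_inj)))) permE.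
rewrite /mnm_plus multinomE (tnth_nth 0%N) /= hE -tnth_nth tnth_mktuple.
by rewrite /f' invF_f.
Qed.

Lemma rk_ltE o g i j : injective o ->
  (rk o g i < rk o g j)%N = (g j < g i)%N || (g i == g j) && (o i < o j)%N.
Proof.
move=> o_inj.
have half x y : (g y < g x)%N || (g x == g y) && (o x < o y)%N -> (rk o g x < rk o g y)%N.
  move=> xy; apply: proper_card; apply/properP; split.
    by apply/subsetP => s; rewrite !inE; move: xy; lia.
  by exists x; rewrite !inE; [move: xy; lia | lia].
apply/idP/idP; last exact: half.
apply: contraTT => nij; rewrite -leqNgt.
have [->//|ij] := eqVneq i j.
have oij : o i != o j by rewrite (inj_eq o_inj).
by apply/ltnW/half; move: nij oij; lia.
Qed.

Lemma rk_bound o g i : (rk o g i < n)%N.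
Proof.
rewrite -[X in (_ < X)%N]card_ord; apply: proper_card; apply/properP; split.
  exact/subsetP.
by exists i; rewrite // !inE; lia.
Qed.

Definition ord_rk o g i : 'I_n := Ordinal (rk_bound o g i).

Lemma ord_rk_inj o g : injective o -> injective (ord_rk o g).
Proof.
move=> o_inj i j /(congr1 val) /= E; apply/eqP; apply: contraT => ij.
have oij : o i != o j by rewrite (inj_eq o_inj).
have : (rk o g i < rk o g j)%N || (rk o g j < rk o g i)%N.
  by rewrite !rk_ltE //; lia.
by rewrite E ltnn.
Qed.

Lemma ord_rk_bij o g : injective o -> bijective (ord_rk o g).
Proof. by move/(ord_rk_inj (g := g))/injF_bij. Qed.

Lemma mnm_plus_rk o g i : injective o -> mnm_plus g (ord_rk o g i) = g i.
Proof.
move=> o_inj; apply: mnm_plus_perm; first exact: ord_rk_inj.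
by move=> x y /=; rewrite leqNgt rk_ltE //; lia.
Qed.

(** Adding 0 or 1 cannot reverse a strict inequality, and among equal entries of g the nonincreasing
    alpha adds the 1s to the earlier indices. So the ranking of g also sorts g + chi_l(alpha). *)
Lemma mnm_plus_chi_rk m g (alpha : 'X_{1..n}) l i :
  standard_parity_type m alpha ->
  mnm_plus (g + chi l alpha) (ord_rk (@nat_of_ord n) g i)
  = (g i + (l <= alpha i))%N.
Proof.
case=> _ adec.
have E x : (g + chi l alpha)%MM x = (g x + (l <= alpha x))%N by rewrite mnmDE mnmE.
rewrite -E; apply: mnm_plus_perm; first exact/ord_rk_inj/val_inj.
move=> x y /=; rewrite leqNgt rk_ltE; last exact: val_inj.
rewrite !E; have [xy|yx] := leqP x y; first by have := adec x y xy; lia.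
by have := adec y x (ltnW yx); lia.
Qed.

End SortingRank.

Section Pochhammer.
Variables (F : fieldType) (n : nat) (k : F).
Implicit Types (g : 'X_{1..n}) (o : 'I_n -> nat) (t : F).

Lemma opoch_plus o g t : injective o ->
  pochhammer_part k t (mnm_plus g) = opoch k o g t.
Proof.
move=> o_inj; rewrite /pochhammer_part /opoch.
rewrite (reindex (ord_rk o g)) /=; last exact/onW_bij/ord_rk_bij.
by apply: eq_bigr => i _; rewrite mnm_plus_rk.
Qed.

Lemma rpochD (x : F) d e : rpoch x (d + e) = rpoch x d * rpoch (x + d%:R) e.
Proof.
rewrite /rpoch big_split_ord /=; congr (_ * _).
by apply: eq_bigr => j _; rewrite natrD addrA.
Qed.

Lemma pochhammer_part_chi m g (alpha : 'X_{1..n}) l t :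
  standard_parity_type m alpha ->
  pochhammer_part k t (mnm_plus (g + chi l alpha)) =
  opoch k (@nat_of_ord n) g t *
  \prod_(i | (l <= alpha i)%N) (t - (rk (@nat_of_ord n) g i)%:R * k + (g i)%:R).
Proof.
move=> std; rewrite /pochhammer_part /opoch.
rewrite (reindex (ord_rk (@nat_of_ord n) g)) /=; last exact/onW_bij/ord_rk_bij/val_inj.
rewrite [X in _ * X]big_mkcond -big_split; apply: eq_bigr => i _ /=.
rewrite (mnm_plus_chi_rk _ _ _ std) [LHS]rpochD; congr (_ * _).
by case: leqP; rewrite /rpoch ?big_ord1 ?big_ord0 ?addr0.
Qed.

End Pochhammer.

Section HookRatio.
Variables (F : fieldType) (n : nat) (k : F) (g : 'X_{1..n}).
Implicit Types (o : 'I_n -> nat) (t : F).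

Lemma hooks_plus o t : injective o ->
  (forall i j, (o i < o j)%N -> (g j <= g i)%N) ->
  hooks k o g t = hook k (mnm_plus g) t.
Proof.
move=> o_inj srt.
have rkE i s : (rk o g i < rk o g s)%N = (o i < o s)%N.
  rewrite rk_ltE //; have := srt i s; have := srt s i.
  have [->|is_] := eqVneq i s; first by rewrite !ltnn eqxx.
  have : o i != o s by rewrite (inj_eq o_inj).
  lia.
rewrite /hook big_mkcond (reindex (ord_rk o g)) /=; last exact/onW_bij/ord_rk_bij.
apply: eq_bigr => i _; rewrite mnm_plus_rk //; case: posnP => [->|gi].
  by rewrite big_ord0.
(* Reversing the product replaces the column j by the arm a = g i - j. *)
rewrite big_nat_rev big_add1 /= big_mkord; apply: eq_bigr => a _.
have aE : (1 + (g i).+1 - a.+2 = g i - a)%N by lia.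
rewrite aE subKn ?(ltnW (ltn_ord a)) //; congr (_ + _ * _%:R).
rewrite /leg -(card_imset _ (ord_rk_inj (g := g) o_inj)); apply: eq_card => p.
rewrite inE; have [f' fK f'K] := ord_rk_bij g o_inj.
rewrite -[p]f'K mem_imset ?inE; last exact: ord_rk_inj.
rewrite mnm_plus_rk // rkE; set s := f' p; have := srt i s; have := srt s i; lia.
Qed.

(** Numerator (x = k or -k) and denominator (x = 0) of the products E_+ and E_-. *)
Definition inversion_prod o (e : 'I_n -> F) (x : F) : F :=
  \prod_(p : 'I_n * 'I_n | (o p.1 < o p.2)%N && (g p.1 < g p.2)%N) (e p.2 - e p.1 + x).

(** Induction on the pairs with the smaller exponent first. An adjacent swap removes one pair,
    changes [hooks] by the factor belonging to it, and leaves the eigenvalues [e] alone. With no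
    pair left the order sorts g, and [hooks] is the hook product of the partition. *)
Lemma hooks_inversion o (e : 'I_n -> F) : injective o -> (forall i, e i = ev k o g i) ->
  hooks k o g 1 * inversion_prod o e (- k) =
    hook k (mnm_plus g) 1 * inversion_prod o e 0 /\
  hooks k o g (k + 1) * inversion_prod o e 0 =
    hook k (mnm_plus g) (k + 1) * inversion_prod o e k.
Proof.
have r_split x y z : (x < y)%N -> (x < z)%N || (z < y)%N by lia.
move: {-1}(inversions o ltn g) (leqnn (inversions o ltn g)) => d.
have base o1 : injective o1 ->
  (forall p : 'I_n * 'I_n, ~~ ((o1 p.1 < o1 p.2)%N && (g p.1 < g p.2)%N)) ->
  hooks k o1 g 1 * inversion_prod o1 e (- k) =
    hook k (mnm_plus g) 1 * inversion_prod o1 e 0 /\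
  hooks k o1 g (k + 1) * inversion_prod o1 e 0 =
    hook k (mnm_plus g) (k + 1) * inversion_prod o1 e k.
  move=> o_inj no; have I1 x : inversion_prod o1 e x = 1.
    by rewrite /inversion_prod big_pred0 // => p; apply/negbTE.
  have srt i j : (o1 i < o1 j)%N -> (g j <= g i)%N.
    by move=> oij; have := no (i, j); rewrite /= oij -leqNgt.
  by rewrite !I1 !mulr1 !(hooks_plus _ o_inj srt).
elim: d o => [|d IH] o od o_inj eE.
  apply: base => // p; apply/negP => pI; move: od.
  by rewrite leqn0 cards_eq0 => /eqP/setP/(_ p); rewrite !inE pI.
have [/existsP[[x y] /= /andP[oxy gxy]]|no] :=
  boolP [exists p : 'I_n * 'I_n, (o p.1 < o p.2)%N && (g p.1 < g p.2)%N]; last first.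
  by apply: base => // p; move: no; rewrite negb_exists => /forallP.
have [i [j [oij gij adj]]] := adjacent_inversion r_split oxy gxy.
pose o' := o \o tperm i j.
have o'_inj : injective o' by exact: inj_comp o_inj (@perm_inj _ _).
have ij : i != j by apply: contraTneq oij => ->; rewrite ltnn.
have o'ij : (o' j < o' i)%N by rewrite /o' /= tpermL tpermR.
have adj' l : ~~ ((o' j < o' l)%N && (o' l < o' i)%N).
  rewrite /o' /= tpermL tpermR.
  case: tpermP => [_|_|_ _]; rewrite ?ltnn ?andbF //; exact: adj.
have oE : o' \o tperm j i = o.
  by apply: boolp.funext => l; rewrite /o' /= tpermC tpermK.
have gij' : g i != g j by rewrite ltn_eqF.
have e'E l : e l = ev k o' g l by rewrite /o' (ev_swap k o_inj oij adj gij').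
have [|E1 Ek] := IH o' _ o'_inj e'E.
  by rewrite -ltnS (leq_trans _ od) // inversions_swap // -leqNgt ltnW.
have gji' : g j != g i by rewrite eq_sym.
(* The swap identities start from the order with the larger exponent first, so they are applied to
   [o'] and lead back to [o]. *)
have H1 := hooks_swap1 k o'_inj o'ij adj' gji' gij; rewrite oE -!e'E in H1.
have Hk := hooks_swapk k o'_inj o'ij adj' gji' gij; rewrite oE -!e'E in Hk.
have IE v : inversion_prod o e v = (e j - e i + v) * inversion_prod o' e v.
  rewrite /inversion_prod (bigD1 (i, j)) /=; last by rewrite oij.
  congr (_ * _); apply: eq_bigl => -[a b] /=.
  have [E|nij] := eqVneq (a, b) (i, j).
    by case: E => -> ->; rewrite andbF ltnNge (ltnW o'ij).
  rewrite andbT; have [E|nji] := eqVneq (a, b) (j, i).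
    by case: E => -> ->; rewrite (ltnNge (g j)) (ltnW gij) !andbF.
  have [->|ab] := eqVneq a b; first by rewrite !ltnn.
  by rewrite (swap_order_lt o_inj oij adj).
rewrite !IE addr0; split.
  rewrite [LHS]mulrA H1.
  transitivity (hooks k o' g 1 * inversion_prod o' e (- k) * (e j - e i)); first by ring.
  by rewrite E1; ring.
rewrite [LHS]mulrA Hk.
transitivity (hooks k o' g (k + 1) * inversion_prod o' e 0 * (e j - e i + k)); first by ring.
by rewrite Ek; ring.
Qed.

End HookRatio.

Section ClosedForm.
Variables (F : fieldType) (N : nat) (k : F) (g : 'X_{1..N}).
Local Notation o := (@nat_of_ord N).
Hypothesis xi_neq0 : forall i j : 'I_N, (i < j)%N -> (g i < g j)%N ->
  xi k g j - xi k g i != 0.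
Hypothesis hook_neq0 : hook k (mnm_plus g) 1 != 0.

Lemma EfactorE eps : Efactor eps k g =
  inversion_prod g o (xi k g) (eps * k) / inversion_prod g o (xi k g) 0.
Proof.
rewrite /Efactor pair_big_dep /= /inversion_prod -prodf_div.
apply: eq_bigr => -[i j] /= /andP[ij gij]; have := xi_neq0 ij gij.
by rewrite addr0 => X0; rewrite mulrDl divff.
Qed.

Lemma norm_closed_form (A nf : F) :
  A * hooks k o g 1 = nf * hooks k o g (k + 1) ->
  A = nf * (hook k (mnm_plus g) (k + 1) / hook k (mnm_plus g) 1)
      * Efactor 1 k g * Efactor (-1) k g.
Proof.
move=> E; rewrite !EfactorE mul1r mulN1r.
have [E1 Ek] := hooks_inversion (@val_inj _ _ _ : injective o) (xiE k g).
move: E1 Ek; set I0 := inversion_prod _ _ _ 0; set Ik := inversion_prod _ _ _ k.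
set In := inversion_prod _ _ _ (- k) => E1 Ek.
have I00 : I0 != 0.
  by apply/prodf_neq0 => -[i j] /= /andP[ij gij]; rewrite addr0 xi_neq0.
have nz : hook k (mnm_plus g) 1 * I0 * I0 != 0 by rewrite !mulf_neq0.
apply: (mulfI nz).
transitivity (nf * (hook k (mnm_plus g) (k + 1) * Ik) * In).
  rewrite -Ek -E1.
  transitivity (A * hooks k o g 1 * In * I0); first by ring.
  by rewrite E; ring.
by field; rewrite I00 hook_neq0.
Qed.

End ClosedForm.

(** * Dunkl operators of G(m,1,N) *)

Section SubstPow.
Variables (F : fieldType) (n m : nat).
Implicit Types (p q h : {mpoly F[n]}) (i j : 'I_n) (a b : 'X_{1..n}).
Local Notation sp := (@subst_pow F m n).

Lemma subst_powM p q : sp (p * q) = sp p * sp q.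
Proof. by rewrite /subst_pow rmorphM. Qed.

Lemma subst_powD p q : sp (p + q) = sp p + sp q.
Proof. by rewrite /subst_pow rmorphD. Qed.

Lemma subst_powB p q : sp (p - q) = sp p - sp q.
Proof. by rewrite /subst_pow rmorphB. Qed.

Lemma subst_powC x : sp x%:MP = x%:MP.
Proof. exact: comp_mpolyC. Qed.

Lemma subst_powZ x p : sp (x *: p) = x *: sp p.
Proof. exact: comp_mpolyZ. Qed.

Lemma subst_pow0 : sp 0 = 0.
Proof. exact: comp_mpoly0. Qed.

Lemma subst_powX a : sp 'X_[a] = 'X_[(a *+ m)%MM].
Proof.
rewrite /subst_pow comp_mpolyX [RHS]mpolyXE_id; apply: eq_bigr => i _.
by rewrite tnth_mktuple -exprM mulmnE mulnC.
Qed.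

Lemma subst_powXU i : sp 'X_i = 'X_i ^+ m.
Proof. by rewrite subst_powX mpolyXn. Qed.

Lemma sw_subst_pow i j h : sw i j (sp h) = sp (sw i j h).
Proof.
elim/mpolyind: h => [|c a h _ _ IH].
  by rewrite subst_pow0 (linear0 (sw i j)) subst_pow0.
rewrite subst_powD subst_powZ !swD !swZ subst_powD subst_powZ IH subst_powX !sw_mnm.
rewrite subst_powX; congr (_ *: 'X_[_] + _); apply/mnmP => l.
by rewrite !(mnmE, mulmnE).
Qed.

Lemma mderiv_subst_pow i h : (0 < m)%N ->
  (sp h)^`M(i) = (m%:R)%:MP * 'X_i ^+ m.-1 * sp h^`M(i).
Proof.
move=> m_gt0; elim/mpolyind: h => [|c a h _ _ IH].
  by rewrite subst_pow0 !raddf0 subst_pow0 mulr0.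
rewrite subst_powD subst_powZ subst_powX !mderivD !mderivZ subst_powD subst_powZ.
rewrite IH mulrDr; congr (_ + _); rewrite -scalerAr; congr (_ *: _).
rewrite !mderivX subst_powZ subst_powX mulmnE.
have [->|ai] := posnP (a i); first by rewrite mul0n !scale0r mulr0.
have -> : (a *+ m - U_(i) = U_(i) *+ m.-1 + (a - U_(i)) *+ m)%MM.
  apply/mnmP => l; rewrite !(mnmBE, mnmDE, mulmnE, mnm1E).
  by case: eqVneq => [<-|_]; nia.
by rewrite mpolyXD -mpolyXn mulrC natrM -!mul_mpolyC mpolyCM; ring.
Qed.

Definition xmul b h : {mpoly F[n]} := 'X_[b] * sp h.

Lemma sw_xmul i j b h : sw i j (xmul b h) = xmul (swm i j b) (sw i j h).
Proof. by rewrite /xmul swM sw_mnm sw_subst_pow. Qed.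

Lemma xmulD b g h : xmul b (g + h) = xmul b g + xmul b h.
Proof. by rewrite /xmul subst_powD mulrDr. Qed.

Lemma xmul_mulC b x h : xmul b (x%:MP * h) = x%:MP * xmul b h.
Proof. by rewrite /xmul subst_powM subst_powC mulrCA. Qed.

End SubstPow.

(** * Quotients by x_i - eta^s x_j *)

Section ReflectionQuotient.
Variables (F : fieldType) (n m : nat) (eta : F).
Hypothesis eta_prim : m.-primitive_root eta.
Implicit Types (h : {mpoly F[n]}) (i j : 'I_n) (b : 'X_{1..n}) (z : F).
Local Notation sp := (@subst_pow F m n).
Local Notation T := {mpoly F[n]}.

Lemma mpolyCX x d : (x%:MP : T) ^+ d = (x ^+ d)%:MP.
Proof. by rewrite rmorphXn. Qed.

Definition geo (u v : T) d : T := \sum_(r < d) u ^+ (d.-1 - r) * v ^+ r.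

Lemma geoE u v d : (u - v) * geo u v d = u ^+ d - v ^+ d.
Proof. by rewrite subrXX. Qed.

Lemma root_sum e d : e != d -> (e < d + m)%N -> (d < e + m)%N ->
  \sum_(s < m) (eta ^+ s) ^+ e / (eta ^+ s) ^+ d = 0.
Proof.
move=> ed lt1 lt2.
have eta0 : eta != 0.
  by apply: contra_eq_neq (prim_expr_order eta_prim) => ->;
    rewrite expr0n gtn_eqF ?(prim_order_gt0 eta_prim) // eq_sym oner_neq0.
pose w := eta ^+ e / eta ^+ d.
have w1 : w != 1.
  rewrite /w; apply/eqP => E.
  have : eta ^+ e == eta ^+ d.
    by rewrite -[X in X == _](divfK (expf_neq0 d eta0)) E mul1r.
  rewrite (eq_prim_root_expr eta_prim).
  have nd x y : (x < y)%N -> (y < x + m)%N -> ~ (y == x %[mod m])%N.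
    move=> xy yx; rewrite (eqn_mod_dvd _ (ltnW xy)) gtnNdvd //; lia.
  have [lt|lt|/eqP] := ltngtP e d; last by rewrite (negbTE ed).
    by rewrite eq_sym; apply: (nd _ _ lt lt2).
  exact: (nd _ _ lt lt1).
have wm : w ^+ m = 1.
  by rewrite expr_div_n -!exprM !(mulnC _ m) !exprM (prim_expr_order eta_prim) !expr1n divr1.
have w10 : w - 1 != 0 by rewrite subr_eq0.
apply: (mulfI w10); rewrite mulr0.
rewrite (eq_bigr (fun s : 'I_m => w ^+ s)) => [|s _].
  by rewrite -subrX1 wm subrr.
by rewrite /w expr_div_n -!exprM !(mulnC s).
Qed.

Lemma root_sum_eq d : \sum_(s < m) (eta ^+ s) ^+ d / (eta ^+ s) ^+ d = m%:R :> F.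
Proof.
have eta0 : eta != 0.
  by apply: contra_eq_neq (prim_expr_order eta_prim) => ->;
    rewrite expr0n gtn_eqF ?(prim_order_gt0 eta_prim) // eq_sym oner_neq0.
rewrite (eq_bigr (fun=> 1)) => [|s _]; last by rewrite divff // !expf_neq0.
by rewrite sumr_const card_ord.
Qed.

Variables (i j : 'I_n).
Hypothesis ij : i != j.
Local Notation tw z := (z%:MP * 'X_j : T).

Lemma sum_twisted_geo d e f : 
  \sum_(s < m) (((eta ^+ s) ^+ d)^-1)%:MP * (tw (eta ^+ s)) ^+ e * geo 'X_i (tw (eta ^+ s)) f
  = \sum_(r < f) 'X_i ^+ (f.-1 - r) * 'X_j ^+ (e + r)
     * (\sum_(s < m) (eta ^+ s) ^+ (e + r) / (eta ^+ s) ^+ d)%:MP.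
Proof.
rewrite /geo; under eq_bigr do rewrite mulr_sumr.
rewrite exchange_big; apply: eq_bigr => r _.
rewrite rmorph_sum mulr_sumr /=; apply: eq_bigr => s _.
rewrite !exprMn !mpolyCX !mpolyCM (exprD 'X_j) (exprD (eta ^+ s)) mpolyCM; ring.
Qed.

Lemma sum_twisted_geo_pos d f : (0 < f <= m)%N ->
  \sum_(s < m) (((eta ^+ s) ^+ d)^-1)%:MP * (tw (eta ^+ s)) ^+ d * geo 'X_i (tw (eta ^+ s)) f
  = (m%:R)%:MP * 'X_i ^+ f.-1 * 'X_j ^+ d.
Proof.
case: f => // f /andP[_ fm]; rewrite sum_twisted_geo big_ord_recl [X in _ + X]big1 ?addr0.
  by rewrite /= subn0 addn0 root_sum_eq mulrC mulrA.
move=> r _; rewrite root_sum ?mulr0 //= ?/bump /=; have := ltn_ord r; lia.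
Qed.

Lemma sum_twisted_geo_neg d e f : (e + f <= d)%N -> (d < e + m)%N ->
  \sum_(s < m) (((eta ^+ s) ^+ d)^-1)%:MP * (tw (eta ^+ s)) ^+ e * geo 'X_i (tw (eta ^+ s)) f
  = 0.
Proof.
move=> efd dem; rewrite sum_twisted_geo big1 // => r _.
by rewrite root_sum ?mulr0 //; have := ltn_ord r; lia.
Qed.

(** Write h = (y_i - y_j) [dd i j h] + (i,j) h. Since z^m = 1, y_i - y_j = x_i^m - (z x_j)^m is
    divisible by x_i - z x_j; what remains is a difference of two monomials in x_i and z x_j. Both
    quotients are geometric sums. *)
Definition refl_quo b h z : T :=
  let X := tw z in let a := b i in let d := b j in
  'X_[mrest i j b] * ((z ^+ d)^-1)%:MP *
    ('X_i ^+ a * X ^+ d * geo 'X_i X m * sp (dd i j h)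
     + (if (d <= a)%N then 'X_i ^+ d * X ^+ d * geo 'X_i X (a - d)
        else - ('X_i ^+ a * X ^+ a * geo 'X_i X (d - a))) * sp (sw i j h)).

Lemma refl_quoE b h z : z ^+ m = 1 -> z != 0 ->
  refl_quo b h z * ('X_i - tw z) =
  xmul m b h - (z ^+ b i / z ^+ b j)%:MP * xmul m (swm i j b) (sw i j h).
Proof.
move=> zm z0; pose a := b i; pose d := b j; pose D := sp (dd i j h); pose H := sp (sw i j h).
have hE : sp h = ('X_i ^+ m - tw z ^+ m) * D + H.
  rewrite exprMn mpolyCX zm mpolyC1 mul1r -!subst_powXU -subst_powB -subst_powM ddP //.
  by rewrite -subst_powD subrK.
have GE : (if (d <= a)%N then 'X_i ^+ d * tw z ^+ d * geo 'X_i (tw z) (a - d)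
        else - ('X_i ^+ a * tw z ^+ a * geo 'X_i (tw z) (d - a))) * ('X_i - tw z)
    = 'X_i ^+ a * tw z ^+ d - 'X_i ^+ d * tw z ^+ a.
  case: leqP => da; rewrite ?mulNr -!mulrA [geo _ _ _ * _]mulrC geoE.
    have aE : a = (d + (a - d))%N by rewrite subnKC.
    rewrite [in RHS]aE !exprD; ring.
  have dE : d = (a + (d - a))%N by rewrite subnKC // ltnW.
  rewrite [in RHS]dE !exprD; ring.
rewrite /xmul (mpolyX_rest _ b ij) (mpolyX_rest _ (swm i j b) ij) -/a -/d hE.
have -> : mrest i j (swm i j b) = mrest i j b.
  apply/mnmP => l; rewrite !mnmE; case: eqVneq => //= li; case: eqVneq => //= lj.
  by rewrite tpermD // eq_sym.
have -> : swm i j b i = d by rewrite mnmE tpermL.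
have -> : swm i j b j = a by rewrite mnmE tpermR.
rewrite /refl_quo -/a -/d -/D -/H.
transitivity ('X_[mrest i j b] * ((z ^+ d)^-1)%:MP *
   ('X_i ^+ a * tw z ^+ d * (('X_i - tw z) * geo 'X_i (tw z) m) * D
    + ((if (d <= a)%N then 'X_i ^+ d * tw z ^+ d * geo 'X_i (tw z) (a - d)
        else - ('X_i ^+ a * tw z ^+ a * geo 'X_i (tw z) (d - a))) * ('X_i - tw z)) * H)).
  by ring.
rewrite GE geoE.
have zd : ((z ^+ d)^-1)%:MP * tw z ^+ d = 'X_j ^+ d.
  by rewrite exprMn mulrA mpolyCX -mpolyCM mulVf ?expf_neq0 // mpolyC1 mul1r.
have za : ((z ^+ d)^-1)%:MP * tw z ^+ a = (z ^+ a / z ^+ d)%:MP * 'X_j ^+ a.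
  by rewrite exprMn mulrA mpolyCX -mpolyCM [(z ^+ d)^-1 * _]mulrC.
transitivity ('X_[mrest i j b] * (
   'X_i ^+ a * (((z ^+ d)^-1)%:MP * tw z ^+ d) * (('X_i ^+ m - tw z ^+ m) * D + H)
    - 'X_i ^+ d * (((z ^+ d)^-1)%:MP * tw z ^+ a) * H)); first by ring.
by rewrite zd za; ring.
Qed.

(** Averaging over the roots of unity keeps the powers of x_j congruent to b j modulo m, that is,
    the first terms of the geometric sums. In the sum attached to the exchange term this power
    occurs only if b j < b i. *)
Lemma sum_refl_quo b h : (b i < m)%N -> (b j < m)%N ->
  \sum_(s < m) refl_quo b h (eta ^+ s) =
  xmul m (low m i b) ((m%:R)%:MP * (if b i == 0%N then dd i j h
     else 'X_i * dd i j h + (if (b j < b i)%N then sw i j h else 0))).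
Proof.
move=> am dm; have m_gt0 := prim_order_gt0 eta_prim.
set a := b i; set d := b j; set D := sp (dd i j h); set H := sp (sw i j h).
pose W : T := 'X_[mrest i j b].
pose t e f (s : 'I_m) : T := (((eta ^+ s) ^+ d)^-1)%:MP * tw (eta ^+ s) ^+ e
  * geo 'X_i (tw (eta ^+ s)) f.
have red v e f :
    (forall s : 'I_m, refl_quo b h (eta ^+ s) = W * 'X_i ^+ a * D * t d m s + v * t e f s) ->
    \sum_(s < m) refl_quo b h (eta ^+ s) =
      W * 'X_i ^+ a * D * ((m%:R)%:MP * 'X_i ^+ m.-1 * 'X_j ^+ d) + v * \sum_s t e f s.
  move=> E; rewrite (eq_bigr _ (fun s _ => E s)) big_split -!mulr_sumr /=.
  by rewrite /t sum_twisted_geo_pos ?m_gt0 ?leqnn.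
have -> : \sum_(s < m) refl_quo b h (eta ^+ s) =
    W * ((m%:R)%:MP * ('X_i ^+ a * 'X_i ^+ m.-1) * 'X_j ^+ d * D
      + (if (d < a)%N then (m%:R)%:MP * 'X_i ^+ a.-1 * 'X_j ^+ d else 0) * H).
  have [da|ad] := leqP d a.
    rewrite (red (W * 'X_i ^+ d * H) d (a - d)%N); last first.
      by move=> s; rewrite /refl_quo -/a -/d -/D -/H da /t /W /=; ring.
    have [lt|ge] := ltnP d a.
      rewrite /t sum_twisted_geo_pos; last by lia.
      have -> : (a.-1 = d + (a - d).-1)%N by lia.
      by rewrite exprD; ring.
    have -> : \sum_s t d (a - d)%N s = 0.
      apply: big1 => s _; have -> : (a - d = 0)%N by lia.
      by rewrite /t /geo big_ord0 mulr0.
    by ring.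
  rewrite (red (- (W * 'X_i ^+ a * H)) a (d - a)%N); last first.
    by move=> s; rewrite /refl_quo -/a -/d -/D -/H leqNgt ad /t /W /=; ring.
  rewrite /t sum_twisted_geo_neg; [|by lia|by move: dm; rewrite -/d; lia].
  by rewrite ltnNge (ltnW ad) /=; ring.
have lowE : 'X_[low m i b] = W * ('X_i ^+ (if a == 0%N then m.-1 else a.-1) * 'X_j ^+ d) :> T.
  rewrite (mpolyX_rest _ _ ij) low_eq low_neq 1?eq_sym // -/a -/d; congr ('X_[_] * _).
  by apply/mnmP => l; rewrite !mnmE; case: eqVneq.
rewrite xmul_mulC /xmul lowE; have [a0|a0] := eqVneq a 0%N.
  by rewrite a0 ltn0 expr0 -/D; ring.
rewrite subst_powD subst_powM subst_powXU -/D.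
have -> : 'X_i ^+ a * 'X_i ^+ m.-1 = 'X_i ^+ a.-1 * 'X_i ^+ m :> T.
  by rewrite -!exprD; congr (_ ^+ _); lia.
by case: ifP => _; rewrite ?subst_pow0 -/H; ring.
Qed.

End ReflectionQuotient.

Section RootOfUnity.
Variables (R : realType) (m : nat).
Hypothesis m_gt0 : (0 < m)%N.
Local Notation C := (R[i]).
Local Notation theta := (2 * trigo.pi / m%:R : R).

Lemma eta_expE d : eta R m ^+ d =
  (trigo.cos (d%:R * theta) +i* trigo.sin (d%:R * theta))%C.
Proof.
elim: d => [|d IH]; first by rewrite expr0 mul0r trigo.cos0 trigo.sin0.
have E : d.+1%:R * theta = d%:R * theta + theta by rewrite -natr1 mulrDl mul1r.
rewrite exprSr IH E trigo.cosD trigo.sinD /eta.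
apply/eqP; rewrite eq_complex /= eqxx /=; apply/eqP; ring.
Qed.

Lemma eta_prim : m.-primitive_root (eta R m).
Proof.
have m0 : m%:R != 0 :> R by rewrite pnatr_eq0 -lt0n.
apply/andP; split=> //; apply/forallP => -[d /= dm]; rewrite unity_rootE.
apply/eqP; move: dm; rewrite leq_eqVlt => /orP[/eqP E|dm].
  rewrite E eqxx eta_expE; apply/eqP; rewrite [_ * _]mulrC divfK //.
  by rewrite mulr_natl trigo.cos2pi trigo.sin2pi.
rewrite ltn_eqF //; apply/negP => /eqP.
rewrite eta_expE => /(congr1 (@complex.Re R)) /=.
(* Half the angle lies strictly between 0 and pi, where the sine is positive, whereas cos(2y) = 1
   would force sin y = 0. *)
pose y := d.+1%:R * trigo.pi / m%:R : R.
have -> : d.+1%:R * theta = y + y by rewrite /y; field.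
have y_gt0 : 0 < trigo.sin y.
  apply: trigo.sin_gt0_pi; apply/andP; split.
    by rewrite /y !mulr_gt0 ?invr_gt0 ?ltr0n // trigo.pi_gt0.
  rewrite /y ltr_pdivrMr ?ltr0n // mulrC ltr_pM2l ?trigo.pi_gt0 //.
  by rewrite ltr_nat.
rewrite trigo.cosD => H.
have := trigo.cos2Dsin2 y; rewrite !expr2 => H2.
have : trigo.sin y * trigo.sin y = 0.
  have -> : trigo.sin y * trigo.sin y = ((trigo.cos y * trigo.cos y + trigo.sin y * trigo.sin y)
    - (trigo.cos y * trigo.cos y - trigo.sin y * trigo.sin y)) / 2 by field.
  by rewrite H H2 subrr mul0r.
by move/eqP; rewrite mulf_eq0 orbb gt_eqF.
Qed.

End RootOfUnity.

Section DunklAction.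
Variables (R : realType) (m N : nat) (kappa : m.-tuple R).
Hypothesis m_gt0 : (0 < m)%N.
Local Notation C := (R[i]).
Implicit Types (i j : 'I_N) (b : 'X_{1..N}) (p h : {mpoly C[N]}) (s : int).
Local Notation eta := (eta R m).
Let eta_prim : m.-primitive_root eta := eta_prim R m_gt0.

Lemma eta_neq0 : eta != 0.
Proof.
apply: contra_eq_neq (prim_expr_order eta_prim) => ->.
by rewrite expr0n gtn_eqF // eq_sym oner_neq0.
Qed.

Lemma tau_mlin i s p :
  tau m i s p = mlin (fun a => (eta ^ (s * (a i)%:Z)) *: 'X_[a]) p.
Proof. by apply: eq_bigr => a _; rewrite scalerA mulrC. Qed.

Lemma tau_xmul i s b h :
  tau m i s (xmul m b h) = (eta ^ (s * (b i)%:Z))%:MP * xmul m b h.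
Proof.
rewrite tau_mlin; elim/mpolyind: h => [|x a h _ _ IH].
  by rewrite /xmul subst_pow0 !mulr0 mlin0.
rewrite xmulD.
rewrite mlinD.
rewrite [X in _ + X = _]IH.
rewrite -[x *: _]mul_mpolyC.
rewrite xmul_mulC.
rewrite mulrDr.
rewrite [x%:MP * _]mul_mpolyC.
rewrite mlinZ -[x *: xmul _ _ _]mul_mpolyC.
congr (_ + _).
rewrite [RHS]mulrCA -[LHS]mul_mpolyC; congr (_ * _).
rewrite /xmul subst_powX -mpolyXD mlinX -mul_mpolyC; congr (_%:MP * _).
rewrite mnmDE mulmnE.
have E : eta ^ (s * (a i * m)%N%:Z) = 1.
  rewrite PoszM mulrA mulrC -exprz_exp -exprnP (prim_expr_order eta_prim).
  exact: exp1rz.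
by rewrite PoszD mulrDr expfzDr ?eta_neq0 // E mulr1.
Qed.

Let q : C := m%:R.
Let k : C := (kappa`_0)%:C%C.
Let c (l : nat) : C := l%:R / m%:R + (kappa`_l)%:C%C.

Lemma dunkl_reflections i j b h : j != i -> (b i < m)%N -> (b j < m)%N ->
  \sum_(s < m) exact_quo (xmul m b h
     - tau m i (- s%:Z) (swap i j (tau m i s%:Z (xmul m b h))))
     ('X_i - eta ^+ s *: 'X_j) =
  xmul m (low m i b) (q%:MP * (if b i == 0%N then dd i j h
     else 'X_i * dd i j h + (if (b j < b i)%N then sw i j h else 0))).
Proof.
move=> ji bi bj; have ij : i != j by rewrite eq_sym.
rewrite -(sum_refl_quo eta_prim ij) //; apply: eq_bigr => s _.
have z0 : eta ^+ s != 0 by rewrite expf_neq0 // eta_neq0.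
apply: exact_quoE.
  apply/eqP => /(congr1 (mcoeff U_(i))).
  rewrite mcoeffB mcoeffZ !mcoeffXU eqxx eq_sym (negbTE ij) mulr0 subr0 mcoeff0.
  by move/eqP; rewrite oner_eq0.
rewrite -mul_mpolyC refl_quoE //; last first.
  by rewrite -exprM mulnC exprM (prim_expr_order eta_prim) expr1n.
congr (_ - _); rewrite swapE tau_xmul sw_mulC sw_xmul -[in RHS]xmul_mulC tau_xmul.
apply/esym.
rewrite xmul_mulC [LHS]mulrA -mpolyCM mnmE tpermL; congr (_%:MP * _).
rewrite mulNr -invr_expz mulrC -!exprz_exp -!exprnP.
by [].
Qed.

(** x^b h(y) is an eigenvector of tau_i with eigenvalue eta^(b_i), so the sum over s selects t =
    b_i. *)
Lemma dunkl_torus i t b h : (b i < m)%N -> (1 <= t < m)%N ->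
  exact_quo (\sum_(s < m) eta ^- (s * t) *: tau m i s%:Z (xmul m b h)) 'X_i =
  if b i == t then xmul m (low m i b) (q%:MP * h) else 0.
Proof.
move=> bi /andP[t0 tm].
have X0 : 'X_i != 0 :> {mpoly C[N]} by rewrite -msize_poly_eq0 msizeX.
have -> : \sum_(s < m) eta ^- (s * t) *: tau m i s%:Z (xmul m b h)
    = (\sum_(s < m) (eta ^+ s) ^+ b i / (eta ^+ s) ^+ t)%:MP * xmul m b h.
  rewrite rmorph_sum mulr_suml /=; apply: eq_bigr => s _.
  rewrite tau_xmul -mul_mpolyC [LHS]mulrA -mpolyCM; congr (_%:MP * _).
  by rewrite -exprz_exp -!exprnP [LHS]mulrC [eta ^+ (s * t)]exprM.
have [E|bt] := eqVneq (b i) t.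
  rewrite E (root_sum_eq eta_prim); apply: exact_quoE => //.
  rewrite xmul_mulC -mulrA; congr (_ * _); rewrite /xmul mulrAC; congr (_ * _).
  rewrite -mpolyXD; congr 'X_[_]; apply/mnmP => l.
  rewrite mnmDE mnm1E mnmE [i == l]eq_sym; have [->|_] := eqVneq l i.
    by rewrite E gtn_eqF // addn1 prednK.
  by rewrite addn0.
rewrite (root_sum eta_prim bt) ?mul0r; [|lia|lia].
by apply: exact_quoE => //; rewrite mul0r.
Qed.

(** Origin of [c]: m c(b_i) = b_i + m kappa_{b_i}, with b_i from the derivative of x_i^(b_i) and m
    kappa_{b_i} from the torus term. *)
Lemma dunkl_xmul i b h : (forall j, b j < m)%N ->
  dunkl kappa i (xmul m b h) = xmul m (low m i b) (q%:MP * levelop k c i b h).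
Proof.
move=> bm; rewrite /dunkl.
have -> : \sum_(j < N | j != i) \sum_(s < m) exact_quo (xmul m b h
     - tau m i (- s%:Z) (swap i j (tau m i s%:Z (xmul m b h))))
     ('X_i - eta ^+ s *: 'X_j)
  = \sum_(j < N | j != i) xmul m (low m i b) (q%:MP * (if b i == 0%N then dd i j h
     else 'X_i * dd i j h + (if (b j < b i)%N then sw i j h else 0))).
  by apply: eq_bigr => j ji; apply: dunkl_reflections.
have -> : \sum_(1 <= t < m) (kappa`_t)%:C%C *:
      exact_quo (\sum_(s < m) eta ^- (s * t) *: tau m i s%:Z (xmul m b h)) 'X_i
  = if b i == 0%N then 0 else
    xmul m (low m i b) ((q * (kappa`_(b i))%:C%C)%:MP * h).
  rewrite (eq_big_nat _ _ (F2 := fun t => if b i == t then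
     (kappa`_t)%:C%C *: xmul m (low m i b) (q%:MP * h) else 0)); last first.
    by move=> t tm; rewrite dunkl_torus //; case: ifP; rewrite ?scaler0.
  have [b0|b0] := eqVneq (b i) 0%N.
    by rewrite big_nat_cond big1 // => t /andP[/andP[t1 _] _]; rewrite b0 ltn_eqF.
  rewrite (bigD1_seq (b i)) ?iota_uniq //=; last first.
    by rewrite mem_index_iota bm lt0n b0.
  rewrite eqxx big1 ?addr0 => [|t tb]; last by rewrite eq_sym (negbTE tb).
  by rewrite -mul_mpolyC -xmul_mulC [X in xmul _ _ X]mulrA -mpolyCM [_ * q]mulrC.
have xsum (P : pred 'I_N) G : \sum_(j < N | P j) xmul m (low m i b) (G j)
    = xmul m (low m i b) (\sum_(j < N | P j) G j).
  by rewrite /xmul -mulr_sumr /subst_pow rmorph_sum.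
rewrite xsum -mulr_sumr -mul_mpolyC -!xmul_mulC.
have -> : (xmul m b h)^`M(i) = xmul m (low m i b) (if b i == 0%N then q%:MP * h^`M(i)
    else ((b i)%:R)%:MP * h + q%:MP * ('X_i * h^`M(i))).
  rewrite /xmul mderivM mderiv_subst_pow // mderivX -mul_mpolyC.
  have [b0|b0] := eqVneq (b i) 0%N.
    rewrite b0 mpolyC0 !mul0r add0r subst_powM subst_powC.
    have -> : low m i b = (b + U_(i) *+ m.-1)%MM.
      apply/mnmP => l; rewrite mnmE mnmDE mulmnE mnm1E [i == l]eq_sym.
      by have [->|_] := eqVneq l i; rewrite ?b0 ?eqxx ?mul1n ?mul0n ?addn0.
    by rewrite mpolyXD -mpolyXn; ring.
  have lowE : low m i b = (b - U_(i))%MM.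
    apply/mnmP => l; rewrite mnmE mnmBE mnm1E [i == l]eq_sym (negbTE b0).
    by have [->|_] := eqVneq l i; rewrite ?subn0 ?subn1.
  have bE : b = (low m i b + U_(i))%MM.
    by rewrite lowE submK // lep1mP.
  have XbE : 'X_[b] = 'X_[low m i b] * 'X_i :> {mpoly C[N]} by rewrite {1}bE mpolyXD.
  have Xm : 'X_i ^+ m = 'X_i * 'X_i ^+ m.-1 :> {mpoly C[N]} by rewrite -exprS prednK.
  have spE : subst_pow m (((b i)%:R)%:MP * h + q%:MP * ('X_i * h^`M(i)))
      = ((b i)%:R)%:MP * subst_pow m h + q%:MP * ('X_i ^+ m * subst_pow m h^`M(i)).
    by rewrite subst_powD 3!subst_powM 2!subst_powC subst_powXU.
  rewrite -lowE spE XbE Xm -[(m%:R)%:MP]/(q%:MP).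
  move: (subst_pow m h) (subst_pow m _) (q%:MP) ((b i)%:R%:MP) ('X_i ^+ m.-1)
    => x1 x2 x3 x4 x5; ring.
rewrite /levelop; have [b0|b0] := eqVneq (b i) 0%N.
  rewrite addr0 -xmulD opDlE; congr (xmul m _ _).
  by rewrite (eq_bigr (fun j => dd i j h)) //; ring.
rewrite -!xmulD opKE opDlE; congr (xmul m _ _).
have cE : q%:MP * (c (b i))%:MP = ((b i)%:R)%:MP + (q * (kappa`_(b i))%:C%C)%:MP :> {mpoly C[N]}.
  rewrite -mpolyCM -mpolyCD; congr _%:MP; rewrite /c mulrDr; congr (_ + _).
  by rewrite /q mulrC divfK // pnatr_eq0 -lt0n.
have sE : \sum_(j < N | j != i) ('X_i * dd i j h + (if (b j < b i)%N then sw i j h else 0))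
  = 'X_i * (\sum_(j < N | j != i) dd i j h) + \sum_(j < N | (b j < b i)%N) sw i j h.
  rewrite big_split -mulr_sumr /= -big_mkcondr; congr (_ + _); apply: eq_bigl => j.
  by case: eqVneq => [->|_] /=; rewrite ?ltnn.
rewrite [RHS]mulrDr [X in _ = X + _]mulrA cE sE.
move: (\sum_(j < N | j != i) _) (\sum_(j < N | (b j < b i)%N) _) => s1 s2.
move: (_ * (kappa`_(b i))%:C%C)%:MP (q%:MP) (k%:MP) ((b i)%:R%:MP) h^`M(i)
  => x1 x2 x3 x4 x5; ring.
Qed.

Lemma dunkl_fold_xmul a b h (l : seq 'I_N) : (forall j, b j < m)%N ->
  let st := foldr (fun i st => iter (a i) (dstep m k q c i) st) (b, h) l in
  reduced m st /\
  foldr (fun i f => iter (a i) (dunkl kappa i) f) (xmul m b h) l = xmul m st.1 st.2.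
Proof.
move=> bm /=; elim: l => [|i l [IH1 IH2]]; first by split; [exact: bm | reflexivity].
rewrite [foldr _ (xmul m b h) _]/= IH2 [foldr _ _ (i :: l)]/=.
set st := foldr _ _ _ in IH1 *; clearbody st.
elim: (a i) => [|d [r1 E]]; first by rewrite [iter 0 _ st]/= [iter 0 _ _]/=; split; [exact: IH1 | reflexivity].
rewrite !iterS E; split; first exact: dstep_reduced.
exact: dunkl_xmul.
Qed.

Lemma dunkl_mnm_xmul a b h : (forall j, b j < m)%N ->
  dunkl_mnm kappa a (xmul m b h) =
  xmul m (fpow (dstep m k q c) a (b, h)).1 (fpow (dstep m k q c) a (b, h)).2.
Proof. by move=> bm; have [_ E] := dunkl_fold_xmul a h (enum 'I_N) bm; exact: E. Qed.

End DunklAction.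

(** * Lowering x^alpha to 1 *)

Section ParityProduct.
Variables (R : idomainType) (n m : nat) (k q : R) (c : nat -> R).
Hypothesis m_gt0 : (0 < m)%N.
Implicit Types (z h : {mpoly R[n]}) (i j : 'I_n) (a b : 'X_{1..n}).
Local Notation o := (@nat_of_ord n).
Local Notation dpow := (fpow (dstep m k q c)).

Lemma dpow_fst0 a h : (dpow (a *+ m)%MM (0%MM, h)).1 = 0%MM.
Proof.
have r0 g : @reduced R n m (0%MM, g) by move=> j; rewrite mnm0E.
elim/mnm_ind: a => [|i a IH].
  have -> : (0 *+ m = 0 :> 'X_{1..n})%MM by apply/mnmP => l; rewrite mulmnE mnm0E.
  by rewrite dpow0.
have -> : ((U_(i) + a) *+ m = U_(i) *+ m + a *+ m)%MM.
  by apply/mnmP => l; rewrite !(mnmDE, mulmnE) mulnDl.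
rewrite (dpowD _ _ _ m_gt0) //; case: (dpow _ _) IH => x g /= ->.
by rewrite dpowMn iter_dstep0.
Qed.

Definition parity_factor (e : 'I_n -> R) b : R :=
  \prod_i \prod_(1 <= l < (b i).+1) (q * (c l + e i - 1 - k)).

(* Lowering the last nonzero exponent keeps the parity type standard, and there
   the operator of the Dunkl step is [opUo - 1 - k]. *)
Lemma dpow_parity (e : 'I_n -> R) z b :
  (forall i, opUo k o i z = (e i)%:MP * z) -> standard_parity_type m b ->
  dpow b (b, z) = (0%MM, (parity_factor e b)%:MP * z).
Proof.
move=> ez; move: {-1}(mdeg b) (erefl (mdeg b)) => d.
elim: d b => [|d IH] b db [bm bdec].
  move/eqP: db; rewrite mdeg_eq0 => /eqP ->.
  rewrite dpow0 /parity_factor big1 ?mpolyC1 ?mul1r // => i _.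
  by rewrite mnm0E big_nil.
have [i0 bi0] : exists i, b i != 0%N.
  apply/existsP; apply: contra_eqT db; rewrite negb_exists => /forallP b0.
  by rewrite mdegE big1 // => l _; apply/eqP; rewrite -[_ == _]negbK b0.
have [i bi imax] : exists2 i, b i != 0%N & forall j, (i < j)%N -> b j = 0%N.
  case: (@arg_maxnP _ i0 (fun j => b j != 0%N) (@nat_of_ord n) bi0) => i bi imax.
  exists i => // j ij; apply/eqP; apply: contraTT ij => bj.
  by rewrite -leqNgt; apply: (imax j bj).
pose b' := (b - U_(i))%MM.
have bE : b = (b' + U_(i))%MM by rewrite submK // lep1mP.
have lowE : low m i b = b'.
  apply/mnmP => l; rewrite mnmE mnmBE mnm1E [i == l]eq_sym (negbTE bi).
  by have [->|_] := eqVneq l i; rewrite ?subn0 ?subn1.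
have b'E j : b' j = (b j - (i == j))%N by rewrite mnmBE mnm1E.
have std' : standard_parity_type m b'.
  split=> [j|j l jl]; first by rewrite b'E (leq_ltn_trans (leq_subr _ _)).
  rewrite !b'E; have H := bdec j l jl.
  have [E|ij] := eqVneq i j; last by rewrite subn0 (leq_trans (leq_subr _ _)).
  subst j; have [<-//|il] := eqVneq i l.
  have il' : (i < l)%N by rewrite ltn_neqAle jl andbT; exact: il.
  by rewrite (imax l il').
have db' : mdeg b' = d by move: db; rewrite bE mdegD mdeg1 addn1 => -[].
have levE : levelop k c i b z = (c (b i) + e i - 1 - k)%:MP * z.
  rewrite /levelop (negbTE bi).
  have -> : opK k (fun j => (b j < b i)%N) i z = (e i - 1 - k)%:MP * z.
    (* As b is nonincreasing and i is its last nonzero index, the smaller exponents are exactly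
       those after i. *)
    rewrite (@eq_opK _ _ _ (fun j => (b j < b i)%N) (fun j : 'I_n => (i < j)%N)); last first.
      move=> j; have [ij|ji] := ltnP i j; first by rewrite (imax j ij) lt0n bi.
      by apply/negbTE; rewrite -leqNgt bdec.
    have := ez i; rewrite opUoE opDl_mulX opKE.
    have -> : \sum_(j < n | j != i) sw i j z
        = \sum_(j < n | (j < i)%N) sw i j z + \sum_(j < n | (i < j)%N) sw i j z.
      rewrite (bigID (fun j : 'I_n => (j < i)%N)) /=; congr (_ + _); apply: eq_bigl => j.
        by rewrite -(inj_eq val_inj) /=; lia.
      by rewrite -(inj_eq val_inj) /=; lia.
    move=> H; rewrite !mpolyCB !mulrBl -H mpolyC1; ring.
  by rewrite !(mpolyCD, mpolyCB); ring.
have -> : dpow b (b, z) = dpow b' (dpow U_(i)%MM (b, z)).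
  by rewrite {1}bE (dpowD _ _ _ m_gt0).
rewrite dpow1 /dstep /= lowE levE mulrA -mpolyCM dpow_scale IH //=.
rewrite mulrA -mpolyCM; congr (_, _%:MP * _).
rewrite /parity_factor (bigD1 i) //= [in RHS](bigD1 i) //= mulrA; congr (_ * _).
  rewrite b'E eqxx subn1 prednK ?lt0n // [in RHS]big_nat_recr ?lt0n //= mulrC.
  by congr (_ * _).
by apply: eq_bigr => j ji; rewrite b'E eq_sym (negbTE ji) subn0.
Qed.

End ParityProduct.

Section PairingReduction.
Variables (R : realType) (m N : nat) (kappa : m.-tuple R).
Hypothesis m_gt0 : (0 < m)%N.
Local Notation C := (R[i]).
Implicit Types (b : 'X_{1..N}) (p h z : {mpoly C[N]}).
Let q : C := m%:R.
Let k : C := (kappa`_0)%:C%C.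
Let c (l : nat) : C := l%:R / m%:R + (kappa`_l)%:C%C.

Lemma xmulE b z :
  xmul m b z = \sum_(a <- msupp z) z@_a *: 'X_[b + a *+ m].
Proof.
rewrite /xmul {1}[z]mpolyE /subst_pow raddf_sum mulr_sumr; apply: eq_bigr => a _.
rewrite [X in _ * X](subst_powZ m) subst_powX -scalerAr; congr (_ *: _).
by rewrite mpolyXD.
Qed.

Lemma meval_xmul0 h : (xmul m 0%MM h).@[fun=> 0] = h@_0%MM.
Proof.
elim/mpolyind: h => [|x a h _ _ IH].
  by rewrite /xmul subst_pow0 mulr0 meval0 mcoeff0.
rewrite xmulD mevalD [X in _ + X]IH mcoeffD mcoeffZ mcoeffX; congr (_ + _).
rewrite -mul_mpolyC xmul_mulC mevalM mevalC; congr (_ * _).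
rewrite /xmul subst_powX -mpolyXD add0m mevalX.
have [->|a0] := eqVneq a 0%MM.
  by rewrite big1 // => i _; rewrite mulmnE mnm0E expr0.
have [i ai] : exists i, a i != 0%N.
  apply/existsP; apply: contraNT a0; rewrite negb_exists => /forallP H.
  by apply/eqP/mnmP => i; rewrite mnm0E; apply/eqP; rewrite -[_ == _]negbK H.
rewrite (bigD1 i) //= expr0n mulmnE; have -> : (a i * m == 0)%N = false.
  by apply/negbTE; rewrite muln_eq0 negb_or ai -lt0n.
by rewrite mul0r.
Qed.

(** Real coefficients remove the conjugation. In T^(b + m a) the factor T^b is applied first: it
    turns x^b z(y) into a scalar multiple of z(y), on which T^(m a) computes the form. *)
Lemma pairing_xmul (e : 'I_N -> C) b z :
  (forall a, (z@_a)^* = z@_a) -> standard_parity_type m b ->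
  (forall i, opUo k (@nat_of_ord N) i z = (e i)%:MP * z) ->
  pairing kappa (xmul m b z) (xmul m b z) = parity_factor k q c e b * form m k q c z z.
Proof.
move=> zreal std ez; have bm := std.1; pose p := xmul m b z.
have preal a : (p@_a)^* = p@_a.
  rewrite /p xmulE (raddf_sum (mcoeff a)) rmorph_sum; apply: eq_bigr => d _.
  rewrite /= mcoeffZ mcoeffX rmorphM; congr (_ * _); first exact: zreal.
  exact: rmorph_nat.
pose G a : C^o := (dunkl_mnm kappa a p).@[fun=> 0].
have -> : pairing kappa p p = mlin G p.
  rewrite /pairing /mlin raddf_sum; apply: eq_bigr => a _.
  by rewrite /= mevalZ preal.
have GE a : G (b + a *+ m)%MM
    = parity_factor k q c e b * (fpow (dstep m k q c) (a *+ m)%MM (0%MM, z)).2@_0%MM.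
  rewrite /G /p dunkl_mnm_xmul // -/q -/k -/c addmC.
  rewrite (dpowD _ _ _ m_gt0) // (dpow_parity _ _ m_gt0 ez std) dpow_scale.
  by rewrite dpow_fst0 // meval_xmul0 mcoeffCM.
rewrite {1}/p xmulE /form.
have -> : mlin G (\sum_(a <- msupp z) z@_a *: 'X_[b + a *+ m])
    = \sum_(a <- msupp z) z@_a * G (b + a *+ m)%MM.
  elim: (msupp z) => [|a s IH]; first by rewrite !big_nil mlin0.
  by rewrite !big_cons mlinD mlinZ mlinX IH.
rewrite /mlin mulr_sumr; apply: eq_bigr => a _.
by rewrite GE mulrCA.
Qed.

End PairingReduction.

Section FieldMorphism.
Variables (F E : fieldType) (f : {rmorphism F -> E}) (N : nat).
Implicit Types (k t : F) (mu : 'X_{1..N}).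

Lemma map_xi k mu i : f (xi k mu i) = xi (f k) mu i.
Proof. by rewrite !xiE (map_ev f). Qed.

Lemma map_pochhammer_part k t mu :
  f (pochhammer_part k t mu) = pochhammer_part (f k) (f t) mu.
Proof.
rewrite /pochhammer_part rmorph_prod; apply: eq_bigr => i _.
by rewrite [LHS](map_rpoch f) rmorphB rmorphM rmorph_nat.
Qed.

Lemma map_hook k t mu : f (hook k mu t) = hook (f k) mu (f t).
Proof.
rewrite /hook rmorph_prod; apply: eq_bigr => i _; rewrite rmorph_prod.
by apply: eq_bigr => j _; rewrite !rmorphD rmorphM !rmorph_nat.
Qed.

Lemma map_Efactor eps k mu : f (Efactor eps k mu) = Efactor (f eps) (f k) mu.
Proof.
rewrite /Efactor rmorph_prod; apply: eq_bigr => i _; rewrite rmorph_prod.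
apply: eq_bigr => j _.
by rewrite rmorphD rmorph1 fmorph_div rmorphM rmorphB !map_xi.
Qed.

End FieldMorphism.

(** The factor of level l and index i with l <= alpha_i is the next factor in the row of gamma_i of
    the l-th Pochhammer symbol; together they extend gamma to gamma + chi_l(alpha). *)
Lemma parity_norm_product (F : fieldType) (m N : nat) (k q : F) (c : nat -> F)
    (gamma alpha : 'X_{1..N}) : standard_parity_type m alpha ->
  parity_factor k q c (ev k (@nat_of_ord N) gamma) alpha
    * normfactor k m q c (@nat_of_ord N) gamma =
  q ^+ (mdeg alpha + m * mdeg gamma)
    * \prod_(1 <= l < m) pochhammer_part k ((N%:R - 1) * k + c l)
        (mnm_plus (gamma + chi l alpha)%MM)
    * pochhammer_part k (N%:R * k + 1) (mnm_plus gamma).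
Proof.
move=> std; have [am _] := std; set o := @nat_of_ord N.
have o_inj : injective o by exact: val_inj.
pose G l i := (N%:R - 1) * k + c l - (rk o gamma i)%:R * k + (gamma i)%:R.
have PF : parity_factor k q c (ev k o gamma) alpha
    = q ^+ mdeg alpha * \prod_(1 <= l < m) \prod_(i | (l <= alpha i)%N) G l i.
  transitivity (\prod_i (q ^+ alpha i * \prod_(1 <= l < m | (l <= alpha i)%N) G l i)).
    apply: eq_bigr => i _; rewrite big_split prodr_const_nat subn1 /=; congr (_ * _).
    rewrite (big_nat_widen _ _ m) //=; apply: eq_big => [l|l _]; first by rewrite ltnS.
    by rewrite /G /ev; ring.
  rewrite big_split /= mdegE (big_morph _ (exprD q) (expr0 q)); congr (_ * _).
  by rewrite (exchange_big_dep xpredT).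
rewrite PF /normfactor (opoch_plus k gamma _ o_inj).
rewrite [in RHS](eq_bigr (fun l => opoch k o gamma ((N%:R - 1) * k + c l)
  * \prod_(i | (l <= alpha i)%N) G l i)) => [|l _]; last by apply: pochhammer_part_chi std.
rewrite big_split /= exprD.
move: (\prod_(1 <= l < m) opoch _ _ _ _) (\prod_(1 <= l < m) \prod_(i | _) _) => x y.
move: (opoch _ _ _ _) (q ^+ mdeg alpha) (q ^+ (m * _)) => x1 x2 x3; ring.
Qed.

Lemma specializes_real (R : realType) (N : nat) (Z : {mpoly ratfun[N]}) (x : R)
    (z : {mpoly R[i][N]}) : specializes Z x%:C%C z -> forall a, (z@_a)^* = z@_a.
Proof.
move=> hz a; have [u [v [_ _ ->]]] := hz a.
have E (p : {poly rat}) : (map_poly ratr p).[x%:C%C] = ((map_poly ratr p).[x])%:C%C.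
  have -> : map_poly ratr p = map_poly (real_complex R) (map_poly ratr p).
    by apply/polyP => d; rewrite !coef_map /= fmorph_rat.
  exact: horner_map.
rewrite !E -(fmorph_div (real_complex R)); apply: conj_Creal.
by apply/complex_realP; eexists.
Qed.

(** [hzeta] says that the Jack polynomial has no pole at the given kappa_0; [hxi] and [hhook] say
    that the denominators on the right do not vanish. The right-hand side is a real number, and the
    proof carries it into R[i] along the embedding. *)
Theorem theorem3p18 (R : realType) (m N : nat) (hm : (2 <= m)%N) (hN : (1 <= N)%N)
    (kappa : m.-tuple R) (alpha gamma : 'X_{1..N})
    (halpha : standard_parity_type m alpha)
    (Z : {mpoly ratfun[N]}) (hZ : is_nonsym_jack gamma Z)
    (zeta : {mpoly R[i][N]}) (hzeta : specializes Z (kappa`_0)%:C%C zeta)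
    (hxi : forall i j : 'I_N, (i < j)%N -> (gamma i < gamma j)%N ->
       xi kappa`_0 gamma j - xi kappa`_0 gamma i != 0)
    (hhook : hook kappa`_0 (mnm_plus gamma) 1 != 0) :
  pairing kappa ('X_[alpha] * subst_pow m zeta) ('X_[alpha] * subst_pow m zeta) =
  (m%:R ^+ (mdeg alpha + m * mdeg gamma)
   * \prod_(1 <= i < m)
       pochhammer_part kappa`_0 ((N%:R - 1) * kappa`_0 + i%:R / m%:R + kappa`_i)
         (mnm_plus (gamma + chi i alpha)%MM)
   * pochhammer_part kappa`_0 (N%:R * kappa`_0 + 1) (mnm_plus gamma)
   * (hook kappa`_0 (mnm_plus gamma) (kappa`_0 + 1)
      / hook kappa`_0 (mnm_plus gamma) 1)
   * Efactor 1 kappa`_0 gamma * Efactor (-1) kappa`_0 gamma)%:C%C.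

Proof.
pose f : {rmorphism R -> R[i]} := real_complex R.
have m_gt0 : (0 < m)%N by apply: leq_trans hm.
pose k : R[i] := f kappa`_0; pose o := @nat_of_ord N.
pose c l : R[i] := l%:R / m%:R + f kappa`_l.
have ez : forall i, opUo k o i zeta = (ev k o gamma i)%:MP * zeta.
  exact: (specialized_eigen hZ hzeta).
have PX : pairing kappa (xmul m alpha zeta) (xmul m alpha zeta)
    = parity_factor k m%:R c (ev k o gamma) alpha * form m k m%:R c zeta zeta.
  exact: (pairing_xmul m_gt0 (specializes_real hzeta) halpha ez).
have NS : form m k m%:R c zeta zeta * hooks k o gamma 1
    = normfactor k m m%:R c o gamma * hooks k o gamma (k + 1).
  exact: (specialized_norm hZ hzeta m%:R c m_gt0).
have hxiC (i j : 'I_N) : (i < j)%N -> (gamma i < gamma j)%N ->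
    xi k gamma j - xi k gamma i != 0.
  move=> ij gij; rewrite -!(map_xi f) -(rmorphB f) fmorph_eq0.
  exact: hxi.
have hookC : hook k (mnm_plus gamma) 1 != 0.
  by rewrite -(rmorph1 f) -(map_hook f) fmorph_eq0.
have NF := norm_closed_form hxiC hookC NS.
have f6 a b d e g h : f (a * b * d * e * g * h) = f a * f b * f d * f e * f g * f h.
  by rewrite !rmorphM.
transitivity (parity_factor k m%:R c (ev k o gamma) alpha * form m k m%:R c zeta zeta).
  exact: PX.
apply/esym; apply: (eq_trans (f6 _ _ _ _ _ _)).
rewrite (rmorphXn f) (rmorph_nat f) (rmorph_prod f) (fmorph_div f).
rewrite !(map_Efactor f) !(map_hook f) (map_pochhammer_part f).
rewrite (rmorphN1 f) !(rmorph1 f) !(rmorphD f) (rmorphM f) (rmorph_nat f) (rmorph1 f) -/k.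
rewrite (eq_bigr (fun l => pochhammer_part k ((N%:R - 1) * k + c l)
  (mnm_plus (gamma + chi l alpha)%MM))) => [|l _]; last first.
  rewrite (map_pochhammer_part f) !(rmorphD f) (rmorphM f) (rmorphB f) (fmorph_div f).
  by rewrite !(rmorph_nat f) (rmorph1 f) addrA.
by rewrite -(parity_norm_product k m%:R c gamma halpha) NF !mulrA.
Qed.
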